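(* Let $R$ be the ring of integers in a number field and let $\mathfrak p$ be a maximal ideal of $R$ of smallest norm $\mathrm N(\mathfrak p)=|R/\mathfrak p|$. Define $f_1(x)=0$ and, for $k\ge2$, \[f_k(x)=\frac{x^{3k+1}(x^{k-1}-1)(x^{k-1}+1)(x^k-1)}{(x^2+x+1)(x-1)^2(x+1)}\,(x^{3k-2}+x^{2k-2}-x^k-2x^{k-1}-x^{k-2}+x+1).\] For integers $k\ge2$ and $m\ge1$, the smallest number of generators of $\mathrm M_3(R)^m$ as an $R$-algebra equals $k$ if and only if $f_{k-1}(\mathrm N(\mathfrak p))<m\le f_k(\mathrm N(\mathfrak p))$. In particular, the ring $\mathrm M_3(\mathbb Z)^m$ can be generated by $2$ elements if and only if $m\le768$.
   Context: Generation is as unital associative algebra: the non-commutative monomials in the generators (including $1$) span the algebra as an $R$-module. *)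

(* Defs.v *)
From HB Require Import structures.
From mathcomp Require Import all_boot all_order all_algebra all_field.
Set Implicit Arguments. Unset Strict Implicit. Unset Printing Implicit Defensive.
Import Order.TTheory GRing.Theory Num.Theory.
Local Open Scope ring_scope.

Definition ringOfIntegers (K : fieldExtType rat) (x : K) : Prop :=
  exists p : {poly int}, p \is monic /\ root (map_poly (fun z : int => z%:~R) p) x.

Definition is_ideal (A : comNzRingType) (R I : A -> Prop) : Prop :=
  [/\ (forall x, I x -> R x), I 0,
      (forall x y, I x -> I y -> I (x + y)) &
      (forall r x, R r -> I x -> I (r * x))].

Definition maximal_ideal (A : comNzRingType) (R I : A -> Prop) : Prop :=
  [/\ is_ideal R I, ~ I 1 &
      forall J, is_ideal R J -> (forall x, I x -> J x) ->
        (forall x, J x -> I x) \/ J 1].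

Definition quotient_card (A : comNzRingType) (R I : A -> Prop) (n : nat) : Prop :=
  exists s : 'I_n -> A,
    [/\ (forall i, R (s i)),
        (forall i j, I (s i - s j) -> i = j) &
        (forall x, R x -> exists i, I (x - s i))].

(* g : 'I_k -> M_3(R)^m (an element of M_3(R)^m is a family of m
   3x3 matrices with entries in R) generates M_3(R)^m as a unital associative
   R-algebra: every element is an R-linear combination of non-commutative
   monomials (words, including the empty word = 1) in the generators. *)
Definition generates (A : comNzRingType) (R : A -> Prop) (m k : nat)
    (g : 'I_k -> 'I_m -> 'M[A]_3) : Prop :=
  (forall i l a b, R (g i l a b)) /\
  forall x : 'I_m -> 'M[A]_3, (forall l a b, R (x l a b)) ->
    exists s : seq (A * seq 'I_k),
      (forall p, p \in s -> R p.1) /\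
      forall l, x l = \sum_(p <- s) p.1 *: \prod_(i <- p.2) g i l.

Definition min_gens_eq (A : comNzRingType) (R : A -> Prop) (m k : nat) : Prop :=
  (exists g : 'I_k -> 'I_m -> 'M[A]_3, generates R g) /\
  (forall j, (j < k)%N -> ~ exists g : 'I_j -> 'I_m -> 'M[A]_3, generates R g).

(* f_k(x), with f_0 = f_1 = 0 (f_0 is never used by the statement). *)
Definition fk (k : nat) (x : rat) : rat :=
  if (k <= 1)%N then 0 else
  (x ^+ (3 * k + 1) * (x ^+ (k - 1) - 1) * (x ^+ (k - 1) + 1) * (x ^+ k - 1))
  / ((x ^+ 2 + x + 1) * (x - 1) ^+ 2 * (x + 1))
  * (x ^+ (3 * k - 2) + x ^+ (2 * k - 2) - x ^+ k - 2 * x ^+ (k - 1)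
     - x ^+ (k - 2) + x + 1).

(* Main.v *)
(** For a finite field [F] with [q] elements, a k-tuple of 3x3 matrices generates
    [M_3(F)] iff it is irreducible and does not lie in a cubic field [F[C]].  The
    irreducible tuples are counted by summing over all tuples an identity between
    numbers of configurations of common eigenvectors, whose stabilisers are
    coordinate subspaces in a suitable basis.  By Goursat's lemma [m] tuples
    generate [M_3(F)^m] iff they generate [M_3(F)] and are pairwise non-conjugate,
    and since [PGL_3(F)] acts freely on generating tuples this is possible iff
    [m <= f_k(q)].

    Over [R] the generated subalgebra is everything iff it is so modulo every
    maximal ideal: its conductor contains the determinant of any family of words
    in the coordinates (Cramer), which can be made a unit modulo a given ideal.
    To solve all residue fields at once, choose [s = B!] divisible by all small
    residue characteristics, solve modulo [s] by Chinese remaindering, and look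
    for the first two generators on a line [(X + s t N, Y + s t E)] through that
    solution.  The determinant of suitable words on it is a polynomial in [t] with
    leading coefficient a power of [s]; matched with a line that generates
    [M_3(F[t])] over one auxiliary residue field, a resultant gives a nonzero
    constant in the conductor, so only finitely many residue fields, all of them
    large, remain to be avoided by the choice of [t].  Finally [f_k] is increasing
    in [q], so the smallest residue field decides. *)

Require Import Defs.
From HB Require Import structures.
From mathcomp Require Import all_boot all_order all_algebra all_field.
From mathcomp Require Import mxabelem.
From mathcomp Require Import boolp.
From mathcomp Require Import ring lra zify.
Set Implicit Arguments. Unset Strict Implicit. Unset Printing Implicit Defensive.
Import Order.TTheory GRing.Theory Num.Theory.
Local Open Scope ring_scope.

(** The identity behind the count takes the place of Moebius inversion over the lattice of common
    invariant subspaces. Its configuration side is tuned to vanish at every reducible tuple except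
    the scalar ones, whose number is known; so it can be checked one tuple at a time, according to
    the dimension of the span of the common eigenrows.

    The obstacle over [R] is that the determinant on a line vanishes in residue fields that depend
    on the value of t. Hence the need for a conductor element independent of t. It exists because
    over one residue field the conductor of the whole polynomial line contains 1: a lift of 1 is
    coprime there to the determinant, and the resultant of the two does not vanish.

    No ideal theory of Dedekind domains is used. The ring enters through four facts only: it has
    characteristic 0, every nonzero element divides a positive integer, no prime number is a unit,
    and the quotient by a positive integer is finite. Maximal ideals appear as surjections onto
    finite fields. *)

Lemma ord3_ind (P : 'I_3 -> Prop) : P 0 -> P 1 -> P 2 -> forall i, P i.
Proof.
move=> P0 P1 P2 [[|[|[|]]] // lt].
- by rewrite (_ : Ordinal lt = 0) //; apply: val_inj.
- by rewrite (_ : Ordinal lt = 1) //; apply: val_inj.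
by rewrite (_ : Ordinal lt = 2) //; apply: val_inj.
Qed.

(** * Formal non-commutative polynomials and the algebras they generate *)

Section Evaluation.
Variables (A : comNzRingType) (B : algType A) (I : Type).
Implicit Types (h : I -> B) (s t : seq (A * seq I)).

(** The encoding is that of [generates]: a list of coefficients and words, so that one formal
    expression can be evaluated in several rows or after a change of ring. *)
Definition ev h s : B := \sum_(p <- s) p.1 *: \prod_(i <- p.2) h i.

Definition nc_mul s t := [seq (p.1 * r.1, p.2 ++ r.2) | p <- s, r <- t].
Definition nc_const (c : A) : seq (A * seq I) := [:: (c, [::])].
Definition nc_var (i : I) : seq (A * seq I) := [:: (1, [:: i])].

Lemma ev_nil h : ev h [::] = 0.
Proof. by rewrite /ev big_nil. Qed.

Lemma ev_cat h s t : ev h (s ++ t) = ev h s + ev h t.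
Proof. by rewrite /ev big_cat. Qed.

Lemma ev_bigcat h (J : finType) (f : J -> seq (A * seq I)) :
  ev h (\big[cat/[::]]_j f j) = \sum_j ev h (f j).
Proof. by apply: (big_morph (ev h)) => [s t|]; rewrite ?ev_cat ?ev_nil. Qed.

Lemma ev_mul h s t : ev h (nc_mul s t) = ev h s * ev h t.
Proof.
rewrite /ev /nc_mul big_allpairs_dep /= mulr_suml; apply: eq_bigr => p _.
rewrite mulr_sumr; apply: eq_bigr => r _ /=.
by rewrite big_cat /= -scalerAl -scalerAr scalerA.
Qed.

Lemma ev_const h c : ev h (nc_const c) = c%:A.
Proof. by rewrite /ev big_seq1 big_nil. Qed.

Lemma ev_var h i : ev h (nc_var i) = h i.
Proof. by rewrite /ev !big_seq1 scale1r. Qed.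

Lemma eq_ev h h' s : h =1 h' -> ev h s = ev h' s.
Proof. by move=> e; apply: eq_bigr => p _; congr (_ *: _); apply: eq_bigr. Qed.

End Evaluation.
Arguments nc_const {A I}.
Arguments nc_var {A I}.

Section EvalMatrix.
Variables (A A' : comNzRingType) (phi : {rmorphism A -> A'}) (I : Type).

Definition nc_map (s : seq (A * seq I)) := [seq (phi p.1, p.2) | p <- s].

Lemma map_mx_prod n (r : seq I) (h : I -> 'M[A]_n.+1) :
  map_mx phi (\prod_(i <- r) h i) = \prod_(i <- r) map_mx phi (h i).
Proof.
elim: r => [|i r IH]; first by rewrite !big_nil -[1]/(1%:M) map_scalar_mx rmorph1.
by rewrite !big_cons -IH -!mulmxE map_mxM.
Qed.

Lemma map_ev n (h : I -> 'M[A]_n.+1) s :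
  map_mx phi (ev h s) = ev (fun i => map_mx phi (h i)) (nc_map s).
Proof.
rewrite /ev /nc_map big_map; elim: s => [|p s IH].
  by rewrite !big_nil map_mx0.
by rewrite !big_cons map_mxD map_mxZ IH map_mx_prod.
Qed.

Lemma nc_map_surj : (forall y, exists x, phi x = y) ->
  forall s', exists s, nc_map s = s'.
Proof.
move=> surj; elim=> [|[y r] s' [s <-]]; first by exists [::].
by have [x <-] := surj y; exists ((x, r) :: s).
Qed.
End EvalMatrix.

Section RowAlgebra.
Variables (A : comNzRingType) (I : Type) (L : finType).
Implicit Types (h : I -> L -> 'M[A]_3) (x y : L -> 'M[A]_3).

(** A single expression must serve all rows at once; this is what makes generation of the product
    stronger than generation in each row. *)
Definition rowalg h x := exists s, forall l, ev (fun i => h i l) s = x l.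
Definition rgen h := forall x, rowalg h x.

Lemma rowalg0 h : rowalg h (fun _ => 0).
Proof. by exists [::] => l; rewrite ev_nil. Qed.

Lemma rowalgD h x y : rowalg h x -> rowalg h y -> rowalg h (fun l => x l + y l).
Proof. by move=> [s es] [t et]; exists (s ++ t) => l; rewrite ev_cat es et. Qed.

Lemma rowalgM h x y : rowalg h x -> rowalg h y -> rowalg h (fun l => x l * y l).
Proof. by move=> [s es] [t et]; exists (nc_mul s t) => l; rewrite ev_mul es et. Qed.

Lemma rowalgZ h c x : rowalg h x -> rowalg h (fun l => c *: x l).
Proof.
move=> [s es]; exists (nc_mul (nc_const c) s) => l.
by rewrite ev_mul es ev_const -scalerAl mul1r.
Qed.

Lemma rowalg_var h i : rowalg h (h i).
Proof. by exists (nc_var i) => l; rewrite ev_var. Qed.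

Lemma rowalg_const h c : rowalg h (fun _ => c%:A).
Proof. by exists (nc_const c) => l; rewrite ev_const. Qed.

Lemma rowalg_ext h x y : x =1 y -> rowalg h x -> rowalg h y.
Proof. by move=> e [s es]; exists s => l; rewrite es. Qed.

Lemma rowalg_sum h (J : Type) (r : seq J) (P : pred J) (x : J -> L -> 'M[A]_3) :
  (forall j, P j -> rowalg h (x j)) -> rowalg h (fun l => \sum_(j <- r | P j) x j l).
Proof.
move=> hx; elim: r => [|j r IH].
  by apply: rowalg_ext (rowalg0 h) => l; rewrite big_nil.
case: (boolP (P j)) => Pj.
  by apply: rowalg_ext (rowalgD (hx j Pj) IH) => l; rewrite big_cons Pj.
by apply: rowalg_ext IH => l; rewrite big_cons (negbTE Pj).
Qed.

Lemma rowalgX h x n : rowalg h x -> rowalg h (fun l => x l ^+ n).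
Proof.
move=> hx; elim: n => [|n IH].
  by apply: rowalg_ext (rowalg_const h 1) => l; rewrite expr0 scale1r.
by apply: rowalg_ext (rowalgM hx IH) => l; rewrite exprS.
Qed.

Definition rowdelta (t : L * 'I_3 * 'I_3) (l : L) : 'M[A]_3 :=
  if l == t.1.1 then delta_mx t.1.2 t.2 else 0.

Definition coord x (t : L * 'I_3 * 'I_3) : A := x t.1.1 t.1.2 t.2.

Lemma row_basis x l : x l = \sum_t coord x t *: rowdelta t l.
Proof.
transitivity (\sum_(t : (L * 'I_3) * 'I_3) x t.1.1 t.1.2 t.2 *: rowdelta t l); last by [].
rewrite -(pair_bigA _ (fun a (b : 'I_3) => x a.1 a.2 b *: rowdelta (a, b) l)) /=.
rewrite -(pair_bigA _ (fun m a => \sum_b x m a b *: rowdelta (m, a, b) l)) /=.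
rewrite (bigD1 l) //= [X in _ + X]big1 ?addr0 => [|m /negbTE lm].
  rewrite [LHS]matrix_sum_delta; apply: eq_bigr => a _; apply: eq_bigr => b _.
  by rewrite /rowdelta /= eqxx.
by apply: big1 => a _; apply: big1 => b _; rewrite /rowdelta /= eq_sym lm scaler0.
Qed.

(* The conductor of the generated subalgebra. *)
Definition cond h (r : A) := forall t, rowalg h (fun l => r *: rowdelta t l).

Lemma cond1_rgen h : cond h 1 -> rgen h.
Proof.
move=> c1 x; apply: (@rowalg_ext h (fun l => \sum_t coord x t *: (1 *: rowdelta t l))).
  by move=> l; rewrite [RHS]row_basis; apply: eq_bigr => t _; rewrite scale1r.
by apply: rowalg_sum => t _; apply: rowalgZ.
Qed.

Lemma cond0 h : cond h 0.
Proof. by move=> t; apply: rowalg_ext (rowalg0 h) => l; rewrite scale0r. Qed.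

Lemma condD h r r' : cond h r -> cond h r' -> cond h (r + r').
Proof.
by move=> c c' t; apply: rowalg_ext (rowalgD (c t) (c' t)) => l; rewrite scalerDl.
Qed.

Lemma condM h r r' : cond h r' -> cond h (r * r').
Proof.
by move=> c t; apply: rowalg_ext (rowalgZ r (c t)) => l; rewrite scalerA.
Qed.

Definition coord_mx (b : L * 'I_3 * 'I_3 -> L -> 'M[A]_3) :
    'M[A]_#|{: L * 'I_3 * 'I_3}| :=
  \matrix_(i, j) coord (b (enum_val i)) (enum_val j).

(* Cramer's rule *)
Lemma cond_det h b : (forall t, rowalg h (b t)) -> cond h (\det (coord_mx b)).
Proof.
move=> hb t; set M := coord_mx b.
pose i0 := enum_rank t.
apply: (@rowalg_ext h (fun l => \sum_i (\adj M) i0 i *: b (enum_val i) l)); last first.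
  by apply: rowalg_sum => i _; apply: rowalgZ.
move=> l.
under eq_bigr => i _ do rewrite row_basis scaler_sumr.
rewrite exchange_big /=.
have adjM j : \sum_i (\adj M) i0 i * coord (b (enum_val i)) (enum_val j)
     = (\det M) *+ (i0 == j).
  have /matrixP /(_ i0 j) := mul_adj_mx M; rewrite !mxE => <-.
  by apply: eq_bigr => i _; rewrite [M i j]mxE.
transitivity (\sum_u ((\det M) *+ (i0 == enum_rank u)) *: rowdelta u l).
  apply: eq_bigr => u _; rewrite -adjM scaler_suml.
  by apply: eq_bigr => i _; rewrite scalerA enum_rankK.
rewrite (bigD1 t) //= eqxx mulr1n big1 ?addr0 // => u ut.
by rewrite (inj_eq enum_rank_inj) eq_sym (negbTE ut) mulr0n scale0r.
Qed.
End RowAlgebra.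

Section MapRows.
Variables (A A' : comNzRingType) (phi : {rmorphism A -> A'}) (I : Type) (L : finType).

Lemma map_rowalg (h : I -> L -> 'M[A]_3) x : rowalg h x ->
  rowalg (fun i l => map_mx phi (h i l)) (fun l => map_mx phi (x l)).
Proof. by move=> [s es]; exists (nc_map phi s) => l; rewrite -map_ev es. Qed.

Lemma map_rowdelta t l : map_mx phi (@rowdelta A L t l) = rowdelta A' t l.
Proof.
by rewrite /rowdelta; case: eqP => _; rewrite ?map_mx0 // map_delta_mx.
Qed.

Lemma map_cond (h : I -> L -> 'M[A]_3) r : cond h r ->
  cond (fun i l => map_mx phi (h i l)) (phi r).
Proof.
move=> c t; apply: rowalg_ext (map_rowalg (c t)) => l.
by rewrite map_mxZ map_rowdelta.
Qed.
End MapRows.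

Lemma rowalg_sub (A : comNzRingType) (I J : Type) (L : finType) (f : J -> I)
    (h : I -> L -> 'M[A]_3) x :
  rowalg (fun j => h (f j)) x -> rowalg h x.
Proof.
move=> [s es]; exists [seq (p.1, map f p.2) | p <- s] => l; rewrite -es /ev big_map.
by apply: eq_bigr => p _ /=; rewrite big_map.
Qed.

Lemma cond_unit_rgen (F : fieldType) (I : Type) (L : finType) (h : I -> L -> 'M[F]_3) r :
  r != 0 -> cond h r -> rgen h.
Proof. by move=> r0 /(condM r^-1); rewrite mulVf //; apply: cond1_rgen. Qed.

(** * Burnside's theorem for 3x3 matrices over a finite field *)

Lemma mulmx_unit_eq0 (A : comUnitRingType) m n (X : 'M[A]_n) (v : 'M[A]_(m, n)) :
  X \in unitmx -> v *m X = 0 -> v = 0.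
Proof. by move=> U /(congr1 (mulmxr (invmx X))) /=; rewrite mulmxK // mul0mx. Qed.

Lemma row_neq0 (A : nmodType) m n (X : 'M[A]_(m, n)) : X != 0 -> exists i, row i X != 0.
Proof.
move=> X0; apply/existsP; rewrite -negb_forall; apply: contra X0 => /forallP r0.
by apply/eqP/row_matrixP => i; rewrite row0; apply/eqP.
Qed.

Section Burnside.
Variable F : finFieldType.
Local Notation M := 'M[F]_3.

Definition eigrow (X : M) (v : 'rV[F]_3) := [exists c, v *m X == c *: v].
Definition eigcol (X : M) (w : 'cV[F]_3) := [exists c, X *m w == c *: w].
(** For 3x3 matrices this says that the characteristic polynomial is irreducible, so that F[C] is a
    cubic field. *)
Definition noeig (C : M) := [forall v : 'rV[F]_3, (v != 0) ==> ~~ eigrow C v].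
Definition cent (C : M) : {set M} := [set X : 'M[F]_3 | X *m C == C *m X].
Definition is_scal (X : M) := [exists c, X == c%:M].

Lemma noeigP C (v : 'rV[F]_3) c : noeig C -> v *m C = c *: v -> v = 0.
Proof.
move=> /forallP /(_ v) nC vC; apply: contraTeq isT => v0.
by move: nC; rewrite v0 /= => /existsPn /(_ c); rewrite vC eqxx.
Qed.

(** A cubic without roots is irreducible, hence coprime to the nonzero [p] of degree at most 2;
    Bezout and Cayley-Hamilton then give an inverse of p(C). *)
Lemma noeig_poly_unit C (p : {poly F}) : noeig C -> p != 0 -> (size p <= 3)%N ->
  horner_mx C p \in unitmx.
Proof.
move=> nC p0 sp.
have irr : irreducible_poly (char_poly C).
  apply: cubic_irreducible; first by rewrite size_char_poly.
  move=> x; rewrite -eigenvalue_root_char; apply/negP => /eigenvalueP [v vC v0].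
  by rewrite (noeigP nC vC) eqxx in v0.
have : coprimep p (char_poly C).
  rewrite coprimep_sym irreducible_poly_coprime //; apply/negP => /dvdp_leq.
  by rewrite size_char_poly => /(_ p0) /leq_trans /(_ sp).
move=> /Bezout_eq1_coprimepP [[u w] /= e].
have := congr1 (horner_mx C) e.
rewrite rmorphD !rmorphM /= Cayley_Hamilton mulr0 addr0 rmorph1 => eq1.
by have [] := mulmx1_unit (eq1 : horner_mx C u *m horner_mx C p = 1%:M).
Qed.

(** Evaluation of polynomials of degree at most 2 at C, applied to v, is injective because their
    values are invertible, and therefore bijective by finiteness. *)
Lemma cyclic_row C (v y : 'rV[F]_3) : noeig C -> v != 0 ->
  exists2 p : {poly F}, (size p <= 3)%N & v *m horner_mx C p = y.
Proof.
move=> nC v0; pose f (u : 'rV[F]_3) := v *m horner_mx C (rVpoly u).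
have finj : injective f.
  move=> u1 u2 e; apply/eqP; rewrite -subr_eq0; apply: contraT => d0.
  have du : horner_mx C (rVpoly (u1 - u2)) \in unitmx.
    apply: noeig_poly_unit => //; last exact: size_poly.
    apply: contraNneq d0 => /(congr1 (@poly_rV F 3)).
    by rewrite rVpolyK linear0 => ->.
  have: v *m horner_mx C (rVpoly (u1 - u2)) = 0.
    by rewrite !raddfB /=; apply/eqP; rewrite subr_eq0; apply/eqP.
  by move=> /(mulmx_unit_eq0 du) z0; rewrite z0 eqxx in v0.
have [g fg gf] := injF_bij finj.
by exists (rVpoly (g y)); [exact: size_poly | rewrite -[RHS]gf].
Qed.

Let e1 : 'rV[F]_3 := delta_mx 0 0.
Let e1n0 : e1 != 0.
Proof. by apply/eqP => /matrixP /(_ 0 0); rewrite !mxE /= => /eqP; rewrite oner_eq0. Qed.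

Lemma horner_cent C p : horner_mx C p \in cent C.
Proof. by rewrite inE; apply/eqP; apply: comm_mx_sym; apply: comm_mx_horner. Qed.

Lemma centB C X Y : X \in cent C -> Y \in cent C -> X - Y \in cent C.
Proof. by rewrite !inE => /eqP eX /eqP eY; rewrite mulmxBl mulmxBr eX eY. Qed.

(** The polynomial is chosen to agree with X on [e1]. The difference commutes with C and kills the
    cyclic vector [e1], hence kills every row. *)
Lemma cent_poly C X : noeig C -> X \in cent C ->
  exists2 p : {poly F}, (size p <= 3)%N & X = horner_mx C p.
Proof.
move=> nC cX; have [p sp ep] := cyclic_row (e1 *m X) nC e1n0; exists p => //.
apply/eqP; rewrite -subr_eq0; set D := X - _.
have cD : D \in cent C by apply: centB => //; apply: horner_cent.
have eD : e1 *m D = 0 by rewrite mulmxBr ep subrr.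
apply/eqP/row_matrixP => i; rewrite row0 rowE.
have [r _ <-] := cyclic_row (delta_mx 0 i) nC e1n0.
have -> : e1 *m horner_mx C r *m D = e1 *m D *m horner_mx C r.
  rewrite -!mulmxA; congr (_ *m _); apply: comm_mx_sym; apply: comm_mx_horner.
  by move: cD; rewrite inE => /eqP.
by rewrite eD mul0mx.
Qed.

Lemma cent_unit C X : noeig C -> X \in cent C -> X != 0 -> X \in unitmx.
Proof.
move=> nC cX X0; have [p sp eX] := cent_poly nC cX.
by rewrite eX noeig_poly_unit //; apply: contraNneq X0 => p0; rewrite eX p0 rmorph0.
Qed.

Lemma scalar_cent C c : c%:M \in cent C.
Proof. by rewrite inE scalar_mxC. Qed.

Lemma cent_noeig C X : noeig C -> X \in cent C -> ~~ is_scal X -> noeig X.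
Proof.
move=> nC cX /existsPn nX; apply/forallP => v; apply/implyP => v0.
apply/existsPn => c; apply/eqP => vX.
have D0 : X - c%:M != 0 by rewrite subr_eq0 nX.
have := cent_unit nC (centB cX (scalar_cent C c)) D0 => U.
have: v *m (X - c%:M) = 0 by rewrite mulmxBr vX mul_mx_scalar subrr.
by move=> /(mulmx_unit_eq0 U) z0; rewrite z0 eqxx in v0.
Qed.

Lemma noeig_nonscal C : noeig C -> ~~ is_scal C.
Proof.
move=> nC; apply/existsPn => c; apply/eqP => eC.
by move: e1n0; rewrite (@noeigP C e1 c) ?eqxx // eC mul_mx_scalar.
Qed.

Lemma cent_comm C X Y : noeig C -> X \in cent C -> Y \in cent C -> X *m Y = Y *m X.
Proof.
move=> nC cX /(cent_poly nC) [p _ ->]; apply: comm_mx_horner.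
by move: cX; rewrite inE => /eqP.
Qed.

(** A cubic field has no proper intermediate field, so a non-scalar X generates all of F[C].
    Concretely, X again has no eigenrow, and both centralisers are commutative. *)
Lemma cent_eq C X : noeig C -> X \in cent C -> ~~ is_scal X -> cent X = cent C.
Proof.
move=> nC cX sX; have nX := cent_noeig nC cX sX.
have CX : C \in cent X by move: cX; rewrite !inE eq_sym.
apply/setP => Y; rewrite !inE; apply/eqP/eqP => e.
  by apply: (cent_comm nX) => //; rewrite inE e.
by apply: (cent_comm nC) => //; rewrite inE e.
Qed.

Lemma card_cent C : noeig C -> #|cent C| = (#|F| ^ 3)%N.
Proof.
move=> nC; have <- : #|[set: 'rV[F]_3]| = (#|F| ^ 3)%N by rewrite cardsT card_mx mul1n.
rewrite -(@card_in_imset _ _ (fun X => e1 *m X) (cent C)); last first.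
  move=> X Y cX cY /= e; apply/eqP; rewrite -subr_eq0; apply: contraT => D0.
  have U := cent_unit nC (centB cX cY) D0.
  have: e1 *m (X - Y) = 0 by rewrite mulmxBr e subrr.
  by move=> /(mulmx_unit_eq0 U) /eqP; rewrite (negbTE e1n0).
congr #|pred_of_set _|; apply/setP => y; rewrite in_setT; apply/imsetP.
by have [p _ <-] := cyclic_row y nC e1n0; exists (horner_mx C p) => //; apply: horner_cent.
Qed.

Section Tuple.
Variables (I : finType) (h : I -> M).

(** A proper nonzero invariant subspace of the row space is a line or a plane, and an invariant
    plane is the kernel of a common eigencolumn. *)
Definition irrtuple :=
  [forall v : 'rV[F]_3, (v != 0) ==> ~~ [forall i, eigrow (h i) v]] &&
  [forall w : 'cV[F]_3, (w != 0) ==> ~~ [forall i, eigcol (h i) w]].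

Definition inalg (x : M) := exists s, ev h s = x.
Definition sgen := forall x, inalg x.

Lemma inalgD x y : inalg x -> inalg y -> inalg (x + y).
Proof. by move=> [s <-] [t <-]; exists (s ++ t); rewrite ev_cat. Qed.
Lemma inalgM x y : inalg x -> inalg y -> inalg (x *m y).
Proof. by move=> [s <-] [t <-]; exists (nc_mul s t); rewrite ev_mul. Qed.
Lemma inalgC c : inalg c%:M.
Proof. by exists (nc_const c); rewrite ev_const scalemx1. Qed.
Lemma inalgZ c x : inalg x -> inalg (c *: x).
Proof. by move=> ax; rewrite -mul_scalar_mx; apply: inalgM => //; apply: inalgC. Qed.
Lemma inalg0 : inalg 0.
Proof. by exists [::]; rewrite ev_nil. Qed.
Lemma inalgB x y : inalg x -> inalg y -> inalg (x - y).
Proof. by move=> ax ay; rewrite -scaleN1r; apply: inalgD => //; apply: inalgZ. Qed.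
Lemma inalg_var i : inalg (h i).
Proof. by exists (nc_var i); rewrite ev_var. Qed.
Lemma inalg_sum (J : finType) (x : J -> M) (P : pred J) :
  (forall j, P j -> inalg (x j)) -> inalg (\sum_(j | P j) x j).
Proof. by move=> ax; apply: big_ind => //; [apply: inalg0 | apply: inalgD]. Qed.
Lemma inalg_horner C p : inalg C -> inalg (horner_mx C p).
Proof.
move=> aC; elim/poly_ind: p => [|p c IH]; first by rewrite rmorph0; apply: inalg0.
rewrite rmorphD rmorphM /= horner_mx_X horner_mx_C.
by apply: inalgD; [apply: inalgM | apply: inalgC].
Qed.

(** For linear [f] this row space is the image under [f] of the generated algebra. *)
Definition orbmx (f : M -> 'rV[F]_3) := (\sum_(x : M | `[<inalg x>]) <<f x>>)%MS.

Lemma sub_orbmx f x : inalg x -> (f x <= orbmx f)%MS.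
Proof. by move=> ax; rewrite (sumsmx_sup x) ?genmxE //; apply/asboolP. Qed.

Lemma orbmxP (f : {linear M -> 'rV[F]_3}) y : (y <= orbmx f)%MS ->
  exists2 x, inalg x & f x = y.
Proof.
move=> /sub_sumsmxP [u ->].
have /choice [c ec] : forall x : M, exists c, u x *m <<f x>>%MS = c *: f x.
  by move=> x; apply/sub_rVP; apply: submx_trans (submxMl _ _) _; rewrite genmxE.
exists (\sum_(x | `[<inalg x>]) c x *: x).
  by apply: inalg_sum => x /asboolP ax; apply: inalgZ.
by rewrite linear_sum; apply: eq_bigr => x _; rewrite linearZ ec.
Qed.

Lemma orbmx_full (f : {linear M -> 'rV[F]_3}) :
  (forall w : 'cV[F]_3, (forall x, inalg x -> f x *m w = 0) -> w = 0) ->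
  forall y, exists2 x, inalg x & f x = y.
Proof.
move=> ann y; apply: orbmxP; apply: submx_full; rewrite -cokermx_eq0.
apply/eqP/matrixP => i j; rewrite mxE.
have /matrixP /(_ i 0) : col j (cokermx (orbmx f)) = 0; last by rewrite !mxE.
apply: ann => x ax; have /submxP [D ->] := sub_orbmx f ax.
by rewrite colE -mulmxA (mulmxA (orbmx f)) mulmx_coker mul0mx mulmx0.
Qed.

Hypothesis irrh : irrtuple.

Lemma irr_row (v : 'rV[F]_3) : v != 0 -> exists i, ~~ eigrow (h i) v.
Proof.
case/andP: irrh => /forallP /(_ v) + _ v0; rewrite v0 /= => /forallPn [i ni].
by exists i.
Qed.

Lemma irr_col (w : 'cV[F]_3) : w != 0 -> exists i, ~~ eigcol (h i) w.
Proof.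
case/andP: irrh => _ /forallP /(_ w) + w0; rewrite w0 /= => /forallPn [i ni].
by exists i.
Qed.

(** The orbit of v is invariant. If it had rank 1, v would be a common eigenrow; if it had rank 2,
    the column orthogonal to it would be a common eigencolumn. *)
Lemma irr_transitive (v y : 'rV[F]_3) : v != 0 -> exists2 x, inalg x & v *m x = y.
Proof.
move=> v0; apply: (orbmxP (f := (mulmx v : {linear M -> 'rV[F]_3}))).
set U := orbmx _.
have stU i : (U *m h i <= U)%MS.
  rewrite {1}/U /orbmx sumsmxMr_gen; apply/sumsmx_subP => x /asboolP ax.
  rewrite genmxE (eqmxMr _ (genmxE _)) -mulmxA.
  by apply: (sub_orbmx (mulmx v)); apply: inalgM => //; apply: inalg_var.
have vU : (v <= U)%MS.
  by rewrite -[v]mulmx1; apply: (sub_orbmx (mulmx v)); apply: inalgC.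
apply: submx_full; rewrite -col_leq_rank leqNgt; apply/negP => r3.
have rU : (0 < \rank U)%N.
  by apply: leq_trans (mxrankS vU); rewrite lt0n mxrank_eq0.
have [r1|r2] : \rank U = 1%N \/ \rank U = 2%N.
  by move: rU r3; case: (\rank U) => [|[|[|]]] // _ _; [left|right].
  have [i /existsPn nv] := irr_row v0.
  have: (v *m h i <= v)%MS.
    apply: submx_trans (submxMr _ vU) _; apply: submx_trans (stU i) _.
    rewrite -(mxrank_leqif_sup vU) r1 rank_rV v0 //.
  by move=> /sub_rVP [c ec]; move: (nv c); rewrite ec eqxx.
pose K := kermx U^T.
have rK : \rank K = 1%N by rewrite mxrank_ker mxrank_tr r2.
have [j wj] : exists j, row j K != 0.
  by apply: row_neq0; rewrite -mxrank_eq0 rK.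
pose w := (row j K)^T.
have Uw : U *m w = 0.
  by rewrite /w -[U]trmxK -trmx_mul -row_mul mulmx_ker row0 trmx0.
have w0 : w != 0 by rewrite -[0]trmx0 (inj_eq trmx_inj).
have [i /existsPn nw] := irr_col w0.
have: ((h i *m w)^T <= row j K)%MS.
  have s1 : ((h i *m w)^T <= K)%MS.
    apply/sub_kermxP; rewrite -trmx_mul mulmxA.
    have /submxP [D ->] := stU i.
    by rewrite -mulmxA Uw mulmx0 trmx0.
  apply: submx_trans s1 _.
  by rewrite -(mxrank_leqif_sup (row_sub j K)) rK rank_rV wj.
move=> /sub_rVP [c ec]; move: (nw c).
by rewrite -[h i *m w]trmxK ec linearZ eqxx.
Qed.

(** Dual to [irr_transitive]: if a nonzero row kills the orbit of u, then so does its own orbit,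
    which is everything, and u is 0. *)
Lemma irr_transitive_col (u z : 'cV[F]_3) : u != 0 -> exists2 x, inalg x & x *m u = z.
Proof.
move=> u0.
have lin : linear (fun x : M => (x *m u)^T).
  by move=> c x y; rewrite mulmxDl -scalemxAl linearP.
pose f := GRing.isLinear.Build _ _ _ _ (fun x : M => (x *m u)^T) lin.
pose fl : {linear M -> 'rV[F]_3} := HB.pack (fun x : M => (x *m u)^T) f.
have [] := @orbmx_full fl _ z^T; last by move=> x ax /trmx_inj; exists x.
move=> w wP; apply: contraNeq u0 => w0.
have wT0 : w^T != 0 by rewrite -[0]trmx0 (inj_eq trmx_inj).
apply/eqP/row_matrixP => i; rewrite rowE row0.
have [x ax <-] := irr_transitive (delta_mx 0 i) wT0.
by apply: trmx_inj; rewrite trmx0 -(wP x ax) /= !trmx_mul trmxK !mulmxA.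
Qed.

(** An element of rank 1 is a column times a row; transitivity on both sides moves it to every
    matrix unit. *)
Lemma rank1_sgen b : inalg b -> \rank b = 1%N -> sgen.
Proof.
move=> ab rb x.
have [j rj] : exists j, row j b != 0.
  by apply: row_neq0; rewrite -mxrank_eq0 rb.
have /submxP [u eb] : (b <= row j b)%MS.
  by rewrite -(mxrank_leqif_sup (row_sub j b)) rb rank_rV rj.
have u0 : u != 0 by apply: contraNneq rj => e0; rewrite eb e0 mul0mx row0.
rewrite [x]matrix_sum_delta; apply: inalg_sum => i _; apply: inalg_sum => k _.
apply: inalgZ.
have [y ay ey] := irr_transitive_col (delta_mx i 0) u0.
have [z az ez] := irr_transitive (delta_mx 0 k) rj.
have -> : delta_mx i k = y *m b *m z.
  by rewrite eb !mulmxA ey -mulmxA ez mul_delta_mx.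
by apply: inalgM => //; apply: inalgM.
Qed.

(* A singular element of minimal rank 2 would yield an endomorphism without
   eigenvalues commuting with the algebra, which is then contained in a field. *)
Lemma rank2_sgen b : inalg b -> \rank b = 2%N -> sgen.
Proof.
move=> ab rb; have [//|nsg] := pselect sgen; exfalso.
have no1 x : inalg x -> (\rank x <= 1)%N -> x = 0.
  move=> ax rx; apply/eqP; apply: contra_notT nsg => x0.
  by apply: (rank1_sgen ax); apply/eqP; rewrite eqn_leq rx lt0n mxrank_eq0.
pose K := kermx b.
have rK : \rank K = 1%N by rewrite mxrank_ker rb.
have [j nj] : exists j, row j K != 0.
  by apply: row_neq0; rewrite -mxrank_eq0 rK.
set n := row j K in nj.
have nb : n *m b = 0 by rewrite -row_mul mulmx_ker row0.
(* The kernel of [b *m y] contains v and the kernel vector n of b, which are independent; so the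
   rank is at most 1 and [no1] applies. *)
have inj (v : 'rV[F]_3) y : inalg y -> v *m b != 0 -> v *m b *m y = 0 -> b *m y = 0.
  move=> ay vb vby; apply: no1; first exact: inalgM.
  have vn : \rank (col_mx v n) = 2%N.
    have le2 : (\rank (col_mx v n) <= 2)%N := rank_leq_row _.
    apply/eqP; rewrite eqn_leq le2 /= ltnNge; apply/negP => r1.
    have: (col_mx v n <= n)%MS.
      have nS : (n <= col_mx v n)%MS by rewrite -addsmxE addsmxSr.
      by rewrite -(mxrank_leqif_sup nS) rank_rV nj eqn_leq r1 andbT; move/mxrankS: nS; rewrite rank_rV nj.
    rewrite -addsmxE addsmx_sub => /andP [/sub_rVP [c ec] _].
    by rewrite ec -scalemxAl nb scaler0 eqxx in vb.
  have: (col_mx v n <= kermx (b *m y))%MS.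
    by apply/sub_kermxP; rewrite mul_col_mx !mulmxA vby nb mul0mx col_mx0.
  by move/mxrankS; rewrite vn mxrank_ker; case: (\rank (b *m y)) => [|[|[|[|]]]].
have [i1 vb1] : exists i, row i b != 0.
  by apply: row_neq0; rewrite -mxrank_eq0 rb.
pose v1 : 'rV[F]_3 := delta_mx 0 i1.
have {}vb1 : v1 *m b != 0 by rewrite -rowE.
have [i2 vb2] : exists i, ~~ (row i b <= v1 *m b)%MS.
  apply/existsP; rewrite -negb_forall; apply/negP => /forallP r0.
  have: (b <= v1 *m b)%MS by apply/row_subP.
  by move/mxrankS; rewrite rb rank_rV vb1.
pose v2 : 'rV[F]_3 := delta_mx 0 i2.
have {}vb2 : ~~ (v2 *m b <= v1 *m b)%MS by rewrite -rowE.
have /choice [y hy] : forall i : 'I_3, exists y, inalg y /\ v1 *m b *m y = delta_mx 0 i.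
  by move=> i; have [x ax ex] := irr_transitive (delta_mx 0 i) vb1; exists x.
(* T is the map sending [v1 *m b *m x] to [v2 *m b *m x] for x in the algebra. It is well defined
   because, by [inj], an x that kills [v1 *m b] satisfies [b *m x = 0]. *)
pose T : M := \matrix_i (v2 *m b *m y i).
have TP x : inalg x -> v1 *m b *m x *m T = v2 *m b *m x.
  move=> ax; set c := v1 *m b *m x.
  have az : inalg (\sum_i c 0 i *: y i).
    by apply: inalg_sum => i _; apply: inalgZ; case: (hy i).
  have ez : v1 *m b *m (\sum_i c 0 i *: y i) = c.
    rewrite mulmx_sumr [RHS]row_sum_delta; apply: eq_bigr => i _.
    by rewrite -scalemxAr (hy i).2.
  have e0 : b *m (x - \sum_i c 0 i *: y i) = 0.
    apply: (inj v1) => //; first exact: inalgB.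
    by rewrite mulmxBr ez subrr.
  have -> : v2 *m b *m x = v2 *m b *m (\sum_i c 0 i *: y i).
    by apply/eqP; rewrite -subr_eq0 -mulmxBr -mulmxA e0 mulmx0.
  rewrite mulmx_sumr mulmx_sum_row; apply: eq_bigr => i _.
  by rewrite rowK -scalemxAr.
have nT : noeig T.
  apply/forallP => z; apply/implyP => z0; apply/existsPn => l; apply/eqP => zT.
  have [x ax ex] := irr_transitive z vb1.
  have e0 : b *m x = 0.
    apply: (inj (v2 - l *: v1)) => //.
      apply: contra vb2 => /eqP; rewrite mulmxBl -scalemxAl => /eqP.
      by rewrite subr_eq0 => /eqP ->; apply: scalemx_sub.
    by rewrite mulmxBl -scalemxAl mulmxBl -TP // -scalemxAl ex zT subrr.
  by move: z0; rewrite -ex -mulmxA e0 mulmx0 eqxx.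
have bT : b \in cent T.
  rewrite inE; apply/eqP/row_matrixP => i; rewrite !rowE !mulmxA.
  have [x ax <-] := irr_transitive (delta_mx 0 i) vb1.
  rewrite TP // -[v1 *m b *m x *m b]mulmxA TP ?mulmxA //; exact: inalgM.
have b0 : b != 0 by rewrite -mxrank_eq0 rb.
by have := cent_unit nT bT b0; rewrite -row_full_unit /row_full rb.
Qed.

(** Either the algebra contains a nonzero singular element, of rank 1 or 2, or all its nonzero
    elements are invertible. In the second case an [h i] that moves the line of [e1] has no
    eigenvalue, and since elements are determined by their value on [e1], every [h j] is a
    polynomial in it. *)
Lemma burnside : sgen \/ exists2 C, noeig C & forall i, h i \in cent C.
Proof.
have [[b ab [b0 bu]]|nob] := pselect (exists2 b, inalg b & b != 0 /\ b \notin unitmx).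
  left; have: (\rank b < 3)%N.
    rewrite ltn_neqAle rank_leq_row andbT; apply: contra bu.
    by rewrite -row_full_unit.
  have: (0 < \rank b)%N by rewrite lt0n mxrank_eq0.
  case e: (\rank b) => [|[|[|]]] // _ _; first exact: rank1_sgen ab e.
  exact: rank2_sgen ab e.
have unitB b : inalg b -> b \notin unitmx -> b = 0.
  by move=> ab bu; apply/eqP; apply: contra_notT nob => b0; exists b.
right; have [i ni] := irr_row e1n0.
have nC : noeig (h i).
  apply/forallP => v; apply/implyP => v0; apply/existsPn => c; apply/eqP => vC.
  have: h i - c%:M = 0.
    apply: unitB; first by apply: inalgB; [apply: inalg_var | apply: inalgC].
    apply/negP => U; have: v *m (h i - c%:M) = 0 by rewrite mulmxBr vC mul_mx_scalar subrr.
    by move=> /(mulmx_unit_eq0 U) z0; rewrite z0 eqxx in v0.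
  move/eqP; rewrite subr_eq0 => /eqP hc; move/existsPn: ni => /(_ c).
  by rewrite hc mul_mx_scalar eqxx.
exists (h i) => // j.
have [p _ ep] := cyclic_row (e1 *m h j) nC e1n0.
suff -> : h j = horner_mx (h i) p by apply: horner_cent.
apply/eqP; rewrite -subr_eq0; apply/eqP; apply: unitB.
  by apply: inalgB; [apply: inalg_var | apply: inalg_horner; apply: inalg_var].
apply/negP => U; have: e1 *m (h j - horner_mx (h i) p) = 0 by rewrite mulmxBr ep subrr.
by move=> /(mulmx_unit_eq0 U) /eqP; rewrite (negbTE e1n0).
Qed.

End Tuple.

Lemma cent_not_sgen (I : finType) (h : I -> M) C :
  noeig C -> (forall i, h i \in cent C) -> ~ sgen h.
Proof.
move=> nC hC gh.
have cC x : x \in cent C.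
  have [s <-] := gh x; rewrite inE; apply/eqP/comm_mx_sym; rewrite /comm_mx mulmxE /ev.
  apply: commr_sum => p _; rewrite /GRing.comm -scalerAr -scalerAl; congr (_ *: _).
  by apply: commr_prod => i _; move: (hC i); rewrite inE => /eqP /esym.
have D0 : (delta_mx 0 0 : M) != 0.
  by apply/eqP => /matrixP /(_ 0 0); rewrite !mxE /= => /eqP; rewrite oner_eq0.
have := cent_unit nC (cC (delta_mx 0 0)) D0.
by rewrite -row_full_unit /row_full mxrank_delta.
Qed.

End Burnside.

(** * Counting irreducible tuples *)

Section Configurations.
Variable F : finFieldType.
Local Notation M := 'M[F]_3.
Local Notation q := #|F|.
Implicit Types (v u : 'rV[F]_3) (w : 'cV[F]_3) (X g : M).

Lemma card_pattern (Z : {set 'I_3 * 'I_3}) :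
  #|[set X : M | [forall p in Z, X p.1 p.2 == 0]]| = (q ^ (9 - #|Z|))%N.
Proof.
have -> : (9 - #|Z|)%N = #|~: Z|.
  have <- : (#|Z| + #|~: Z| = 9)%N by rewrite cardsC card_prod !card_ord.
  by rewrite addKn.
rewrite -(card_pffun_on (0 : F) (~: Z) F).
pose f (X : M) : {ffun 'I_3 * 'I_3 -> F} := [ffun p => X p.1 p.2].
have finj : injective f.
  by move=> X Y /ffunP e; apply/matrixP => i j; have := e (i, j); rewrite !ffunE.
rewrite -(card_imset _ finj); apply: eq_card => r; apply/imsetP/pffun_onP.
  move=> [X XZ ->]; split=> //; apply/subsetP => p; rewrite !inE ffunE.
  apply: contra => pZ; by move: XZ; rewrite inE => /forall_inP /(_ p pZ).
move=> [/subsetP sZ _]; exists (\matrix_(i, j) r (i, j)).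
  rewrite inE; apply/forall_inP => p pZ; rewrite mxE -surjective_pairing.
  by apply: contraTT pZ => rp; have := sZ p rp; rewrite inE.
by apply/ffunP => p; rewrite ffunE mxE -surjective_pairing.
Qed.

Lemma card_conj_pattern g (Z : {set 'I_3 * 'I_3}) : g \in unitmx ->
  #|[set X : M | [forall p in Z, (g *m X *m invmx g) p.1 p.2 == 0]]|
    = (q ^ (9 - #|Z|))%N.
Proof.
move=> gu; rewrite -card_pattern.
have cinj : injective (fun X : M => g *m X *m invmx g).
  by move=> X Y /(can_inj (mulmxKV gu)) /(can_inj (mulKmx gu)).
rewrite -(card_imset _ cinj); apply: eq_card => Y; rewrite [RHS]inE.
apply/imsetP/idP => [[X XZ ->]|YZ]; first by rewrite inE in XZ.
exists (invmx g *m Y *m g); last by rewrite !mulmxA mulmxV // mul1mx mulmxK.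
by rewrite inE !mulmxA mulmxV // mul1mx mulmxK.
Qed.

Lemma row_diag (Y : M) i : (forall j, (j != i) ==> (Y i j == 0)) ->
  row i Y = Y i i *: delta_mx 0 i.
Proof.
move=> Hz; apply/rowP => j; rewrite !mxE; case: (eqVneq j i) => [->|ji].
  by rewrite mulr1.
by rewrite mulr0; have := Hz j; rewrite ji /= => /eqP.
Qed.

Lemma col_diag (Y : M) j : (forall i, (i != j) ==> (Y i j == 0)) ->
  col j Y = Y j j *: delta_mx j 0.
Proof.
move=> Hz; apply/colP => i; rewrite !mxE; case: (eqVneq i j) => [->|ij].
  by rewrite mulr1.
by rewrite mulr0; have := Hz i; rewrite ij /= => /eqP.
Qed.

(** In the basis formed by the rows of g, with dual basis the columns of its inverse, a basis vector
    is an eigenvector exactly when the off-diagonal entries of its row, or dually of its column,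
    vanish. *)
Lemma eigrow_conj g X i : g \in unitmx ->
  eigrow X (row i g) = [forall j, (j != i) ==> ((g *m X *m invmx g) i j == 0)].
Proof.
move=> gu; apply/existsP/forallP.
  move=> [c /eqP e] j; apply/implyP => ji.
  have -> : (g *m X *m invmx g) i j = (c *: row i 1%:M) 0 j :> F.
    by rewrite -(mulmxV gu) row_mul scalemxAl -e -row_mul -row_mul [RHS]mxE.
  by rewrite !mxE [i == j]eq_sym (negbTE ji) mulr0.
move=> Hz; exists ((g *m X *m invmx g) i i); apply/eqP.
have e := row_diag Hz.
by rewrite -[LHS](mulmxKV gu) -2!row_mul e -scalemxAl -rowE.
Qed.

Lemma eigcol_conj g X j : g \in unitmx ->
  eigcol X (col j (invmx g)) = [forall i, (i != j) ==> ((g *m X *m invmx g) i j == 0)].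
Proof.
move=> gu; have e2 : g *m (X *m col j (invmx g)) = col j (g *m X *m invmx g).
  by rewrite !colE !mulmxA.
apply/existsP/forallP.
  move=> [c /eqP e] i; apply/implyP => ij.
  have -> : (g *m X *m invmx g) i j = (c *: col j 1%:M) i 0 :> F.
    rewrite -(mulmxV gu); transitivity ((col j (g *m X *m invmx g)) i 0).
      by rewrite [RHS]mxE.
    by rewrite -e2 e -scalemxAr !colE !mulmxA.
  by rewrite !mxE (negbTE ij) mulr0.
move=> Hz; exists ((g *m X *m invmx g) j j); apply/eqP.
have e := col_diag Hz.
by rewrite -[LHS](mulKmx gu) e2 e -scalemxAr -colE.
Qed.

Lemma card_ker w : w != 0 -> #|[set v : 'rV[F]_3 | v *m w == 0]| = (q ^ 2)%N.
Proof.
move=> w0; have -> : [set v : 'rV[F]_3 | v *m w == 0] = rowg (kermx w).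
  by apply/setP => v; rewrite mem_rowg inE; apply/eqP/sub_kermxP.
by rewrite card_rowg mxrank_ker; have := rank_leq_col w; rewrite leq_eqVlt ltnS leqn0 mxrank_eq0 (negbTE w0) orbF => /eqP ->.
Qed.

Lemma card_kerC w : w != 0 -> #|[set v : 'rV[F]_3 | v *m w != 0]| = (q ^ 3 - q ^ 2)%N.
Proof.
move=> w0; have -> : [set v : 'rV[F]_3 | v *m w != 0] = ~: [set v | v *m w == 0].
  by apply/setP => v; rewrite !inE.
by rewrite cardsCs setCK card_ker // card_mx mul1n.
Qed.

Lemma card_line v : v != 0 -> #|[set c *: v | c : F]| = q.
Proof.
move=> v0; rewrite card_imset // => c d e; apply/eqP; rewrite -subr_eq0.
by have /eqP := e; rewrite -subr_eq0 -scalerBl scaler_eq0 (negbTE v0) orbF.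
Qed.

Lemma q_gt1 : (1 < q)%N.
Proof. exact: finNzRing_gt1. Qed.

Lemma ker_indep v w : v != 0 -> w != 0 -> v *m w = 0 ->
  exists2 u, u *m w = 0 & forall c, u != c *: v.
Proof.
move=> v0 w0 vw.
have: ~~ ([set u : 'rV[F]_3 | u *m w == 0] \subset [set c *: v | c : F]).
  apply/negP => /subset_leq_card; rewrite card_ker // card_line //.
  by rewrite leqNgt -{1}[q]muln1 -mulnn ltn_pmul2l ?q_gt1 // (ltn_trans _ q_gt1).
case/subsetPn => u; rewrite inE => /eqP uw nu; exists u => // c.
by apply: contra nu => /eqP ->; apply/imsetP; exists c.
Qed.

Lemma unit_indep (g : M) : (forall u : 'rV[F]_3, u *m g = 0 -> u = 0) -> g \in unitmx.
Proof.
move=> inj; rewrite -row_free_unit -kermx_eq0; apply/eqP/row_matrixP => i.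
by rewrite row0; apply: inj; rewrite -row_mul mulmx_ker row0.
Qed.

(** The rows u and u2 span the kernel of w and v lies outside it, so the three form a basis. As w
    vanishes on u and u2, it is a multiple of the first vector of the dual basis. *)
Lemma full_frame v w u u2 : v *m w != 0 -> u != 0 -> u *m w = 0 ->
  u2 *m w = 0 -> (forall c, u2 != c *: u) ->
  exists g : M, [/\ g \in unitmx, row 0 g = v, row 1 g = u, row 2 g = u2 &
    exists2 c, c != 0 & col 0 (invmx g) = c *: w].
Proof.
move=> vw u0 uw u2w nu.
pose g : M := \matrix_i (if i == 0 then v else if i == 1 then u else u2).
have r0 : row 0 g = v by rewrite rowK.
have r1 : row 1 g = u by rewrite rowK.
have r2 : row 2 g = u2 by rewrite rowK.
have sumg (z : 'rV[F]_3) : z *m g = z 0 0 *: v + z 0 1 *: u + z 0 2 *: u2.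
  rewrite mulmx_sum_row !big_ord_recl big_ord0 addr0 addrA.
  have -> : lift ord0 ord0 = 1 :> 'I_3 by apply: val_inj.
  have -> : lift ord0 (lift ord0 ord0) = 2 :> 'I_3 by apply: val_inj.
  by rewrite r0 r1 r2.
have vwE : v *m w = ((v *m w) 0 0)%:M by rewrite -mx11_scalar.
have c0 : (v *m w) 0 0 != 0.
  by apply: contraNneq vw => c0; rewrite vwE c0 raddf0.
have gu : g \in unitmx.
  apply: unit_indep => z zg.
  have: z *m g *m w = 0 by rewrite zg mul0mx.
  rewrite sumg !mulmxDl -!scalemxAl uw u2w !scaler0 !addr0 => /eqP.
  rewrite scaler_eq0 (negbTE vw) orbF => /eqP z0.
  move: zg; rewrite sumg z0 scale0r add0r => /eqP e.
  have z2 : z 0 2 = 0.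
    apply: contraTeq isT => z2; apply/negP.
    have := nu (- (z 0 2)^-1 * z 0 1); move=> /eqP; case.
    apply: (scalerI z2); rewrite scalerA mulNr mulrN mulrA mulfV // mul1r scaleNr.
    by apply/eqP; rewrite -addr_eq0 addrC e.
  move: e; rewrite z2 scale0r addr0 scaler_eq0 (negbTE u0) orbF => /eqP z1.
  by apply/rowP; elim/ord3_ind; rewrite mxE.
exists g; split=> //; exists ((v *m w) 0 0)^-1; first by rewrite invr_eq0.
have gw : g *m w = (v *m w) 0 0 *: delta_mx 0 0.
  apply/row_matrixP => i; rewrite row_mul; elim/ord3_ind: i.
  - by rewrite r0 [LHS]vwE; apply/rowP => j; rewrite !mxE !ord1 /= mulr1.
  - by rewrite r1 uw; apply/rowP => j; rewrite !mxE /= mulr0.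
  - by rewrite r2 u2w; apply/rowP => j; rewrite !mxE /= mulr0.
apply: (scalerI c0); rewrite scalerA mulfV // scale1r colE scalemxAr -gw.
by rewrite mulKmx.
Qed.

Lemma frame v w u : v *m w != 0 -> u != 0 -> u *m w = 0 ->
  exists g : M, [/\ g \in unitmx, row 0 g = v, row 1 g = u &
    exists2 c, c != 0 & col 0 (invmx g) = c *: w].
Proof.
move=> vw u0 uw.
have w0 : w != 0 by apply: contraNneq vw => ->; rewrite mulmx0.
have [u2 u2w nu] := ker_indep u0 w0 uw.
by have [g [gu r0 r1 _ gw]] := full_frame vw u0 uw u2w nu; exists g.
Qed.

Lemma eigcolZ X w c : c != 0 -> eigcol X (c *: w) = eigcol X w.
Proof.
move=> c0; apply/existsP/existsP => [] [d /eqP e]; exists d; apply/eqP.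
  by apply: (scalerI c0); rewrite scalemxAr e !scalerA mulrC.
by rewrite -scalemxAr e !scalerA mulrC.
Qed.

Lemma eigrowZ X v c : c != 0 -> eigrow X (c *: v) = eigrow X v.
Proof.
move=> c0; apply/existsP/existsP => [] [d /eqP e]; exists d; apply/eqP.
  by apply: (scalerI c0); rewrite scalemxAl e !scalerA mulrC.
by rewrite -scalemxAl e !scalerA mulrC.
Qed.

Lemma exists_dual v : v != 0 -> exists w, v *m w != 0.
Proof.
case/rV0Pn => i vi; exists (delta_mx i 0); rewrite -colE.
apply: contraNneq vi => /matrixP /(_ 0 0); by rewrite !mxE => ->.
Qed.

Lemma exists_codual w : w != 0 -> exists v, v *m w != 0.
Proof.
move=> w0; have /exists_dual [u] : w^T != 0 by rewrite -[0]trmx0 (inj_eq trmx_inj).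
by move=> uw; exists u^T; apply: contraNneq uw => /(congr1 trmx); rewrite trmx_mul trmxK trmx0 => ->.
Qed.

Lemma exists_ker w : w != 0 -> exists2 u : 'rV[F]_3, u != 0 & u *m w = 0.
Proof.
move=> w0; have: ~~ ([set u : 'rV[F]_3 | u *m w == 0] \subset [set 0]).
  apply/negP => /subset_leq_card; rewrite card_ker // cards1 leqNgt.
  by rewrite (ltn_trans q_gt1) // -{1}[q]expn1 ltn_exp2l // q_gt1.
by case/subsetPn => u; rewrite !inE => /eqP uw u0; exists u.
Qed.

(** Number of entries left free when the rows in [r] and the columns in [c] may be nonzero only on
    the diagonal. *)
Definition patdim (r c : seq 'I_3) : nat :=
  9 - \sum_(i < 3) \sum_(j < 3) ((i != j) && ((i \in r) || (j \in c))).

Lemma card_stab g (r c : seq 'I_3) : g \in unitmx ->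
  #|[set X : M | all (fun i => eigrow X (row i g)) r
                 && all (fun j => eigcol X (col j (invmx g))) c]| = (q ^ patdim r c)%N.
Proof.
move=> gu; pose Z := [set p : 'I_3 * 'I_3 | (p.1 != p.2) && ((p.1 \in r) || (p.2 \in c))].
have -> : patdim r c = (9 - #|Z|)%N.
  rewrite /patdim pair_bigA /= -sum1_card; congr (_ - _)%N; rewrite [RHS]big_mkcond /=.
  by apply: eq_bigr => p _; rewrite inE; case: (_ && _).
rewrite -(card_conj_pattern _ gu); apply: eq_card => X; rewrite !inE.
apply/andP/forall_inP.
  move=> [/allP hr /allP hc] [i j]; rewrite inE /= => /andP [ij /orP [ir|jc]].
    by have := hr i ir; rewrite eigrow_conj // => /forallP /(_ j); rewrite eq_sym ij.
  by have := hc j jc; rewrite eigcol_conj // => /forallP /(_ i); rewrite ij.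
move=> H; split; apply/allP => i iin; rewrite ?eigrow_conj ?eigcol_conj //;
  apply/forallP => j; apply/implyP => ji.
  by apply: (H (i, j)); rewrite inE /= eq_sym ji iin.
by apply: (H (j, i)); rewrite inE /= ji iin orbT.
Qed.

Lemma card_stab_v v : v != 0 -> #|[set X : M | eigrow X v]| = (q ^ 7)%N.
Proof.
move=> v0; have [w vw] := exists_dual v0.
have w0 : w != 0 by apply: contraNneq vw => ->; rewrite mulmx0.
have [u u0 uw] := exists_ker w0.
have [g [gu <- _ _]] := frame vw u0 uw.
have := card_stab [:: 0] [::] gu.
rewrite /patdim !big_ord_recl !big_ord0 /= => <-.
by apply: eq_card => X; rewrite !inE /= !andbT.
Qed.

Lemma card_stab_w w : w != 0 -> #|[set X : M | eigcol X w]| = (q ^ 7)%N.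
Proof.
move=> w0; have [v vw] := exists_codual w0.
have [u u0 uw] := exists_ker w0.
have [g [gu _ _ [c c0 ec]]] := frame vw u0 uw.
have := card_stab [::] [:: 0] gu.
rewrite /patdim !big_ord_recl !big_ord0 /= => <-.
by apply: eq_card => X; rewrite !inE /= !andbT ec eigcolZ.
Qed.

(** Row 1 and column 0 of the frame share the off-diagonal position (1, 0), so only three entries
    are forced to vanish. In [card_stab_split] row and column meet on the diagonal and four entries
    vanish. *)
Lemma card_stab_flag v w : v != 0 -> w != 0 -> v *m w = 0 ->
  #|[set X : M | eigrow X v && eigcol X w]| = (q ^ 6)%N.
Proof.
move=> v0 w0 vw; have [u uw] := exists_codual w0.
have [g [gu _ <- [c c0 ec]]] := frame uw v0 vw.
have := card_stab [:: 1] [:: 0] gu.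
rewrite /patdim !big_ord_recl !big_ord0 /= => <-.
by apply: eq_card => X; rewrite !inE /= !andbT ec eigcolZ.
Qed.

Lemma card_stab_split v w : v *m w != 0 ->
  #|[set X : M | eigrow X v && eigcol X w]| = (q ^ 5)%N.
Proof.
move=> vw; have w0 : w != 0 by apply: contraNneq vw => ->; rewrite mulmx0.
have [u u0 uw] := exists_ker w0.
have [g [gu <- _ [c c0 ec]]] := frame vw u0 uw.
have := card_stab [:: 0] [:: 0] gu.
rewrite /patdim !big_ord_recl !big_ord0 /= => <-.
by apply: eq_card => X; rewrite !inE /= !andbT ec eigcolZ.
Qed.

Lemma card_stab3 v w u : v *m w != 0 -> u != 0 -> u *m w = 0 ->
  #|[set X : M | [&& eigrow X v, eigcol X w & eigrow X u]]| = (q ^ 4)%N.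
Proof.
move=> vw u0 uw; have [g [gu <- <- [c c0 ec]]] := frame vw u0 uw.
have := card_stab [:: 0; 1] [:: 0] gu.
rewrite /patdim !big_ord_recl !big_ord0 /= => <-.
by apply: eq_card => X; rewrite !inE /= !andbT ec eigcolZ // -andbA [_ && eigrow _ _]andbC.
Qed.

Lemma card_stab4 v w u1 u2 : v *m w != 0 -> u1 != 0 -> u1 *m w = 0 ->
  u2 *m w = 0 -> (forall c, u2 != c *: u1) ->
  #|[set X : M | [&& eigrow X v, eigcol X w, eigrow X u1 & eigrow X u2]]| = (q ^ 3)%N.
Proof.
move=> vw u10 u1w u2w nu; have [g [gu <- <- <- [c c0 ec]]] := full_frame vw u10 u1w u2w nu.
have := card_stab [:: 0; 1; 2] [:: 0] gu.
rewrite /patdim !big_ord_recl !big_ord0 /= => <-.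
apply: eq_card => X; rewrite !inE /= !andbT ec eigcolZ //.
by case: (eigrow _ _); case: (eigrow _ _); case: (eigrow _ _); case: (eigcol _ _).
Qed.

Lemma sgen_ind (I : finType) (h : I -> M) (P : M -> Prop) : sgen h -> P 1%:M ->
  (forall X Y, P X -> P Y -> P (X + Y)) -> (forall c X, P X -> P (c *: X)) ->
  (forall X Y, P X -> P Y -> P (X *m Y)) -> (forall i, P (h i)) -> forall X, P X.
Proof.
move=> gh P1 PD PZ PM Ph X; have [s <-] := gh X; rewrite /ev.
apply: big_ind => // [|p _]; first by rewrite -(scale0r 1%:M); apply: PZ.
by apply: PZ; apply: big_ind => // Y Z PY; apply: PM.
Qed.

(** A vector that is an eigenvector of all generators would be one of all matrices, but its
    stabiliser has only q^7 elements. *)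
Lemma sgen_irr (I : finType) (h : I -> M) : sgen h -> irrtuple h.
Proof.
have big (P : pred M) : #|[set X | P X]| = (q ^ 7)%N -> ~ forall X, P X.
  move=> cP aP; have : #|[set X | P X]| = #|{: M}| by apply: eq_card => X; rewrite inE aP.
  by rewrite cP card_mx => /eqP; rewrite eqn_exp2l ?q_gt1.
move=> gh; apply/andP; split; apply/forallP => v; apply/implyP => v0; apply/negP => /forallP ev0.
  apply: (big _ (card_stab_v v0)); apply: (sgen_ind gh) => //.
  - by apply/existsP; exists 1; rewrite mulmx1 scale1r.
  - move=> X Y /existsP [c /eqP ec] /existsP [d /eqP ed].
    by apply/existsP; exists (c + d); rewrite mulmxDr ec ed scalerDl.
  - move=> c X /existsP [d /eqP ed].
    by apply/existsP; exists (c * d); rewrite -scalemxAr ed scalerA.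
  move=> X Y /existsP [c /eqP ec] /existsP [d /eqP ed].
  by apply/existsP; exists (c * d); rewrite mulmxA ec -scalemxAl ed scalerA.
apply: (big _ (card_stab_w v0)); apply: (sgen_ind gh) => //.
- by apply/existsP; exists 1; rewrite mul1mx scale1r.
- move=> X Y /existsP [c /eqP ec] /existsP [d /eqP ed].
  by apply/existsP; exists (c + d); rewrite mulmxDl ec ed scalerDl.
- move=> c X /existsP [d /eqP ed].
  by apply/existsP; exists (c * d); rewrite -scalemxAl ed scalerA.
move=> X Y /existsP [c /eqP ec] /existsP [d /eqP ed].
by apply/existsP; exists (d * c); rewrite -mulmxA ed -scalemxAr ec scalerA.
Qed.

End Configurations.

(** * Totals of the configuration numbers *)

Section Sums.
Variables (F : finFieldType) (k : nat).
Local Notation M := 'M[F]_3.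
Local Notation q := #|F|.
Local Notation tup := {ffun 'I_k -> M}.
Implicit Types (u v : 'rV[F]_3) (w : 'cV[F]_3) (h : tup).

(* Common eigenrows and eigencolumns.  [nx h w] and [ny h w] count the eigenrows
   orthogonal resp. not orthogonal to w; [nS] and [nT] count the configurations
   of [card_stab3] and [card_stab4]. *)
Definition ER h v := (v != 0) && [forall i, eigrow (h i) v].
Definition EC h w := (w != 0) && [forall i, eigcol (h i) w].
Definition na h := #|[set v | ER h v]|.
Definition nb h := #|[set w | EC h w]|.
Definition nx h w := #|[set v | ER h v && (v *m w == 0)]|.
Definition ny h w := #|[set v | ER h v && (v *m w != 0)]|.
Definition nS h := (\sum_(w | EC h w) nx h w * ny h w)%N.
Definition nT h := (\sum_(w | EC h w) nx h w * (nx h w - (q - 1)) * ny h w)%N.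

Lemma na_split h w : na h = (nx h w + ny h w)%N.
Proof.
rewrite /na -(cardsID [set v | v *m w == 0]); congr (_ + _)%N;
  by apply: eq_card => v; rewrite !inE // andbC.
Qed.

(** The k matrices are constrained independently. Each total below exchanges summations and counts,
    for a fixed configuration, the tuples in the k-th power of its stabiliser. *)
Lemma sum_tuples (st : pred M) N : #|[set X | st X]| = N ->
  (\sum_(h : tup) [forall i, st (h i)] = N ^ k)%N.
Proof.
move=> <-; rewrite -[X in (_ ^ X)%N](card_ord k) -card_ffun_on -sum1_card [RHS]big_mkcond /=.
apply: eq_bigr => h _.
suff -> : (h \in ffun_on (mem [set X | st X])) = [forall i, st (h i)] by case: [forall i, _].
by apply/ffun_onP/forallP => H i; have := H i; rewrite inE.
Qed.

Lemma card_nz m n : #|[set v : 'M[F]_(m, n) | v != 0]| = (q ^ (m * n) - 1)%N.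
Proof.
have -> : [set v : 'M[F]_(m, n) | v != 0] = ~: [set 0] by apply/setP => v; rewrite !inE.
by rewrite cardsCs setCK cards1 card_mx.
Qed.

Lemma card_ker_nz w : w != 0 ->
  #|[set v : 'rV[F]_3 | (v != 0) && (v *m w == 0)]| = (q ^ 2 - 1)%N.
Proof.
move=> w0; rewrite -(card_ker w0) (cardsD1 0 [set v | v *m w == 0]) inE mul0mx eqxx addKn.
by apply: eq_card => v; rewrite !inE.
Qed.

Lemma card_ker_indep w u : w != 0 -> u != 0 -> u *m w = 0 ->
  #|[set v : 'rV[F]_3 | (v *m w == 0) && [forall c, v != c *: u]]| = (q ^ 2 - q)%N.
Proof.
move=> w0 u0 uw.
have -> : [set v : 'rV[F]_3 | (v *m w == 0) && [forall c, v != c *: u]]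
   = [set v | v *m w == 0] :\: [set c *: u | c : F].
  apply/setP => v; rewrite !inE andbC; congr (_ && _).
  apply/forallP/negP => [H /imsetP [c _ e]|H c]; first by have := H c; rewrite e eqxx.
  by apply/eqP => e; apply: H; apply/imsetP; exists c.
rewrite cardsD (setIidPr _) ?card_ker ?card_line //.
by apply/subsetP => v /imsetP [c _ ->]; rewrite inE -scalemxAl uw scaler0.
Qed.

Lemma sum_boolE (T : finType) (P : pred T) (f : T -> nat) :
  (\sum_(x | P x) f x = \sum_x P x * f x)%N.
Proof. by rewrite big_mkcond; apply: eq_bigr => x _; case: (P x); rewrite ?mul1n. Qed.

Lemma cardE_sum (T : finType) (P : pred T) : (#|[set x | P x]| = \sum_x P x)%N.
Proof.
rewrite -sum1_card big_mkcond; apply: eq_bigr => x _; rewrite inE; by case: (P x).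
Qed.

Lemma sum_na : (\sum_h na h = (q ^ 3 - 1) * (q ^ 7) ^ k)%N.
Proof.
under eq_bigr => h _ do rewrite /na cardE_sum.
rewrite exchange_big -(card_nz 1 3) cardE_sum big_distrl; apply: eq_bigr => v _ /=.
case: (eqVneq v 0) => [->|v0]; first by apply: big1 => h _; rewrite /ER eqxx.
rewrite mul1n -(sum_tuples (card_stab_v v0)); apply: eq_bigr => h _.
by rewrite /ER v0.
Qed.

Lemma sum_nb : (\sum_h nb h = (q ^ 3 - 1) * (q ^ 7) ^ k)%N.
Proof.
under eq_bigr => h _ do rewrite /nb cardE_sum.
rewrite exchange_big -(card_nz 3 1) cardE_sum big_distrl; apply: eq_bigr => v _ /=.
case: (eqVneq v 0) => [->|v0]; first by apply: big1 => h _; rewrite /EC eqxx.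
rewrite mul1n -(sum_tuples (card_stab_w v0)); apply: eq_bigr => h _.
by rewrite /EC v0.
Qed.

Lemma forall_andE (T : finType) (P Q : pred T) :
  [forall x, P x] && [forall x, Q x] = [forall x, P x && Q x].
Proof.
apply/andP/forallP => [[/forallP a /forallP b] x|a]; first by rewrite a b.
by split; apply/forallP => x; case/andP: (a x).
Qed.

Lemma sum_nab : (\sum_h na h * nb h =
  (q ^ 3 - 1) * ((q ^ 2 - 1) * (q ^ 6) ^ k + (q ^ 3 - q ^ 2) * (q ^ 5) ^ k))%N.
Proof.
under eq_bigr => h _ do rewrite /na /nb !cardE_sum mulnC big_distrlr /=.
rewrite exchange_big -(card_nz 3 1) cardE_sum big_distrl; apply: eq_bigr => w _ /=.
case: (eqVneq w 0) => [->|w0].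
  by apply: big1 => h _; apply: big1 => v _; rewrite /EC eqxx.
rewrite mul1n exchange_big /= -(card_ker_nz w0) -(card_kerC w0) !cardE_sum !big_distrl /=.
rewrite -big_split /=; apply: eq_bigr => v _.
case: (eqVneq v 0) => [->|v0].
  by rewrite mul0mx eqxx !mul0n; apply: big1 => h _; rewrite /ER eqxx muln0.
case: (eqVneq (v *m w) 0) => [vw|vw] /=; rewrite ?mul1n ?mul0n ?addn0 ?add0n.
  rewrite -(sum_tuples (card_stab_flag v0 w0 vw)); apply: eq_bigr => h _.
  by rewrite /EC /ER w0 v0 /= mulnb andbC forall_andE.
rewrite -(sum_tuples (card_stab_split vw)); apply: eq_bigr => h _.
by rewrite /EC /ER w0 v0 /= mulnb andbC forall_andE.
Qed.

Lemma sum_nS : (\sum_h nS h =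
  (q ^ 3 - 1) * ((q ^ 2 - 1) * ((q ^ 3 - q ^ 2) * (q ^ 4) ^ k)))%N.
Proof.
under eq_bigr => h _ do rewrite /nS sum_boolE.
rewrite exchange_big -(card_nz 3 1) cardE_sum big_distrl; apply: eq_bigr => w _ /=.
case: (eqVneq w 0) => [->|w0]; first by apply: big1 => h _; rewrite /EC eqxx.
rewrite mul1n.
under eq_bigr => h _ do rewrite /nx /ny !cardE_sum big_distrlr /= big_distrr /=.
rewrite exchange_big /= -(card_ker_nz w0) !cardE_sum !big_distrl /=.
apply: eq_bigr => u _.
case: (eqVneq u 0) => [->|u0].
  by apply: big1 => h _; rewrite big_distrr /=; apply: big1 => v _; rewrite /ER eqxx muln0.
case: (eqVneq (u *m w) 0) => [uw|uw]; last first.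
  by apply: big1 => h _; rewrite big_distrr /=; apply: big1 => v _; rewrite andbF muln0.
rewrite mul1n; under eq_bigr => h _ do rewrite big_distrr /=.
rewrite exchange_big /= -(card_kerC w0) !cardE_sum !big_distrl /=; apply: eq_bigr => v _.
case: (eqVneq (v *m w) 0) => [vw|vw].
  by apply: big1 => h _; rewrite !andbF !muln0.
have v0 : v != 0 by apply: contraNneq vw => ->; rewrite mul0mx.
rewrite mul1n -(sum_tuples (card_stab3 vw u0 uw)); apply: eq_bigr => h _.
rewrite /EC /ER w0 v0 u0 /= !andbT !mulnb -!forall_andE.
by case: [forall _, _]; case: [forall _, _]; case: [forall _, _].
Qed.

Definition nTc h := (\sum_(w | EC h w)
  (\sum_(u | ER h u && (u *m w == 0)%R)
    #|[set u2 | ER h u2 && (u2 *m w == 0)%R && [forall c, (u2 != c *: u)%R]]|) * ny h w)%N.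

Lemma ERZ h v c : c != 0 -> ER h (c *: v) = ER h v.
Proof.
move=> c0; rewrite /ER scaler_eq0 (negbTE c0) /=; congr (_ && _).
by apply: eq_forallb => i; rewrite eigrowZ.
Qed.

Lemma card_nzline m n (u : 'M[F]_(m, n)) : u != 0 -> #|[set c *: u | c in [set~ (0 : F)]]| = (q - 1)%N.
Proof.
move=> u0; rewrite card_imset ?cardsC1 ?subn1 // => c d e; apply/eqP; rewrite -subr_eq0.
by have /eqP := e; rewrite -subr_eq0 -scalerBl scaler_eq0 (negbTE u0) orbF.
Qed.

(** For an eigenrow u in the kernel of w, its q - 1 nonzero multiples are among those counted by
    [nx]; so the truncated difference [nx - (q - 1)] is exact and counts the rows independent of u.
    Without such a u both sides are 0. *)
Lemma nT_nTc h : nT h = nTc h.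
Proof.
apply: eq_bigr => w _; congr (_ * _)%N; rewrite /nx -sum1_card big_distrl /=.
apply: eq_big => [u|u]; rewrite inE // mul1n => /andP [Eu uw].
have u0 : u != 0 by case/andP: Eu.
rewrite -(card_nzline u0).
have -> : [set u2 | ER h u2 && (u2 *m w == 0) && [forall c, u2 != c *: u]]
   = [set v | ER h v && (v *m w == 0)] :\: [set c *: u | c in [set~ (0 : F)]].
  apply/setP => v; rewrite !inE andbC; case: (boolP (ER h v)) => [Ev|]; last by rewrite !andbF.
  congr (_ && _); apply/forallP/negP => [H /imsetP [c _ e]|H c]; first by have := H c; rewrite e eqxx.
  apply/eqP => e; apply: H; apply/imsetP; exists c => //; rewrite !inE.
  by case/andP: Ev => v0 _; apply: contraNneq v0 => c0; rewrite e c0 scale0r.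
rewrite cardsD (setIidPr _) ?sum1_card //; apply/subsetP => v /imsetP [c]; rewrite !inE => c0 ->.
by rewrite ERZ // Eu -scalemxAl (eqP uw) scaler0 eqxx.
Qed.

Lemma sum_nT : (\sum_h nT h =
  (q ^ 3 - 1) * ((q ^ 2 - 1) * ((q ^ 2 - q) * ((q ^ 3 - q ^ 2) * (q ^ 3) ^ k))))%N.
Proof.
under eq_bigr => h _ do rewrite nT_nTc /nTc sum_boolE.
rewrite exchange_big -(card_nz 3 1) cardE_sum big_distrl; apply: eq_bigr => w _ /=.
case: (eqVneq w 0) => [->|w0]; first by apply: big1 => h _; rewrite /EC eqxx.
rewrite mul1n.
under eq_bigr => h _ do rewrite sum_boolE big_distrl /= big_distrr /=.
rewrite exchange_big /= -(card_ker_nz w0) !cardE_sum !big_distrl /=.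
apply: eq_bigr => u _.
case: (eqVneq u 0) => [->|u0].
  by apply: big1 => h _; rewrite /ER eqxx /= mul0n muln0.
case: (eqVneq (u *m w) 0) => [uw|uw]; last first.
  by apply: big1 => h _; rewrite andbF mul0n muln0.
rewrite mul1n.
under eq_bigr => h _ do rewrite andbT !cardE_sum big_distrr /= big_distrl /= big_distrr /=.
rewrite exchange_big /= -(card_ker_indep w0 u0 uw) !cardE_sum !big_distrl /=.
apply: eq_bigr => u2 _.
case: (eqVneq (u2 *m w) 0) => [u2w|u2w]; last first.
  by apply: big1 => h _; rewrite andbF /= muln0 mul0n muln0.
case: (boolP [forall c, u2 != c *: u]) => [/forallP nu|_]; last first.
  by apply: big1 => h _; rewrite andbF /= muln0 mul0n muln0.
rewrite mul1n; under eq_bigr => h _ do rewrite /ny cardE_sum big_distrr /= big_distrr /=.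
rewrite exchange_big /= -(card_kerC w0) !cardE_sum !big_distrl /=; apply: eq_bigr => v _.
case: (eqVneq (v *m w) 0) => [vw|vw].
  by apply: big1 => h _; rewrite !andbF !muln0.
have v0 : v != 0 by apply: contraNneq vw => ->; rewrite mul0mx.
have u20 : u2 != 0 by have := nu 0; rewrite scale0r.
rewrite mul1n -(sum_tuples (card_stab4 vw u0 uw u2w nu)); apply: eq_bigr => h _.
rewrite /EC /ER w0 v0 u0 u20 /= !andbT !mulnb -!forall_andE.
by case: [forall _, _]; case: [forall _, _]; case: [forall _, _]; case: [forall _, _].
Qed.

End Sums.

(** * Diagonal tuples and partitions of the three indices *)

Section ClassSupported.
Variables (F : finFieldType) (r : rel 'I_3).
Hypotheses (rr : reflexive r) (rs : symmetric r) (rt : transitive r).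
Local Notation q := #|F|.
Local Notation Fn := {ffun 'I_3 -> F}.

Definition cl i : {set 'I_3} := [set j | r i j].
Definition supp_in (f : Fn) (S : {set 'I_3}) := [forall i, (f i != 0) ==> (i \in S)].
(** These are the coordinates of the common eigenvectors of a tuple of diagonal matrices, when [r]
    relates the indices at which all the matrices have equal diagonal entries. *)
Definition CS (f : Fn) := [exists i, f i != 0] && [forall i, (f i != 0) ==> supp_in f (cl i)].
Definition dotf (f f' : Fn) : F := \sum_i f i * f' i.

Lemma ffun_neq0 (f : Fn) : [exists a, f a != 0] = (f != [ffun=> 0]).
Proof.
apply/existsP/idP => [[i fi]|ne]; first by apply: contraNneq fi => ->; rewrite ffunE.
apply/existsP; rewrite -negb_forall; apply: contra ne => /forallP H.
by apply/eqP/ffunP => i; rewrite ffunE; apply/eqP.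
Qed.

Lemma card_supp_in S : #|[set f : Fn | supp_in f S]| = (q ^ #|S|)%N.
Proof.
rewrite -(card_pffun_on (0 : F) S F); apply: eq_card => f; rewrite inE.
apply/forallP/pffun_onP => [H|[/subsetP sZ _] i].
  split=> //; apply/subsetP => i fi; have := H i; by rewrite inE in fi; rewrite fi.
by apply/implyP => fi; apply: sZ; rewrite inE.
Qed.

Lemma card_supp_nz S : #|[set f : Fn | [exists i, f i != 0] && supp_in f S]| = (q ^ #|S| - 1)%N.
Proof.
rewrite -card_supp_in (cardsD1 [ffun => 0] [set f : Fn | supp_in f S]).
have -> : ([ffun => 0] : Fn) \in [set f : Fn | supp_in f S].
  by rewrite inE; apply/forallP => i; rewrite ffunE eqxx.
rewrite addKn; by apply: eq_card => f; rewrite !inE ffun_neq0.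
Qed.

(** Translation in the coordinate [i0] permutes the q level sets of the form [dotf _ g], so they all
    have the same size. *)
Lemma card_supp_dot (S : {set 'I_3}) (g : Fn) i0 : i0 \in S -> g i0 != 0 ->
  (q * #|[set f : Fn | supp_in f S && (dotf f g == 0)%R]| = q ^ #|S|)%N.
Proof.
move=> iS gi; rewrite -card_supp_in -[RHS]sum1_card.
rewrite (partition_big (fun f => dotf f g) predT) //= -sum_nat_const.
apply: eq_bigr => c _.
pose tr (f : Fn) : Fn := [ffun i => f i + (i == i0)%:R * (c / g i0)].
have trI : injective tr.
  by move=> f f' /ffunP e; apply/ffunP => i; have := e i; rewrite !ffunE => /addIr.
rewrite sum1dep_card -[LHS](card_imset _ trI); apply: eq_card => f; rewrite !inE.
have dtr f' : dotf (tr f') g = dotf f' g + c.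
  rewrite /dotf (bigD1 i0) //= [in RHS](bigD1 i0) //= ffunE eqxx mul1r mulrDl divfK //.
  rewrite addrAC; congr (_ + _ + _); apply: eq_bigr => i /negbTE ni.
  by rewrite ffunE ni mul0r addr0.
apply/imsetP/andP.
  move=> [f']; rewrite inE => /andP [/forallP sf /eqP df] ->; rewrite dtr df add0r eqxx.
  split=> //; apply/forallP => i; rewrite ffunE; apply/implyP.
  case: (eqVneq i i0) => [->|ni] //; rewrite mul0r addr0 => fi.
  by have := sf i; rewrite fi.
move=> [/forallP sf /eqP df].
exists [ffun i => f i - (i == i0)%:R * (c / g i0)]; last first.
  by apply/ffunP => i; rewrite /tr !ffunE subrK.
rewrite inE; apply/andP; split.
  apply/forallP => i; rewrite ffunE; apply/implyP.
  case: (eqVneq i i0) => [->|ni] //; rewrite mul0r subr0 => fi.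
  by have := sf i; rewrite fi.
apply/eqP; apply: (addIr c); rewrite -dtr add0r -[RHS]df; congr (dotf _ g).
by apply/ffunP => i; rewrite /tr !ffunE subrK.
Qed.

Lemma cl_eq i j : r i j -> cl i = cl j.
Proof.
move=> ij; apply/setP => k; rewrite !inE; apply/idP/idP; last exact: rt.
by apply: rt; rewrite rs.
Qed.

Lemma CS_supp (f : Fn) i : [exists i, f i != 0] -> supp_in f (cl i) -> CS f.
Proof.
move=> f0 /forallP sf; rewrite /CS f0; apply/forallP => j; apply/implyP => fj.
have := sf j; rewrite fj inE /= => ij; rewrite -(cl_eq ij); exact/forallP.
Qed.

Lemma CS_supp_cl (f : Fn) i j : CS f -> f i != 0 -> supp_in f (cl j) = (j \in cl i).
Proof.
move=> /andP [_ /forallP H] fi; apply/idP/idP.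
  by move/forallP/(_ i); rewrite fi !inE rs.
by rewrite inE => ij; rewrite -(cl_eq ij); have := H i; rewrite fi.
Qed.

(** Summing over indices meets each class once per element; dividing by the size of the class
    corrects this. *)
Lemma sum_CS (phi : Fn -> rat) (psi : 'I_3 -> rat) :
  (forall i j, r i j -> psi i = psi j) ->
  (forall (f : Fn) i, CS f -> f i != 0 -> phi f = psi i) ->
  \sum_(f | CS f) phi f = \sum_i ((q ^ #|cl i|)%:R - 1) / #|cl i|%:R * psi i.
Proof.
move=> psiE e.
have cl0 i : #|cl i|%:R != 0 :> rat.
  by rewrite pnatr_eq0 -lt0n; apply/card_gt0P; exists i; rewrite inE.
transitivity (\sum_(f | CS f) \sum_(i | supp_in f (cl i)) psi i / #|cl i|%:R).
  apply: eq_bigr => f Cf; have /andP [/existsP [i fi] _] := Cf.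
  rewrite (eq_bigl _ _ (fun j => CS_supp_cl j Cf fi)).
  rewrite (eq_bigr (fun _ => phi f / #|cl i|%:R)); last first.
    by move=> j; rewrite inE => ij; rewrite (e f i Cf fi) (psiE _ _ ij) (cl_eq ij).
  by rewrite sumr_const -[RHS]mulr_natr divfK.
rewrite (exchange_big_dep predT) //=; apply: eq_bigr => i _.
rewrite sumr_const -[LHS]mulr_natl mulrA mulrAC; congr (_ / _ * _).
have -> : (q ^ #|cl i|)%:R - 1 = (q ^ #|cl i| - 1)%:R :> rat.
  by rewrite natrB // expn_gt0 (ltn_trans _ (q_gt1 F)).
rewrite -card_supp_nz; congr (_%:R); apply: eq_card => f; rewrite !inE unfold_in.
apply/andP/andP => [[/andP [-> _] ->]//|[f0 sf]].
by rewrite (CS_supp f0 sf).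
Qed.

Definition Ydot (g : Fn) := #|[set f : Fn | CS f && (dotf f g != 0)]|.

(** A function with nonzero product against g shares an index with it, hence is supported in the
    same class; what is counted is the complement of a hyperplane among the functions on that
    class. *)
Lemma YdotE g i : CS g -> g i != 0 ->
  (Ydot g)%:R = (q ^ #|cl i|)%:R - (q ^ #|cl i|)%:R / q%:R :> rat.
Proof.
move=> Cg gi.
have q0 : q%:R != 0 :> rat by rewrite pnatr_eq0 -lt0n (ltn_trans _ (q_gt1 F)).
have ii : i \in cl i by rewrite inE.
have := card_supp_dot ii gi; set Z := #|_| => eZ.
have eY : (Ydot g + Z = q ^ #|cl i|)%N.
  rewrite -card_supp_in -(cardsID [set f : Fn | dotf f g == 0]) addnC; congr (_ + _)%N.
    by apply: eq_card => f; rewrite !inE andbC.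
  apply: eq_card => f; rewrite !inE andbC; case: (boolP (dotf f g == 0)) => //= d0.
  have [j] : exists j, f j * g j != 0.
    apply/existsP; rewrite -negb_forall; apply: contra d0 => /forallP H.
    by rewrite /dotf big1 // => j _; apply/eqP; exact: H j.
  rewrite mulf_eq0 negb_or => /andP [fj gj].
  have jcl : j \in cl i.
    have /andP [_ /forallP /(_ i)] := Cg; rewrite gi => /forallP /(_ j).
    by rewrite gj.
  have f0 : [exists i, f i != 0] by apply/existsP; exists j.
  apply/idP/idP => [Cf|sf]; last exact: CS_supp f0 sf.
  by rewrite (CS_supp_cl i Cf fj) inE rs; rewrite inE in jcl.
have eYr : (Ydot g)%:R + Z%:R = (q ^ #|cl i|)%:R :> rat by rewrite -natrD eY.
have eZr : (q ^ #|cl i|)%:R / q%:R = Z%:R :> rat.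
  by rewrite -eZ natrM mulrAC mulfV // mul1r.
by rewrite eZr -eYr addrK.
Qed.

(** Three indices have five partitions, and for each of them both sides are explicit rational
    functions of q. Only the partition with a single class, that of scalar tuples, gives a nonzero
    value. *)
Lemma class_identity :
  let n : rat := q%:R - 1 in let a : rat := #|[set f | CS f]|%:R in
  3%:R * n ^+ 2 * (n - a) ^+ 2
   + \sum_(g | CS g) (a - (Ydot g)%:R) * (Ydot g)%:R * (a - (Ydot g)%:R - 4%:R * n)
   = [forall i, forall j, r i j]%:R * (q%:R ^+ 3 * n ^+ 6 * (q%:R + 1)).
Proof.
move=> n a.
have q0 : q%:R != 0 :> rat by rewrite pnatr_eq0 -lt0n (ltn_trans _ (q_gt1 F)).
have aE : a = \sum_i ((q ^ #|cl i|)%:R - 1) / #|cl i|%:R.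
  transitivity (\sum_(f | CS f) (1 : rat)).
    by rewrite sumr_const /a; congr (_%:R); apply: eq_card => f; rewrite inE.
  rewrite (@sum_CS (fun _ => 1) (fun _ => 1)) //.
  by apply: eq_bigr => i _; rewrite mulr1.
rewrite (@sum_CS (fun g => (a - (Ydot g)%:R) * (Ydot g)%:R * (a - (Ydot g)%:R - 4%:R * n))
  (fun i => let y := (q ^ #|cl i|)%:R - (q ^ #|cl i|)%:R / q%:R in (a - y) * y * (a - y - 4%:R * n))).
- have cE i : #|cl i| = (r i 0%R + r i 1%R + r i 2%R)%N.
    rewrite -sum1_card big_mkcond !big_ord_recl big_ord0 !inE /= addn0 addnA.
    have -> : lift ord0 ord0 = 1 :> 'I_3 by apply: val_inj.
    have -> : lift ord0 (lift ord0 ord0) = 2 :> 'I_3 by apply: val_inj.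
    by case: (r i 0); case: (r i 1); case: (r i 2).
  have o3 (P : pred 'I_3) : [forall i, P i] = [&& P 0, P 1 & P 2].
    by apply/forallP/and3P => [H|[H0 H1 H2]]; [split | elim/ord3_ind].
  rewrite aE !o3 !big_ord_recl !big_ord0 /=.
  have -> : lift ord0 ord0 = 1 :> 'I_3 by apply: val_inj.
  have -> : lift ord0 (lift ord0 ord0) = 2 :> 'I_3 by apply: val_inj.
  rewrite !cE !rr (rs 1 0) (rs 2 0) (rs 2 1).
  have t012 : r 0 1 -> r 0 2 -> r 1 2 by move=> a1 a2; apply: rt a2; rewrite rs.
  have t102 : r 0 1 -> r 1 2 -> r 0 2 by apply: rt.
  have t021 : r 0 2 -> r 1 2 -> r 0 1 by move=> a1 a2; apply: rt a1 _; rewrite rs.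
  rewrite /n; case: (r 0 1) t012 t102 t021; case: (r 0 2); case: (r 1 2) => t1 t2 t3;
    try (by have := t1 isT isT); try (by have := t2 isT isT); try (by have := t3 isT isT);
    rewrite /= ?expnS ?expn0 ?natrM; by field.
- by move=> i j /cl_eq ->.
- by move=> f i Cf fi; rewrite (YdotE Cf fi).
Qed.

End ClassSupported.

(** * The identity at a single tuple *)

Section Pointwise.
Variables (F : finFieldType) (k : nat).
Local Notation M := 'M[F]_3.
Local Notation q := #|F|.
Local Notation tup := {ffun 'I_k -> M}.
Implicit Types (u v : 'rV[F]_3) (w : 'cV[F]_3) (h : tup).
Local Notation n := (q%:R - 1 : rat).

Lemma natr_q1 : (q - 1)%:R = n.
Proof. by rewrite natrB // (ltn_trans _ (q_gt1 F)). Qed.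

Definition scalt h := [forall i, is_scal (h i)].

Lemma nx_ge h w v : ER h v -> v *m w = 0 -> (q - 1 <= nx h w)%N.
Proof.
move=> Ev vw; have v0 : v != 0 by case/andP: Ev.
rewrite -(card_nzline v0); apply: subset_leq_card; apply/subsetP => u /imsetP [c].
by rewrite !inE => c0 ->; rewrite ERZ // Ev -scalemxAl vw scaler0 eqxx.
Qed.

(** This is [nT - 3 n nS], whose coefficients are forced by the identity: [- 3 n] by tuples whose
    eigenrows lie in a plane, where [nx] is n for every relevant w, and then 1 by diagonal tuples
    with three different eigenlines. *)
Definition GG h : rat := \sum_(w | EC h w)
  (nx h w)%:R * (ny h w)%:R * ((nx h w)%:R - 4%:R * n).

Lemma GGE h : GG h = (nT h)%:R - 3%:R * n * (nS h)%:R.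
Proof.
rewrite /nT /nS !natr_sum mulr_sumr -sumrB; apply: eq_bigr => w _.
rewrite !natrM.
have [x0|] := posnP (nx h w); first by rewrite x0 mul0r !mul0r mulr0 subr0.
rewrite card_gt0 => /set0Pn [v]; rewrite inE => /andP [Ev /eqP vw].
by rewrite natrB ?(nx_ge Ev vw) // natr_q1; ring.
Qed.

Lemma ECZ h w c : c != 0 -> EC h (c *: w) = EC h w.
Proof.
move=> c0; rewrite /EC scaler_eq0 (negbTE c0) /=; congr (_ && _).
by apply: eq_forallb => i; rewrite eigcolZ.
Qed.

Lemma ker2_line w w' : w != 0 -> (forall c, w' != c *: w) ->
  exists2 u : 'rV[F]_3, u != 0 & u *m w = 0 /\ u *m w' = 0 /\
    forall z : 'rV[F]_3, z *m w = 0 -> z *m w' = 0 -> exists c, z = c *: u.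
Proof.
move=> w0 nw; pose A := row_mx w w'.
have rA : \rank A = 2%N.
  apply/eqP; rewrite eqn_leq rank_leq_col /= ltnNge; apply/negP => r1.
  have wS : (w^T <= A^T)%MS by rewrite tr_row_mx -addsmxE addsmxSl.
  have : (A^T <= w^T)%MS.
    have wT0 : w^T != 0 by rewrite -[0]trmx0 (inj_eq trmx_inj).
    rewrite -(mxrank_leqif_sup wS) rank_rV wT0 (mxrank_tr A) eqn_leq r1 andbT.
    by move/mxrankS: wS; rewrite rank_rV wT0 (mxrank_tr A).
  rewrite tr_row_mx -addsmxE addsmx_sub => /andP [_ /sub_rVP [c ec]].
  by move/eqP: (nw c); apply; apply: trmx_inj; rewrite ec linearZ.
pose K := kermx A.
have rK : \rank K = 1%N by rewrite mxrank_ker rA.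
have [j nj] : exists j, row j K != 0.
  by apply: row_neq0; rewrite -mxrank_eq0 rK.
have : row j K *m A = 0 by rewrite -row_mul mulmx_ker row0.
rewrite /A mul_mx_row => /eqP; rewrite row_mx_eq0 => /andP [/eqP e1 /eqP e2].
exists (row j K) => //; split=> //; split=> // z zw zw'; apply/sub_rVP.
have s1 : (z <= K)%MS by apply/sub_kermxP; rewrite mul_mx_row zw zw' row_mx0.
apply: submx_trans s1 _; by rewrite -(mxrank_leqif_sup (row_sub j K)) rK rank_rV nj.
Qed.

Lemma ker2_line_col v v' : v != 0 -> (forall c, v' != c *: v) ->
  exists2 w : 'cV[F]_3, w != 0 & v *m w = 0 /\ v' *m w = 0 /\
    forall z : 'cV[F]_3, v *m z = 0 -> v' *m z = 0 -> exists c, z = c *: w.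
Proof.
move=> v0 nv.
have vT0 : v^T != 0 by rewrite -[0]trmx0 (inj_eq trmx_inj).
have nvT c : v'^T != c *: v^T by rewrite -linearZ (inj_eq trmx_inj).
have [u u0 [e1 [e2 e3]]] := ker2_line vT0 nvT.
exists u^T; first by rewrite -[0]trmx0 (inj_eq trmx_inj).
split; first by rewrite -[v]trmxK -trmx_mul e1 trmx0.
split; first by rewrite -[v']trmxK -trmx_mul e2 trmx0.
move=> z vz v'z; have [||c ec] := e3 z^T.
- by rewrite -trmx_mul vz trmx0.
- by rewrite -trmx_mul v'z trmx0.
by exists c; apply: trmx_inj; rewrite ec linearZ /= trmxK.
Qed.

(** Two distinct invariant planes meet in an invariant line. Dually, in [EC_join], two invariant
    lines span an invariant plane. *)
Lemma ER_meet h w w' u : EC h w -> EC h w' -> u != 0 -> u *m w = 0 -> u *m w' = 0 ->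
  (forall z : 'rV[F]_3, z *m w = 0 -> z *m w' = 0 -> exists c, z = c *: u) -> ER h u.
Proof.
move=> /andP [_ /forallP Ew] /andP [_ /forallP Ew'] u0 uw uw' H.
apply/andP; split=> //; apply/forallP => i.
have /existsP [c /eqP ec] := Ew i; have /existsP [d /eqP ed] := Ew' i.
have [||e ee] := H (u *m h i).
- by rewrite -mulmxA ec -scalemxAr uw scaler0.
- by rewrite -mulmxA ed -scalemxAr uw' scaler0.
by apply/existsP; exists e; apply/eqP.
Qed.

Lemma EC_join h v v' w : ER h v -> ER h v' -> w != 0 -> v *m w = 0 -> v' *m w = 0 ->
  (forall z : 'cV[F]_3, v *m z = 0 -> v' *m z = 0 -> exists c, z = c *: w) -> EC h w.
Proof.
move=> /andP [_ /forallP Ew] /andP [_ /forallP Ew'] u0 uw uw' H.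
apply/andP; split=> //; apply/forallP => i.
have /existsP [c /eqP ec] := Ew i; have /existsP [d /eqP ed] := Ew' i.
have [||e ee] := H (h i *m w).
- by rewrite mulmxA ec -scalemxAl uw scaler0.
- by rewrite mulmxA ed -scalemxAl uw' scaler0.
by apply/existsP; exists e; apply/eqP.
Qed.

Lemma scalt_ER h v : scalt h -> v != 0 -> ER h v.
Proof.
move=> /forallP sh v0; rewrite /ER v0; apply/forallP => i.
have /existsP [c /eqP ->] := sh i; apply/existsP; exists c.
by rewrite mul_mx_scalar.
Qed.

Lemma irrE h : irrtuple h = (na h == 0)%N && (nb h == 0)%N.
Proof.
rewrite /na /nb !cards_eq0; congr (_ && _).
  apply/forallP/eqP => [H|H v].
    by apply/setP => v; rewrite !inE; have := H v; rewrite /ER; case: (v != 0) => //= /negbTE.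
  by apply/implyP => v0; have /setP /(_ v) := H; rewrite !inE /ER v0 /= => ->.
apply/forallP/eqP => [H|H v].
  by apply/setP => v; rewrite !inE; have := H v; rewrite /EC; case: (v != 0) => //= /negbTE.
by apply/implyP => v0; have /setP /(_ v) := H; rewrite !inE /EC v0 /= => ->.
Qed.

(* Summed over all tuples, every term except [irrtuple] becomes explicit. *)
Definition identity_at h := 3%:R * n ^+ 4 * (irrtuple h)%:R
  + (scalt h)%:R * (q%:R ^+ 3 * n ^+ 6 * (q%:R + 1))
  = 3%:R * n ^+ 2 * (n - (na h)%:R) * (n - (nb h)%:R) + GG h.

Let e1 : 'rV[F]_3 := delta_mx 0 0.
Let e1n0 : e1 != 0.
Proof. by apply/eqP => /matrixP /(_ 0 0); rewrite !mxE /= => /eqP; rewrite oner_eq0. Qed.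

Lemma exists_indep v : v != 0 -> exists2 u : 'rV[F]_3, u != 0 & forall c, u != c *: v.
Proof.
move=> v0; have: ~~ ([set: 'rV[F]_3] \subset [set c *: v | c : F]).
  apply/negP => /subset_leq_card; rewrite card_line // cardsT card_mx mul1n.
  by rewrite leqNgt -{1}[q]expn1 ltn_exp2l // q_gt1.
case/subsetPn => u _ nu; exists u; last first.
  by move=> c; apply: contra nu => /eqP ->; apply/imsetP; exists c.
by apply: contra nu => /eqP ->; apply/imsetP; exists 0; rewrite ?scale0r.
Qed.

(** Two invariant planes would meet in an invariant line, so there is at most one: [nb h] is 0, the
    irreducible case, or q - 1, which kills the first product. *)
Lemma identity_noER h : na h = 0%N -> identity_at h.
Proof.
move=> a0; have E0 v : ER h v = false.
  by have /eqP := a0; rewrite cards_eq0 => /eqP/setP/(_ v); rewrite !inE.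
have ns : scalt h = false by apply: contraFF (E0 e1) => /scalt_ER; apply.
rewrite /identity_at ns irrE a0 eqxx /= mul0r addr0 subr0.
have -> : GG h = 0.
  apply: big1 => w _; suff -> : nx h w = 0%N by rewrite !mul0r.
  by apply: eq_card0 => v; rewrite inE E0.
rewrite addr0; have [->|] := posnP (nb h); first by rewrite subr0 mulr1; ring.
rewrite card_gt0 => /set0Pn [w]; rewrite inE => Ew.
have w0 : w != 0 by case/andP: Ew.
suff -> : nb h = (q - 1)%N.
  by rewrite natr_q1 mulr0 subrr mulr0.
rewrite -(card_nzline w0); apply: eq_card => w'; rewrite [LHS]inE; apply/idP/imsetP.
  move=> Ew'; have [[c ec]|nc] := pselect (exists c, w' = c *: w).
    exists c => //; rewrite !inE; case/andP: Ew' => w'0 _.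
    by apply: contraNneq w'0 => c0; rewrite ec c0 scale0r.
  have [c|u u0 [uw [uw' H]]] := ker2_line (w' := w') w0.
    by apply/eqP => ec; apply: nc; exists c.
  by have := ER_meet Ew Ew' u0 uw uw' H; rewrite E0.
by move=> [c]; rewrite !inE => c0 ->; rewrite ECZ.
Qed.

Lemma scalt_frame h : scalt h -> exists g : M, g \in unitmx /\ forall i, ER h (row i g).
Proof.
move=> sh; exists 1%:M; split; first exact: unitmx1.
move=> i; apply: scalt_ER => //; apply/eqP => /rowP /(_ i); rewrite !mxE eqxx => /eqP.
by rewrite oner_eq0.
Qed.

(** Here [na h] is q - 1, and for every w the unique invariant line lies either in its kernel or
    outside, so [nx] or [ny] vanishes. *)
Lemma identity_line h v : ER h v -> (forall u, ER h u -> exists c, u = c *: v) ->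
  identity_at h.
Proof.
move=> Ev H; have v0 : v != 0 by case/andP: Ev.
have ea : na h = (q - 1)%N.
  rewrite -(card_nzline v0); apply: eq_card => u; rewrite [LHS]inE; apply/idP/imsetP.
    move=> Eu; have [c ec] := H u Eu; exists c => //; rewrite !inE.
    by case/andP: Eu => u0 _; apply: contraNneq u0 => c0; rewrite ec c0 scale0r.
  by move=> [c]; rewrite !inE => c0 ->; rewrite ERZ.
have ni : irrtuple h = false.
  rewrite irrE ea; have -> // : (q - 1 == 0)%N = false.
  by apply/negbTE; rewrite -lt0n subn_gt0 q_gt1.
have ns : scalt h = false.
  apply/negP => sh; have [u u0 nu] := exists_indep v0.
  by have [c ec] := H u (scalt_ER sh u0); have := nu c; rewrite ec eqxx.
rewrite /identity_at ni ns mulr0 mul0r addr0 ea natr_q1 subrr mulr0 mul0r add0r.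
rewrite /GG big1 // => w _.
case: (eqVneq (v *m w) 0) => vw.
  suff -> : ny h w = 0%N by rewrite mulr0 mul0r.
  apply: eq_card0 => u; rewrite inE; apply/negP => /andP [/H [c ->]].
  by rewrite -scalemxAl vw scaler0 eqxx.
suff -> : nx h w = 0%N by rewrite !mul0r.
apply: eq_card0 => u; rewrite inE; apply/negP => /andP [Eu].
have [c ec] := H u Eu; rewrite ec -scalemxAl scaler_eq0 (negbTE vw) orbF => /eqP c0.
by move: Eu; rewrite ec c0 scale0r /ER eqxx.
Qed.

(** The plane spanned by the eigenrows is the kernel of w, so w is an eigencolumn and its multiples
    contribute 0 to [GG]. The kernel of any other eigencolumn meets the plane in one invariant line,
    so [nx] is q - 1 and the summand does not depend on it. *)
Lemma identity_plane h v v' w : ER h v -> ER h v' -> w != 0 ->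
  (forall c, v' != c *: v) -> (forall u, ER h u -> u *m w = 0) -> identity_at h.
Proof.
move=> Ev Ev' w0 nv H; have v0 : v != 0 by case/andP: Ev.
have Ew : EC h w.
  have [z z0 [vz [v'z Hz]]] := ker2_line_col v0 nv.
  have [c ec] := Hz w (H _ Ev) (H _ Ev').
  have c0 : c != 0 by apply: contraNneq w0 => c0; rewrite ec c0 scale0r.
  by rewrite ec ECZ //; apply: EC_join Hz.
have ni : irrtuple h = false.
  rewrite irrE; have -> // : (na h == 0)%N = false.
  by apply/negbTE; rewrite -lt0n card_gt0; apply/set0Pn; exists v; rewrite inE.
have ns : scalt h = false.
  apply/negP => sh; have [u uw] := exists_codual w0.
  have u0 : u != 0 by apply: contraNneq uw => ->; rewrite mul0mx.
  by rewrite (H u (scalt_ER sh u0)) eqxx in uw.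
rewrite /identity_at ni ns mulr0 mul0r addr0.
have Gw w' : EC h w' -> (nx h w')%:R * (ny h w')%:R * ((nx h w')%:R - 4%:R * n) =
    - 3%:R * n ^+ 2 * ((na h)%:R - n) * (w' \notin [set c *: w | c in [set~ (0 : F)]])%:R.
  move=> Ew'; have w'0 : w' != 0 by case/andP: Ew'.
  have ea := na_split h w'.
  case: (boolP (w' \in _)) => [/imsetP [c _ ec]|nw'].
    rewrite mulr0; suff -> : ny h w' = 0%N by rewrite mulr0 mul0r.
    apply: eq_card0 => u; rewrite inE; apply/negP => /andP [/H uw].
    by rewrite ec -scalemxAr uw scaler0 eqxx.
  have [c|u u0 [uw [uw' Hu]]] := ker2_line (w' := w') w0.
    apply/eqP => ec; move/imsetP: nw'; apply; exists c => //; rewrite !inE.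
    by apply: contraNneq w'0 => c0; rewrite ec c0 scale0r.
  have Eu := ER_meet Ew Ew' u0 uw uw' Hu.
  have ex : nx h w' = (q - 1)%N.
    rewrite -(card_nzline u0); apply: eq_card => z; rewrite [LHS]inE; apply/andP/imsetP.
      move=> [Ez /eqP zw']; have [c ec] := Hu z (H z Ez) zw'; exists c => //; rewrite !inE.
      by case/andP: Ez => z0 _; apply: contraNneq z0 => c0; rewrite ec c0 scale0r.
    by move=> [c]; rewrite !inE => c0 ->; rewrite ERZ // -scalemxAl uw' scaler0 eqxx.
  by rewrite ea ex natrD natr_q1 mulr1; ring.
rewrite /GG (eq_bigr _ Gw) -mulr_sumr.
have -> : \sum_(w' | EC h w') (w' \notin [set c *: w | c in [set~ (0 : F)]])%:R
   = (nb h)%:R - n :> rat.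
  rewrite -natr_q1 -(card_nzline w0) -natr_sum.
  have sub : [set c *: w | c in [set~ (0 : F)]] \subset [set w | EC h w].
    by apply/subsetP => u /imsetP [c]; rewrite !inE => c0 ->; rewrite ECZ.
  rewrite -natrB; last by rewrite subset_leq_card.
  rewrite -[in RHS](setIidPr sub) -cardsD; congr (_%:R).
  rewrite -sum1_card [RHS]big_mkcond [LHS]big_mkcond /=; apply: eq_bigr => w' _.
  by rewrite !inE; case: (EC h w'); case: (_ \in _).
by ring.
Qed.

Section Frame.
Variables (h : tup) (g : M) (D : 'I_k -> M).
Hypotheses (gu : g \in unitmx) (Eg : forall i, ER h (row i g)).
Hypothesis DE : forall i, D i = g *m h i *m invmx g.

(** Two basis vectors are related when every matrix of the tuple has the same eigenvalue on them. *)
Let r : rel 'I_3 := fun a b => [forall i, D i a a == D i b b].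

Let Doff i a b : b != a -> D i a b = 0.
Proof.
move=> ba; have /andP [_ /forallP /(_ i)] := Eg a; rewrite eigrow_conj // -DE.
by move=> /forallP /(_ b); rewrite ba => /eqP.
Qed.

Let rr : reflexive r. Proof. by move=> a; apply/forallP => i. Qed.
Let rs : symmetric r.
Proof. by move=> a b; apply/forallP/forallP => H i; rewrite eq_sym. Qed.
Let rt : transitive r.
Proof. by move=> b a c /forallP H /forallP H'; apply/forallP => i; rewrite (eqP (H i)). Qed.

Let rowf (f : {ffun 'I_3 -> F}) : 'rV[F]_3 := (\row_a f a) *m g.
Let colf (f : {ffun 'I_3 -> F}) : 'cV[F]_3 := invmx g *m (\col_a f a).

Let rowf_bij : bijective rowf.
Proof.
exists (fun v : 'rV[F]_3 => [ffun a => (v *m invmx g) 0 a]).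
  by move=> f; apply/ffunP => a; rewrite ffunE /rowf mulmxK // mxE.
move=> v; rewrite /rowf -[RHS](mulmxKV gu); congr (_ *m _).
by apply/rowP => a; rewrite mxE ffunE.
Qed.

Let colf_bij : bijective colf.
Proof.
exists (fun v : 'cV[F]_3 => [ffun a => (g *m v) a 0]).
  by move=> f; apply/ffunP => a; rewrite ffunE /colf mulKVmx // mxE.
move=> v; rewrite /colf -[RHS](mulKmx gu); congr (_ *m _).
by apply/colP => a; rewrite mxE ffunE.
Qed.

Let class_cond (f : {ffun 'I_3 -> F}) :
  (forall i, exists c, forall a, f a * D i a a = c * f a) <->
  [forall a, (f a != 0) ==> supp_in f (cl r a)].
Proof.
split=> [H|/forallP H i].
  apply/forallP => a; apply/implyP => fa; apply/forallP => b; apply/implyP => fb.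
  rewrite inE; apply/forallP => i; have [c Hc] := H i; apply/eqP.
  transitivity c.
    by apply: (mulfI fa); rewrite Hc mulrC.
  by apply: (mulfI fb); rewrite Hc mulrC.
case: (boolP [exists a, f a != 0]) => [/existsP [a fa]|].
  exists (D i a a) => b; rewrite mulrC; case: (eqVneq (f b) 0) => [->|fb]; first by rewrite !mulr0.
  have := H a; rewrite fa => /forallP /(_ b); rewrite fb inE => /forallP /(_ i) /eqP.
  by move=> ->.
move=> /existsPn f0; exists 0 => a; have := f0 a; rewrite negbK => /eqP ->.
by rewrite !mul0r.
Qed.

Let ER_rowf f : ER h (rowf f) = CS r f.
Proof.
rewrite /ER /CS ffun_neq0; congr (_ && _).
  have r0 : rowf [ffun=> 0] = 0.
    by rewrite /rowf (_ : \row_a _ = 0) ?mul0mx //; apply/rowP => a; rewrite !mxE ffunE.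
  by rewrite -[in LHS]r0 (inj_eq (bij_inj rowf_bij)).
have e i c : (rowf f *m h i == c *: rowf f) = [forall a, f a * D i a a == c * f a].
  have -> : rowf f *m h i = (\row_a (f a * D i a a)) *m g.
    have -> : rowf f *m h i = (\row_a f a) *m D i *m g by rewrite DE /rowf !mulmxA mulmxKV.
    congr (_ *m g); apply/rowP => a; rewrite !mxE (bigD1 a) //= mxE big1 ?addr0 // => b ba.
    by rewrite Doff ?mulr0 // eq_sym.
  rewrite /rowf scalemxAl (can_eq (mulmxK gu)); apply/eqP/forallP => [/rowP H a|H].
    by have := H a; rewrite !mxE => ->.
  by apply/rowP => a; rewrite !mxE; apply/eqP.
apply/forallP/idP => [H|/class_cond H i].
  apply/class_cond => i; have /existsP [c] := H i; rewrite e => /forallP Hc.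
  by exists c => a; apply/eqP.
by have [c Hc] := H i; apply/existsP; exists c; rewrite e; apply/forallP => a; rewrite Hc.
Qed.

Let EC_colf f : EC h (colf f) = CS r f.
Proof.
rewrite /EC /CS ffun_neq0; congr (_ && _).
  have r0 : colf [ffun=> 0] = 0.
    by rewrite /colf (_ : \col_a _ = 0) ?mulmx0 //; apply/colP => a; rewrite !mxE ffunE.
  by rewrite -[in LHS]r0 (inj_eq (bij_inj colf_bij)).
have e i c : (h i *m colf f == c *: colf f) = [forall a, f a * D i a a == c * f a].
  have -> : h i *m colf f = invmx g *m (\col_a (f a * D i a a)).
    have -> : h i *m colf f = invmx g *m (D i *m (\col_a f a)).
      by rewrite DE /colf -!mulmxA mulKmx.
    congr (_ *m _); apply/colP => a; rewrite !mxE (bigD1 a) //= mxE big1 ?addr0 => [|b ba].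
      by rewrite mulrC.
    by rewrite Doff ?mul0r.
  rewrite /colf scalemxAr (can_eq (mulKVmx gu)); apply/eqP/forallP => [/colP H a|H].
    by have := H a; rewrite !mxE => ->.
  by apply/colP => a; rewrite !mxE; apply/eqP.
apply/forallP/idP => [H|/class_cond H i].
  apply/class_cond => i; have /existsP [c] := H i; rewrite e => /forallP Hc.
  by exists c => a; apply/eqP.
by have [c Hc] := H i; apply/existsP; exists c; rewrite e; apply/forallP => a; rewrite Hc.
Qed.

Let pairf f f' : (rowf f *m colf f' != 0) = (dotf f f' != 0).
Proof.
have -> : rowf f *m colf f' = (dotf f f')%:M.
  rewrite /rowf /colf mulmxA mulmxK // [LHS]mx11_scalar; congr (_%:M).
  by rewrite mxE; apply: eq_bigr => a _; rewrite !mxE.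
congr (~~ _); apply/eqP/eqP => [/matrixP /(_ 0 0)|->]; last exact: raddf0.
by rewrite !mxE mulr1n.
Qed.

Let naE : na h = #|[set f : {ffun 'I_3 -> F} | CS r f]|.
Proof.
rewrite /na -(card_imset _ (bij_inj rowf_bij)); apply: eq_card => v; rewrite [LHS]inE.
apply/idP/imsetP => [Ev|[f]]; last by rewrite inE -ER_rowf => Ef ->.
have [rf r1 r2] := rowf_bij; exists (rf v); last by rewrite r2.
by rewrite inE -ER_rowf r2.
Qed.

Let nbE : nb h = #|[set f : {ffun 'I_3 -> F} | CS r f]|.
Proof.
rewrite /nb -(card_imset _ (bij_inj colf_bij)); apply: eq_card => v; rewrite [LHS]inE.
apply/idP/imsetP => [Ev|[f]]; last by rewrite inE -EC_colf => Ef ->.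
have [rf r1 r2] := colf_bij; exists (rf v); last by rewrite r2.
by rewrite inE -EC_colf r2.
Qed.

Let nyE f : ny h (colf f) = Ydot r f.
Proof.
rewrite /ny /Ydot -(card_imset _ (bij_inj rowf_bij)); apply: eq_card => v; rewrite [LHS]inE.
apply/idP/imsetP => [Ev|[f']]; last by rewrite inE -ER_rowf -pairf => Ef ->.
have [rf r1 r2] := rowf_bij; exists (rf v); last by rewrite r2.
by rewrite inE -ER_rowf -pairf r2.
Qed.

(** In the basis g the tuple is diagonal, and eigenrows as well as eigencolumns have as coordinates
    the functions of [CS r]. Hence [na h = nb h], and [class_identity] applies. *)
Lemma identity_frame : identity_at h.
Proof.
have := class_identity F rr rs rt; rewrite /= -naE.
have -> : [forall i, forall j, r i j] = scalt h.
  apply/forallP/forallP => [H i|H a].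
    apply/existsP; exists (D i 0 0).
    have -> : h i = invmx g *m D i *m g by rewrite DE !mulmxA mulVmx // mul1mx mulmxKV.
    have -> : D i = (D i 0 0)%:M.
      apply/matrixP => a b; rewrite [in RHS]mxE; case: (eqVneq a b) => [->|ab].
        by rewrite mulr1n; have /forallP /(_ 0) /forallP /(_ i) /eqP := H b.
      by rewrite mulr0n Doff // eq_sym.
    by rewrite mul_mx_scalar -scalemxAl mulVmx // scalemx1 mxE mulr1n.
  apply/forallP => b; apply/forallP => i; have /existsP [c /eqP ec] := H i.
  by rewrite DE ec mul_mx_scalar -scalemxAl mulmxV // !mxE !eqxx.
rewrite /identity_at => e.
have -> : irrtuple h = false.
  rewrite irrE; have -> // : (na h == 0)%N = false.
  by apply/negbTE; rewrite -lt0n card_gt0; apply/set0Pn; exists (row 0 g); rewrite inE.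
have eb : nb h = na h by rewrite nbE naE.
rewrite mulr0 add0r -e eb -[in RHS]mulrA -expr2; congr (_ + _).
rewrite /GG (reindex colf) /=; last by apply: onW_bij.
apply: eq_big => [f|f Cf]; first by rewrite EC_colf.
by rewrite nyE (na_split h (colf f)) nyE natrD addrK.
Qed.

End Frame.

(** The four cases are the dimensions 0, 1, 2, 3 of the span of the common eigenrows. *)
Lemma pointwise_identity h : identity_at h.
Proof.
have [a0|] := posnP (na h); first exact: identity_noER.
rewrite card_gt0 => /set0Pn [v]; rewrite inE => Ev.
have v0 : v != 0 by case/andP: Ev.
have [H|nl] := pselect (forall u, ER h u -> exists c, u = c *: v).
  exact: identity_line Ev H.
have [v' [Ev' nv]] : exists v', ER h v' /\ forall c, v' != c *: v.
  apply: contra_notP nl => nl u Eu; apply: contra_notP nl => nl.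
  by exists u; split=> // c; apply/eqP => ec; apply: nl; exists c.
have [w w0 [vw [v'w Hw]]] := ker2_line_col v0 nv.
have [H|np] := pselect (forall u, ER h u -> u *m w = 0).
  exact: identity_plane Ev Ev' w0 nv H.
have [u [Eu uw]] : exists u, ER h u /\ u *m w != 0.
  apply: contra_notP np => np u Eu; apply/eqP; apply: contra_notT np => uw.
  by exists u.
have [g [gu r0 r1 r2 _]] := full_frame uw v0 vw v'w nv.
apply: (@identity_frame _ _ (fun i => g *m h i *m invmx g) gu) => //.
by elim/ord3_ind; rewrite ?r0 ?r1 ?r2.
Qed.

End Pointwise.

(* The number of subfields of M_3(F) of order q^3; below, Q stands for q^k. *)
Definition cubic_count (x : rat) := x ^+ 3 * (x - 1) ^+ 2 * (x + 1) / 3%:R.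

Definition irr_count (x Q : rat) :=
  Q ^+ 9 - 2%:R * (x ^+ 2 + x + 1) * Q ^+ 7 + (x ^+ 2 + x + 1) * (x + 1) * Q ^+ 6
  + x ^+ 2 * (x ^+ 2 + x + 1) * (Q ^+ 5 - (x + 1) * Q ^+ 4)
  + x ^+ 3 * (x + 1) * (x ^+ 2 + x + 1) / 3%:R * Q ^+ 3 - cubic_count x * Q.

(** This is [irr_count x Q - cubic_count x * (Q ^+ 3 - Q)] in factored form: the non-scalar tuples
    inside a cubic field are removed, and the denominators 3 cancel. *)
Definition gen_count (x Q : rat) :=
  Q ^+ 3 * (Q ^+ 2 - x ^+ 2) * (Q - 1)
  * (Q ^+ 3 + Q ^+ 2 - Q * (x + 1) ^+ 2 + x ^+ 2 * (x + 1)).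

(** * Numbers of irreducible and of generating tuples *)

Section Count.
Variable F : finFieldType.
Local Notation M := 'M[F]_3.
Local Notation q := #|F|.

Lemma q_gt0 : (0 < q)%N. Proof. exact: ltn_trans (q_gt1 F). Qed.

Lemma card_scal : #|[set X : M | is_scal X]| = q.
Proof.
have inj : injective (fun c : F => c%:M : M).
  by move=> c d /matrixP /(_ 0 0); rewrite !mxE.
rewrite -(card_imset _ inj); apply: eq_card => X; rewrite inE.
by apply/existsP/imsetP => [[c /eqP ->]|[c _ ->]]; exists c.
Qed.

Section Tuples.
Variable k : nat.
Local Notation tup := {ffun 'I_k -> M}.

Lemma sum_scalt : (\sum_(h : tup) scalt h = q ^ k)%N.
Proof. exact: sum_tuples card_scal. Qed.

Lemma card_irrtuple :
  #|[set h : tup | irrtuple h]|%:R = irr_count q%:R (q%:R ^+ k).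
Proof.
rewrite cardE_sum natr_sum; set I := \sum_(h : tup) _.
have n0 : (q%:R - 1 : rat) != 0.
  by rewrite subr_eq0 -[1]/(1%:R) eqr_nat neq_ltn q_gt1 orbT.
have E : \sum_(h : tup) (3%:R * (q%:R - 1) ^+ 4 * (irrtuple h)%:R
     + (q%:R ^+ 3 * (q%:R - 1) ^+ 6 * (q%:R + 1)) * (scalt h)%:R : rat) =
   \sum_(h : tup) (3%:R * (q%:R - 1) ^+ 4 - 3%:R * (q%:R - 1) ^+ 3 * (na h)%:R
     - 3%:R * (q%:R - 1) ^+ 3 * (nb h)%:R + 3%:R * (q%:R - 1) ^+ 2 * (na h * nb h)%N%:R
     + (nT h)%:R - 3%:R * (q%:R - 1) * (nS h)%:R).
  apply: eq_bigr => h _; rewrite [X in _ + X]mulrC.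
  by have := pointwise_identity h; rewrite /identity_at => ->; rewrite GGE natrM; ring.
rewrite !big_split /= !sumrN -!mulr_sumr -/I -!natr_sum in E.
rewrite sum_scalt sum_na sum_nb sum_nab sum_nS sum_nT in E.
have sc (c : rat) : \sum_(h : tup) c = c * ((q ^ 9) ^ k)%N%:R.
  by rewrite sumr_const card_ffun card_mx card_ord mulr_natr.
rewrite sc in E.
have le1 m : (0 < q ^ m)%N by rewrite expn_gt0 q_gt0.
have le2 a b : (a <= b)%N -> (q ^ a <= q ^ b)%N by move=> ab; rewrite leq_exp2l ?q_gt1.
have leq2 : (q <= q ^ 2)%N by rewrite -{1}[q]expn1 le2.
rewrite !(natrM, natrD, natrB) ?le1 ?le2 // in E.
rewrite -!expnM ![(_ * k)%N]mulnC !expnM !natrX in E.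
apply: (mulfI (_ : 3%:R * (q%:R - 1 : rat) ^+ 4 != 0)).
  by rewrite mulf_neq0 // expf_neq0.
move: E; set x : rat := q%:R; set Q : rat := x ^+ k => E.
rewrite -[LHS](addrK (x ^+ 3 * (x - 1) ^+ 6 * (x + 1) * Q)) E /irr_count /cubic_count.
by field.
Qed.

Lemma noeig_eigcol C (w : 'cV[F]_3) : noeig C -> w != 0 -> ~~ eigcol C w.
Proof.
move=> nC w0; apply/existsPn => c; apply/eqP => ec.
have U : horner_mx C ('X - c%:P) \in unitmx.
  by apply: noeig_poly_unit; rewrite ?polyXsubC_eq0 ?size_XsubC.
rewrite rmorphB /= horner_mx_X horner_mx_C in U.
have: (C - c%:M) *m w = 0 by rewrite mulmxBl ec mul_scalar_mx subrr.
by move/(congr1 (mulmx (invmx (C - c%:M)))); rewrite mulKmx // mulmx0 => e; rewrite e eqxx in w0.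
Qed.

Definition nongen (h : tup) := irrtuple h && ~~ `[< sgen h >].

Lemma card_cent_tuples C : noeig C ->
  #|[set h : tup | [forall i, h i \in cent C] && ~~ scalt h]| = ((q ^ 3) ^ k - q ^ k)%N.
Proof.
move=> nC; rewrite -sum_scalt -cardE_sum -(card_cent nC).
have -> : (#|cent C| ^ k)%N = #|[set h : tup | [forall i, h i \in cent C]]|.
  rewrite [RHS]cardE_sum; symmetry; apply: (@sum_tuples F k (fun X => X \in cent C)).
  by apply: eq_card => X; rewrite inE.
have sub : [set h : tup | scalt h] \subset [set h : tup | [forall i, h i \in cent C]].
  apply/subsetP => h; rewrite !inE => /forallP sh; apply/forallP => i.
  by have /existsP [c /eqP ->] := sh i; apply: scalar_cent.
rewrite -[in RHS](setIidPr sub) -cardsD; apply: eq_card => h.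
by rewrite !inE andbC.
Qed.

Lemma irr_of_cent C (h : tup) : noeig C -> (forall i, h i \in cent C) -> ~~ scalt h ->
  nongen h.
Proof.
move=> nC hC /forallPn [i si]; have nh := cent_noeig nC (hC i) si.
apply/andP; split; last by apply/asboolPn; apply: (cent_not_sgen nC).
apply/andP; split; apply/forallP => v; apply/implyP => v0; apply/forallPn; exists i.
  by move/forallP: nh => /(_ v); rewrite v0.
exact: noeig_eigcol.
Qed.

(** Burnside places the tuple in a cubic field, which is determined by any non-scalar entry. The
    matrices C counted here are the q^3 - q non-scalar elements of that field. *)
Lemma card_fields (h : tup) : nongen h ->
  #|[set C : M | noeig C && [forall i, h i \in cent C]]| = (q ^ 3 - q)%N.
Proof.
case/andP => irrh /asboolPn ng; have [//|[C0 nC0 hC0]] := burnside irrh.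
have [i si] : exists i, ~~ is_scal (h i).
  apply/forallPn; apply/negP => sh.
  have [g [gu Eg]] := scalt_frame sh; move: irrh; rewrite irrE => /andP [].
  by rewrite cards_eq0 => /eqP /setP /(_ (row 0 g)); rewrite !inE Eg.
rewrite -{1}(card_cent nC0) -card_scal.
have sub : [set X : M | is_scal X] \subset cent C0.
  by apply/subsetP => X; rewrite inE => /existsP [c /eqP ->]; apply: scalar_cent.
rewrite -[in RHS](setIidPr sub) -cardsD; apply: eq_card => C; rewrite !inE.
have ceq := cent_eq nC0 (hC0 i) si.
apply/andP/andP => [[nC /forallP hC]|[sC CC]].
  split; first exact: noeig_nonscal.
  have: C \in cent C0 by rewrite -ceq (cent_eq nC (hC i) si) inE.
  by rewrite inE.
have CC' : C \in cent C0 by rewrite inE.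
split; first exact: cent_noeig nC0 CC' sC.
by apply/forallP => j; rewrite (cent_eq nC0 CC' sC).
Qed.

(** Both sides count pairs of a matrix C generating a cubic field and a tuple in this field that is
    not entirely scalar; by [irr_of_cent] such a tuple is irreducible. *)
Lemma double_count :
  (#|[set C : M | noeig C]| * ((q ^ 3) ^ k - q ^ k)
   = #|[set h : tup | nongen h]| * (q ^ 3 - q))%N.
Proof.
transitivity (\sum_(C : M) \sum_(h : tup)
   (noeig C && [forall i, h i \in cent C] && ~~ scalt h))%N.
  rewrite cardE_sum big_distrl /=; apply: eq_bigr => C _.
  case: (boolP (noeig C)) => nC; last by rewrite mul0n big1.
  by rewrite mul1n -(card_cent_tuples nC) cardE_sum.
rewrite exchange_big cardE_sum big_distrl /=; apply: eq_bigr => h _.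
case: (boolP (nongen h)) => nh; last first.
  rewrite mul0n big1 // => C _; apply/eqP; rewrite eqb0.
  apply: contra nh => /andP [/andP [nC /forallP hC] sh].
  exact: irr_of_cent nC hC sh.
rewrite mul1n -(card_fields nh) cardE_sum; apply: eq_bigr => C _.
suff -> : ~~ scalt h by rewrite andbT.
apply/negP => sh; have [g [gu Eg]] := scalt_frame sh.
case/andP: nh; rewrite irrE => /andP [].
by rewrite cards_eq0 => /eqP /setP /(_ (row 0 g)); rewrite !inE Eg.
Qed.

End Tuples.

(** C has no eigenrow exactly when the 1-tuple (C) is irreducible, so this is the case k = 1 of
    [card_irrtuple]. *)
Lemma card_noeig : #|[set C : M | noeig C]|%:R = cubic_count q%:R * (q%:R ^+ 3 - q%:R).
Proof.
have -> : #|[set C : M | noeig C]| = #|[set h : {ffun 'I_1 -> M} | irrtuple h]|.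
  have inj : injective (fun C : M => [ffun _ : 'I_1 => C]).
    by move=> C D /ffunP /(_ 0); rewrite !ffunE.
  rewrite -(card_imset _ inj); apply: eq_card => h; rewrite [RHS]inE.
  apply/imsetP/idP => [[C]|irrh].
    rewrite inE => nC ->; apply/andP; split; apply/forallP => v; apply/implyP => v0;
      apply/forallPn; exists 0; rewrite ffunE.
      by move/forallP: nC => /(_ v); rewrite v0.
    exact: noeig_eigcol.
  exists (h 0); last by apply/ffunP => i; rewrite ffunE ord1.
  rewrite inE; apply/forallP => v; apply/implyP => v0.
  by have [i] := irr_row irrh v0; rewrite ord1.
rewrite card_irrtuple expr1 /irr_count /cubic_count; by field.
Qed.

Lemma card_sgen k : #|[set h : {ffun 'I_k -> M} | `[< sgen h >]]|%:R
  = gen_count q%:R (q%:R ^+ k).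
Proof.
have -> : #|[set h : {ffun 'I_k -> M} | `[< sgen h >]]|%:R =
   #|[set h : {ffun 'I_k -> M} | irrtuple h]|%:R
   - #|[set h : {ffun 'I_k -> M} | nongen h]|%:R :> rat.
  rewrite -(cardsID [set h : {ffun 'I_k -> M} | `[< sgen h >]] [set h : {ffun 'I_k -> M} | irrtuple h]) natrD.
  have -> : [set h : {ffun 'I_k -> M} | irrtuple h] :\: [set h : {ffun 'I_k -> M} | `[< sgen h >]]
     = [set h : {ffun 'I_k -> M} | nongen h] by apply/setP => h; rewrite !inE andbC.
  rewrite addrK; congr (#|pred_of_set _|%:R); apply/setP => h; rewrite !inE.
  case: (asboolP (sgen h)) => gh; rewrite ?andbF // andbT.
  by rewrite sgen_irr.
have q1 : (q%:R : rat) ^+ 3 - q%:R != 0.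
  have -> : (q%:R : rat) ^+ 3 - q%:R = (q ^ 3 - q)%:R.
    by rewrite natrB ?natrX // -{1}[q]expn1 leq_exp2l ?q_gt1.
  by rewrite pnatr_eq0 subn_eq0 -ltnNge -{1}[q]expn1 ltn_exp2l ?q_gt1.
have := congr1 (fun m => m%:R : rat) (double_count k).
have l1 : (q <= q ^ 3)%N by rewrite -{1}[q]expn1 leq_exp2l ?q_gt1.
have l2 : (q ^ k <= (q ^ 3) ^ k)%N by rewrite -expnM leq_exp2l ?q_gt1 // leq_pmull.
rewrite !natrM card_noeig !natrB //.
rewrite -expnM mulnC expnM !natrX => e.
have -> : #|[set h : {ffun 'I_k -> M} | nongen h]|%:R
   = cubic_count q%:R * ((q%:R ^+ k) ^+ 3 - q%:R ^+ k) :> rat.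
  by apply: (mulIf q1); rewrite -e; ring.
rewrite card_irrtuple /irr_count /gen_count /cubic_count.
set Q : rat := q%:R ^+ k; by field.
Qed.

End Count.

(** * Goursat's lemma and conjugacy classes *)

Definition intertwines (A : comNzRingType) (I : Type) (h h' : I -> 'M[A]_3) (g : 'M[A]_3) :=
  forall i, g *m h i = h' i *m g.

Lemma intertwines_ev (A : comNzRingType) (I : Type) (h h' : I -> 'M[A]_3) g s : intertwines h h' g ->
  g *m ev h s = ev h' s *m g.
Proof.
move=> gh; rewrite /ev mulmx_sumr mulmx_suml; apply: eq_bigr => p _.
rewrite -scalemxAr -scalemxAl; congr (_ *: _).
elim: p.2 => [|i r IH]; first by rewrite !big_nil -[1]/(1%:M) mulmx1 mul1mx.
by rewrite !big_cons -!mulmxE mulmxA gh -!mulmxA IH.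
Qed.

Section Goursat.
Variable F : finFieldType.
Local Notation M := 'M[F]_3.

(** Schur's lemma: the left kernel of g is stable under the algebra of [h'], which contains all
    matrix units. *)
Lemma intertwines_unit (I : finType) (h h' : I -> M) g : sgen h' ->
  g != 0 -> intertwines h h' g -> g \in unitmx.
Proof.
move=> gh g0 gi; apply: unit_indep => u ug.
apply: contraNeq g0 => u0; apply/eqP/row_matrixP => i; rewrite row0 rowE.
have [j uj] : exists j, u 0 j != 0 by apply/rV0Pn.
have [s es] := gh (delta_mx j i).
have: u *m (g *m ev h s) = 0 by rewrite mulmxA ug mul0mx.
rewrite (intertwines_ev s gi) es mulmxA.
have -> : u *m delta_mx j i = u 0 j *: delta_mx 0 i.
  rewrite [u in LHS]row_sum_delta mulmx_suml (bigD1 j) //= -scalemxAl mul_delta_mx.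
  by rewrite big1 ?addr0 // => k kj; rewrite -scalemxAl mul_delta_mx_0 // scaler0.
by rewrite -scalemxAl => /eqP; rewrite scaler_eq0 (negbTE uj) => /eqP.
Qed.

(* If ker (ev h') is contained in ker (ev h), then ev h factors through M_3(F),
   and a nonzero row in the image of [delta_mx 0 0] spans an intertwiner. *)
Lemma separate_rows (I : finType) (h h' : I -> M) : sgen h -> sgen h' ->
  (forall g, g \in unitmx -> ~ intertwines h h' g) ->
  exists s, ev h' s = 0 /\ ev h s != 0.
Proof.
move=> gh gh' nc; have [//|nos] := pselect (exists s, ev h' s = 0 /\ ev h s != 0).
exfalso; have ker s : ev h' s = 0 -> ev h s = 0.
  by move=> e; apply/eqP; apply: contra_notT nos => ne; exists s.
have kerE s t : ev h' s = ev h' t -> ev h s = ev h t.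
  move=> e; have := ker (s ++ nc_mul (nc_const (-1)) t).
  rewrite (ev_cat h') (ev_cat h) !ev_mul !ev_const -!scalerAl !mul1r !scaleN1r e subrr => /(_ erefl).
  by move/eqP; rewrite subr_eq0 => /eqP.
pose S x : seq (F * seq I) := projT1 (cid (gh' x)).
have SE x : ev h' (S x) = x by rewrite /S; case: cid.
have th0 : ev h (S (delta_mx 0 0)) != 0.
  apply/eqP => e0.
  pose t := \big[cat/[::]]_(i : 'I_3)
     nc_mul (S (delta_mx i 0)) (nc_mul (S (delta_mx 0 0)) (S (delta_mx 0 i))).
  have: ev h t = ev h (nc_const 1).
    apply: kerE; rewrite ev_bigcat ev_const scale1r -[RHS]/(1%:M) scalar_mx_sum_delta.
    by apply: eq_bigr => i _; rewrite !ev_mul !SE -!mulmxE !mul_delta_mx scale1r.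
  rewrite ev_bigcat big1 => [|i _]; last by rewrite !ev_mul e0 mul0r mulr0.
  by rewrite ev_const scale1r => /eqP; rewrite eq_sym oner_eq0.
have [u0 ue] := row_neq0 th0.
pose g : M := \matrix_j row u0 (ev h (S (delta_mx 0 j))).
have g0 : g != 0.
  by apply: contraNneq ue => /(congr1 (row 0)); rewrite rowK row0 => ->.
have gi : intertwines h h' g.
  move=> i; apply/row_matrixP => j; rewrite [LHS]row_mul rowK -[LHS]row_mul [RHS]row_mul.
  have -> : ev h (S (delta_mx 0 j)) *m h i = ev h (nc_mul (S (delta_mx 0 j)) (nc_var i)).
    by rewrite ev_mul ev_var.
  rewrite (kerE _ (\big[cat/[::]]_k nc_mul (nc_const (h' i j k)) (S (delta_mx 0 k)))).
    rewrite ev_bigcat linear_sum mulmx_sum_row; apply: eq_bigr => k _.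
    by rewrite ev_mul ev_const -scalerAl mul1r linearZ rowK mxE.
  rewrite ev_bigcat ev_mul SE ev_var -mulmxE.
  have -> : delta_mx 0 j *m h' i = \sum_k h' i j k *: (delta_mx 0 k : M).
    apply/matrixP => a b; rewrite summxE !mxE (bigD1 j) //= big1 ?addr0 => [|k kj]; last first.
      by rewrite mxE (negbTE kj) andbF mul0r.
    rewrite mxE eqxx andbT (bigD1 b) //= big1 ?addr0 => [|k kb]; last first.
      by rewrite !mxE [b == k]eq_sym (negbTE kb) andbF mulr0.
    by rewrite !mxE eqxx andbT mulrC.
  by apply: eq_bigr => k _; rewrite ev_mul ev_const SE -scalerAl mul1r.
exact: nc (intertwines_unit gh' g0 gi) gi.
Qed.

Lemma rgen_sgen (I : finType) (L : finType) (h : I -> L -> M) : rgen h ->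
  forall l, sgen (fun i => h i l).
Proof. by move=> gh l x; have [s es] := gh (fun _ => x); exists s; rewrite es. Qed.

Lemma rgen_nonconj (I : finType) (L : finType) (h : I -> L -> M) : rgen h ->
  forall l l', l != l' -> forall g, g \in unitmx ->
  ~ intertwines (fun i => h i l) (fun i => h i l') g.
Proof.
move=> gh l l' ll g gu gi.
have [s es] := gh (fun j => if j == l then 1%:M else 0).
have := intertwines_ev s gi; rewrite !es eqxx eq_sym (negbTE ll) mulmx1 mul0mx => g0.
by move: gu; rewrite g0 -row_free_unit /row_free mxrank0.
Qed.

(** Each factor is simple: sandwiching a nonzero entry between matrix units turns a separating
    expression into one that is 1 in row l and 0 in row l'. Products of these over l' give the
    idempotent of row l. *)
Lemma goursat (I : finType) (L : finType) (h : I -> L -> M) :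
  (forall l, sgen (fun i => h i l)) ->
  (forall l l', l != l' -> exists s, ev (fun i => h i l') s = 0 /\ ev (fun i => h i l) s != 0) ->
  rgen h.
Proof.
move=> gh sep x.
have sep1 l l' : l != l' -> exists s, ev (fun i => h i l') s = 0 /\ ev (fun i => h i l) s = 1.
  move=> /sep [s [s0 s1]]; set y := ev _ s in s1.
  have [a [b yab]] : exists a b, y a b != 0.
    have /existsP [a /existsP [b yab]] : [exists a, exists b, y a b != 0].
      apply: contraNT s1 => /existsPn H; apply/eqP/matrixP => a b; rewrite mxE.
      by have /existsPn /(_ b) := H a; rewrite negbK => /eqP.
    by exists a, b.
  have /choice [S SE] := gh l.
  pose T i := nc_mul (S (delta_mx i a)) (nc_mul s (nc_mul (nc_const (y a b)^-1) (S (delta_mx b i)))).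
  exists (\big[cat/[::]]_i T i); rewrite !ev_bigcat; split.
    by apply: big1 => i _; rewrite !ev_mul s0 mul0r mulr0.
  rewrite -[RHS]/(1%:M) scalar_mx_sum_delta; apply: eq_bigr => i _; rewrite scale1r.
  rewrite !ev_mul !SE ev_const -/y -scalerAl mul1r -!scalerAr -!mulmxE.
  have -> : delta_mx i a *m (y *m delta_mx b i) = y a b *: delta_mx i i :> M.
    apply/matrixP => c d; rewrite !mxE (bigD1 a) //= big1 ?addr0 => [|k ka]; last first.
      by rewrite mxE (negbTE ka) andbF mul0r.
    rewrite !mxE eqxx andbT (bigD1 b) //= big1 ?addr0 => [|k kb]; last first.
      by rewrite mxE (negbTE kb) mulr0.
    by rewrite mxE eqxx /= mulrCA -natrM mulnb.
  by rewrite scalerA mulVf // scale1r.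
have sep2 l : exists s, ev (fun i => h i l) s = 1 /\
    forall l', l' != l -> ev (fun i => h i l') s = 0.
  suff H (r : seq L) : exists s, ev (fun i => h i l) s = 1 /\
      forall l', l' \in r -> l' != l -> ev (fun i => h i l') s = 0.
    by have [s [s1 s0]] := H (enum L); exists s; split=> // l'; apply: s0; rewrite mem_enum.
  elim: r => [|l0 r [s [s1 s0]]].
    by exists (nc_const 1); split=> //; rewrite ev_const scale1r.
  case: (eqVneq l0 l) => [->|ll0].
    exists s; split=> // l'; rewrite inE => /orP [/eqP -> |]; last exact: s0.
    by rewrite eqxx.
  have [t [t0 t1]] : exists t, ev (fun i => h i l0) t = 0 /\ ev (fun i => h i l) t = 1.
    by apply: sep1; rewrite eq_sym.
  exists (nc_mul t s); split; first by rewrite ev_mul t1 s1 mulr1.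
  move=> l'; rewrite inE ev_mul => /orP [/eqP ->|lr] ll; first by rewrite t0 mul0r.
  by rewrite s0 ?mulr0.
apply: (@rowalg_ext _ _ _ h (fun l => \sum_m if l == m then x m else 0)).
  move=> l; rewrite (bigD1 l) //= eqxx big1 ?addr0 // => m ml.
  by rewrite eq_sym (negbTE ml).
apply: rowalg_sum => m _; have [s [s1 s0]] := sep2 m; have [t et] := gh m (x m).
exists (nc_mul s t) => l; rewrite ev_mul; case: (eqVneq l m) => [->|lm].
  by rewrite s1 mul1r et.
by rewrite s0 // mul0r.
Qed.

Section Orbits.
Variable k : nat.
Local Notation tup := {ffun 'I_k -> M}.
Local Notation q := #|F|.

Definition Sg : {set tup} := [set h : tup | `[< sgen h >]].
Definition conjr (h h' : tup) :=
  [exists g : M, (g \in unitmx) && [forall i, g *m h i == h' i *m g]].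

Lemma conjrP (h h' : tup) : reflect (exists2 g, g \in unitmx & intertwines h h' g) (conjr h h').
Proof.
apply: (iffP existsP) => [[g /andP [gu /forallP H]]|[g gu H]]; exists g => //.
  by move=> i; apply/eqP.
by rewrite gu; apply/forallP => i; apply/eqP.
Qed.

Lemma conjr_equiv : {in Sg & &, equivalence_rel conjr}.
Proof.
have refl h : conjr h h.
  by apply/conjrP; exists 1%:M; rewrite ?unitmx1 // => i; rewrite mul1mx mulmx1.
have sym h h' : conjr h h' -> conjr h' h.
  move=> /conjrP [g gu gi]; apply/conjrP; exists (invmx g); rewrite ?unitmx_inv // => i.
  apply: (can_inj (mulKmx gu)); rewrite !mulmxA mulmxV // mul1mx gi -mulmxA mulmxV //.
  by rewrite mulmx1.
have trans h h' h'' : conjr h h' -> conjr h' h'' -> conjr h h''.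
  move=> /conjrP [g gu gi] /conjrP [g' gu' gi']; apply/conjrP; exists (g' *m g).
    by rewrite unitmx_mul gu gu'.
  by move=> i; rewrite -mulmxA gi !mulmxA gi'.
move=> h h' h'' _ _ _; split=> [|hh']; first exact: refl.
by apply/idP/idP; apply: trans => //; apply: sym.
Qed.

Definition classes := equivalence_partition conjr Sg.

Lemma classesP : partition classes Sg.
Proof. exact: equivalence_partitionP conjr_equiv. Qed.

Definition conjt (g : M) (h : tup) : tup := [ffun i => g *m h i *m invmx g].

Lemma sgen_conjt (g : M) (h : tup) : g \in unitmx -> sgen h -> sgen (conjt g h).
Proof.
move=> gu gh x; have [s es] := gh (invmx g *m x *m g); exists s.
have gi : intertwines h (conjt g h) g by move=> i; rewrite ffunE mulmxKV.
have := intertwines_ev s gi; rewrite es !mulmxA mulmxV // mul1mx => e.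
by apply: (can_inj (mulmxK gu)).
Qed.

Lemma card_unitmx : #|[set g : M | g \in unitmx]| = ((q ^ 3 - 1) * (q ^ 3 - q) * (q ^ 3 - q ^ 2))%N.
Proof.
have -> : #|[set g : M | g \in unitmx]| = #|'GL_3[F]%g|.
  rewrite -[RHS](card_imset _ val_inj); apply: eq_card => g; rewrite inE.
  apply/idP/imsetP => [gu|[u _ ->]]; last exact: (valP u).
  by exists (Sub g gu).
rewrite card_GL // 3?big_ltn // big_geq // muln1.
have -> : ('C(3, 2) = 3)%N by [].
have q0 := q_gt0 F.
have -> : (q ^ 3 - q = q * (q ^ 2 - 1))%N by rewrite mulnBr muln1 expnS.
have -> : (q ^ 3 - q ^ 2 = q ^ 2 * (q - 1))%N by rewrite mulnBr muln1 -expnSr.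
rewrite expn1 expnS; set a := (q ^ 2)%N; nia.
Qed.

(** Conjugation maps the invertible matrices onto the class. Two matrices with the same image differ
    by one that commutes with the whole matrix algebra, that is, by a nonzero scalar. *)
Lemma card_class A : A \in classes ->
  (#|A| * (q - 1) = (q ^ 3 - 1) * (q ^ 3 - q) * (q ^ 3 - q ^ 2))%N.
Proof.
move=> /imsetP [h hS ->]; rewrite -card_unitmx.
have gh : sgen h by move: hS; rewrite inE => /asboolP.
set B := [set h' in Sg | conjr h h'].
have part (g : M) : g \in [set g : M | g \in unitmx] -> conjt g h \in B.
  rewrite inE => gu; rewrite !inE; apply/andP; split.
    by apply/asboolP; apply: sgen_conjt.
  by apply/conjrP; exists g => // i; rewrite ffunE mulmxKV.
rewrite -[RHS]sum1_card (partition_big (conjt^~ h) (mem B)) //= -sum_nat_const.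
apply: eq_bigr => h' /[!inE] /andP [_ /conjrP [g gu gi]].
rewrite sum1dep_card.
have -> : (q - 1)%N = #|[set~ (0 : F)]| by rewrite cardsC1 subn1.
have inj : injective (fun c : F => c *: g).
  move=> c d e; apply/eqP; rewrite -subr_eq0.
  have /eqP := e; rewrite -subr_eq0 -scalerBl scaler_eq0.
  have /negbTE -> : g != 0 by apply: contraTneq gu => ->; rewrite -row_free_unit /row_free mxrank0.
  by rewrite orbF.
rewrite -(card_imset _ inj); apply: eq_card => g'; rewrite [RHS]inE.
apply/imsetP/andP.
  move=> [c]; rewrite !inE => c0 ->; split; first by rewrite unitmxZ // unitfE.
  apply/eqP/ffunP => i; rewrite ffunE -scalemxAl gi.
  rewrite invmxZ ?unitmxZ ?unitfE // -scalemxAl -scalemxAr scalerA mulfV // scale1r.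
  by rewrite mulmxK.
rewrite inE => [[gu' /eqP e]].
have gi' : intertwines h h' g' by move=> i; rewrite -e ffunE mulmxKV.
have cm x : (invmx g *m g') *m x = x *m (invmx g *m g').
  have [s <-] := gh x; rewrite -mulmxA (intertwines_ev s gi').
  apply: (can_inj (mulKmx gu)); rewrite !mulmxA mulmxV // mul1mx.
  by rewrite (intertwines_ev s gi) -(mulmxA _ g) mulmxV // mulmx1.
have [c ec] : exists c, invmx g *m g' = c%:M.
  exists ((invmx g *m g') 0 0); move: (invmx g *m g') cm => Y cm.
  apply/matrixP => a b; have /matrixP /(_ a 0) := cm (delta_mx b 0).
  rewrite !mxE (bigD1 b) //= big1 ?addr0 => [|i ib]; last by rewrite mxE (negbTE ib) mulr0.
  rewrite mxE !eqxx mulr1 => ->; rewrite (bigD1 0) //= big1 ?addr0 => [|i i0].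
    by rewrite mxE eqxx andbT mulr_natl.
  by rewrite mxE (negbTE i0) andbF mul0r.
have eg : g' = c *: g by rewrite -[g'](mulKVmx gu) ec mul_mx_scalar.
exists c => //; rewrite !inE; apply: contraTneq gu' => c0.
by rewrite eg c0 scale0r -row_free_unit /row_free mxrank0.
Qed.

End Orbits.
End Goursat.

(** * Generation over a finite field and f_k *)

Section FiniteField.
Variables (F : finFieldType) (k : nat).
Local Notation M := 'M[F]_3.
Local Notation q := #|F|.
Local Notation tup := {ffun 'I_k -> M}.

Lemma card_classes_GL : (#|Sg F k| * (q - 1)
  = #|classes F k| * ((q ^ 3 - 1) * (q ^ 3 - q) * (q ^ 3 - q ^ 2)))%N.
Proof.
pose c := (((q ^ 3 - 1) * (q ^ 3 - q) * (q ^ 3 - q ^ 2)) %/ (q - 1))%N.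
have q1 : (0 < q - 1)%N by rewrite subn_gt0 q_gt1.
have cA : {in classes F k, forall A : {set tup}, #|A| = c}.
  by move=> A AP; rewrite /c -(card_class AP) mulnK.
rewrite (card_uniform_partition cA (classesP F k)).
case: (set_0Vmem (classes F k)) => [->|[A AP]]; first by rewrite cards0.
by rewrite -mulnA -(cA A AP) card_class.
Qed.

Lemma card_classes_fk : (2 <= k)%N -> #|classes F k|%:R = fk k q%:R.
Proof.
case: k card_classes_GL (card_sgen F k) => [|[|j]] // + + _.
rewrite -/(Sg F j.+2) => e cS.
have x1 : 1 < q%:R :> rat by rewrite -[1]/(1%:R) ltr_nat q_gt1.
have := congr1 (fun m => m%:R : rat) e; rewrite !natrM cS.
have le1 : (0 < q ^ 3)%N by rewrite expn_gt0 q_gt0.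
have le2 : (q <= q ^ 3)%N by rewrite -{1}[q]expn1 leq_exp2l ?q_gt1.
have le3 : (q ^ 2 <= q ^ 3)%N by rewrite leq_exp2l ?q_gt1.
rewrite !natrB // ?q_gt0 // !natrX; move: #|classes F j.+2|%:R => N {e cS le1 le2 le3}.
move: q%:R x1 => x x1 e; rewrite /fk /=.
(* With all exponents split along j, the claim becomes a rational identity in x and Y = x^j. *)
have -> : (3 * j.+2 + 1 = j + j + j + 7)%N by lia.
have -> : (j.+2 - 1 = j + 1)%N by lia.
have -> : (3 * j.+2 - 2 = j + j + j + 4)%N by lia.
have -> : (2 * j.+2 - 2 = j + j + 2)%N by lia.
have -> : (j.+2 - 2 = j)%N by lia.
have -> : (j.+2 = j + 2)%N by lia.
rewrite -[j.+2]addn2 !exprD /gen_count in e *.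
move: (x ^+ j) e => Y e.
have x0 : x != 0 by lra.
have xm : x - 1 != 0 by lra.
have xp : x + 1 != 0 by lra.
have xq : x ^+ 2 + x + 1 != 0 by apply: lt0r_neq0; nra.
have n0 : (x ^+ 3 - 1) * (x ^+ 3 - x) * (x ^+ 3 - x ^+ 2) != 0.
  rewrite (_ : _ * _ = x ^+ 3 * (x - 1) ^+ 3 * (x + 1) * (x ^+ 2 + x + 1)); last by ring.
  by rewrite !mulf_neq0 // expf_neq0.
apply: (mulIf n0); rewrite -e.
by field; rewrite ?x0 ?xm ?xp ?xq.
Qed.

Lemma conjrE (h h' : tup) g : g \in unitmx -> intertwines h h' g -> conjr h h'.
Proof. by move=> gu gi; apply/conjrP; exists g. Qed.

Lemma rgen_classes m :
  (exists h : 'I_k -> 'I_m -> M, rgen h) <-> (m <= #|classes F k|)%N.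
Proof.
have eqv := @conjr_equiv F k; have /and3P [/eqP cov triv n0] := classesP F k.
split=> [[h gh]|mle].
  pose H l : tup := [ffun i => h i l].
  have HS l : H l \in Sg F k.
    rewrite inE; apply/asboolP => x; have [s es] := rgen_sgen gh l x; exists s.
    by rewrite -es; apply: eq_ev => i; rewrite ffunE.
  have inj : injective (fun l => pblock (classes F k) (H l)).
    move=> l l' e; apply: contra_eq (erefl true) => ll.
    have : H l' \in pblock (classes F k) (H l).
      by rewrite e mem_pblock cov HS.
    rewrite (pblock_equivalence_partition eqv) ?HS // => /conjrP [g gu gi].
    case: (rgen_nonconj gh ll gu) => i; by have := gi i; rewrite !ffunE.
  rewrite -[m]card_ord -(card_imset predT inj); apply: subset_leq_card.
  by apply/subsetP => A /imsetP [l _ ->]; rewrite pblock_mem // cov HS.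
pose A (l : 'I_m) := enum_val (widen_ord mle l).
have AP l : A l \in classes F k := enum_valP _.
have /choice [H HA] : forall l, exists h, h \in A l.
  by move=> l; apply/set0Pn; apply: contraNneq n0 => <-.
have HS l : H l \in Sg F k by rewrite -cov; apply/bigcupP; exists (A l).
have Hg l : sgen (H l) by have := HS l; rewrite inE => /asboolP.
exists (fun i l => H l i); apply: goursat.
  exact: Hg.
move=> l l' ll; apply: separate_rows; [exact: Hg|exact: Hg|].
move=> g gu gi; have c : conjr (H l) (H l') by apply: conjrE gu gi.
move: ll; apply/negP; rewrite negbK.
have : H l' \in pblock (classes F k) (H l).
  by rewrite (pblock_equivalence_partition eqv) ?HS.
rewrite (def_pblock triv (AP l) (HA l)) => H'.
have eA : A l = A l'.
  by rewrite -(def_pblock triv (AP l) H') (def_pblock triv (AP l') (HA l')).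
by move/enum_val_inj: eA => /(congr1 val) /= e; apply/eqP; apply: val_inj.
Qed.

Lemma rgen_fk m : (2 <= k)%N ->
  (exists h : 'I_k -> 'I_m -> M, rgen h) <-> m%:R <= fk k q%:R.
Proof. by move=> k2; rewrite -card_classes_fk // ler_nat; apply: rgen_classes. Qed.

(** For k = 0 and k = 1 the value Q is 1 or x, and [gen_count] vanishes through its factors Q - 1
    and Q^2 - x^2. *)
Lemma no_sgen : (k <= 1)%N -> forall h : 'I_k -> M, ~ sgen h.
Proof.
move=> k1 h gh; have : #|Sg F k| = 0%N.
  apply/eqP; rewrite -(eqr_nat rat) card_sgen /gen_count.
  by case: k k1 => [|[|]] // _; apply/eqP; ring.
move/eqP; rewrite cards_eq0 => /eqP /setP /(_ [ffun i => h i]).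
rewrite !inE => /asboolP; apply => x; have [s es] := gh x; exists s.
by rewrite -es; apply: eq_ev => i; rewrite ffunE.
Qed.

End FiniteField.

(** * Monotonicity of f_k *)

Section Monotonicity.

(** The divisions by x - 1 and x + 1 are carried out as geometric sums, and the last factor of f_k
    is regrouped so that every factor is visibly nonnegative and increasing for x >= 2. *)
Lemma fk_factor j (x : rat) : 2%:R <= x ->
  fk j.+2 x = x ^+ (3 * j + 6) * (\sum_(i < j.+1) (x ^+ 2) ^+ i)
    * (x * (1 + x + x ^+ 2 * \sum_(i < j) x ^+ i) / (x ^+ 2 + x + 1))
    * (x ^+ j * ((x ^+ j.+2 - x - 1) * (x ^+ j.+2 + x + 1) + x ^+ j.+2) + (x + 1)).
Proof.
move=> x2; rewrite /fk /=.
have x0 : x != 0 by lra.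
have xm : x - 1 != 0 by lra.
have xp : x + 1 != 0 by lra.
have xq : x ^+ 2 + x + 1 != 0 by apply: lt0r_neq0; nra.
have S1 : \sum_(i < j.+1) (x ^+ 2) ^+ i = ((x ^+ j) ^+ 2 * x ^+ 2 - 1) / (x ^+ 2 - 1).
  have n : x ^+ 2 - 1 != 0 by rewrite (_ : _ - 1 = (x - 1) * (x + 1)) ?mulf_neq0 //; ring.
  apply: (mulfI n); rewrite -subrX1 [RHS]mulrC divfK //.
  by rewrite -exprM mulnC exprM exprS exprMn mulrC.
have S2 : \sum_(i < j) x ^+ i = (x ^+ j - 1) / (x - 1).
  by apply: (mulfI xm); rewrite -subrX1 [RHS]mulrC divfK.
rewrite S1 S2.
have -> : (3 * j.+2 + 1 = j + j + j + 7)%N by lia.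
have -> : (j.+2 - 1 = j + 1)%N by lia.
have -> : (3 * j.+2 - 2 = j + j + j + 4)%N by lia.
have -> : (2 * j.+2 - 2 = j + j + 2)%N by lia.
have -> : (j.+2 - 2 = j)%N by lia.
have -> : (3 * j + 6 = j + j + j + 6)%N by lia.
rewrite -[j.+2]addn2 !exprD; move: (x ^+ j) => Y.
have n : x ^+ 2 - 1 != 0 by rewrite (_ : _ - 1 = (x - 1) * (x + 1)) ?mulf_neq0 //; ring.
by field; rewrite ?n ?x0 ?xm ?xp ?xq.
Qed.

Lemma fk_mono k (x y : rat) : (2 <= k)%N -> 2%:R <= x -> x <= y -> fk k x <= fk k y.
Proof.
case: k => [|[|j]] // _ x2 xy.
have y2 : 2%:R <= y by apply: le_trans xy.
have x0 : 0 <= x by lra.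
have y0 : 0 <= y by lra.
have pX (z : rat) n : 0 <= z -> 0 <= z ^+ n by move=> z0; apply: exprn_ge0.
have mX n : x ^+ n <= y ^+ n by apply: lerXn2r.
rewrite !fk_factor //.
have s0 (z : rat) n : 0 <= z -> 0 <= \sum_(i < n) z ^+ i.
  by move=> z0; apply: sumr_ge0 => i _; apply: pX.
have sm (z w : rat) n : 0 <= z -> z <= w -> \sum_(i < n) z ^+ i <= \sum_(i < n) w ^+ i.
  by move=> z0 zw; apply: ler_sum => i _; apply: lerXn2r => //; apply: le_trans zw.
(* From 2 <= z one gets z^(j+2) >= z^2 >= z + 1. *)
have Y (z : rat) : 2%:R <= z -> 0 <= z ^+ j.+2 - z - 1.
  move=> z2; have : 1 <= z ^+ j by rewrite exprn_ege1 //; lra.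
  move=> a1; have b : z * z * 1 <= z * z * z ^+ j by apply: ler_wpM2l => //; nra.
  rewrite !exprS; move: (z ^+ j) b => Z; nra.
have Ym : x ^+ j.+2 - x - 1 <= y ^+ j.+2 - y - 1.
  have a1 : 1 <= x ^+ j by rewrite exprn_ege1 //; lra.
  have b1 : y * y * x ^+ j <= y * y * y ^+ j by apply: ler_wpM2l => //; nra.
  have b2 : (y * y - x * x) * 1 <= (y * y - x * x) * x ^+ j by apply: ler_wpM2l => //; nra.
  have b3 : y - x <= y * y - x * x by nra.
  by rewrite !exprS; lra.
apply: ler_pM; [| |apply: ler_pM; [| |apply: ler_pM|]|].
- apply: mulr_ge0; first by apply: mulr_ge0; [apply: pX|apply: s0; apply: pX].
  apply: divr_ge0; last by nra.
  apply: mulr_ge0 => //; apply: addr_ge0; first lra.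
  by apply: mulr_ge0; [apply: pX | apply: s0].
- apply: addr_ge0; last lra.
  apply: mulr_ge0; first exact: pX.
  apply: addr_ge0; last exact: pX.
  apply: mulr_ge0; first exact: Y.
  by have := pX x j.+2 x0; lra.
- by apply: mulr_ge0; [apply: pX|apply: s0; apply: pX].
- apply: divr_ge0; last by nra.
  apply: mulr_ge0 => //; apply: addr_ge0; first lra.
  by apply: mulr_ge0; [apply: pX | apply: s0].
- exact: pX.
- by apply: s0; apply: pX.
- exact: mX.
- by apply: sm; [apply: pX | apply: mX].
(* The quotient by x^2 + x + 1 is compared after cross-multiplication, separately for the parts x (1
   + x) and x^3 T, where T is the geometric sum. *)
- rewrite ler_pdivrMr; last by nra.
  rewrite [leRHS]mulrAC ler_pdivlMr; last by nra.
  have T0 := s0 x j x0; have Tm := sm x y j x0 xy.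
  move: (\sum_(i < j) x ^+ i) (\sum_(i < j) y ^+ i) T0 Tm => T T' T0 Tm.
  have T'0 : 0 <= T' by lra.
  have a1 : x * (1 + x) * (y ^+ 2 + y + 1) <= y * (1 + y) * (x ^+ 2 + x + 1).
    by rewrite -subr_ge0 (_ : _ - _ = (y - x) * (y + x + 1)); [apply: mulr_ge0; lra | ring].
  have a2 : x ^+ 3 * (y ^+ 2 + y + 1) <= y ^+ 3 * (x ^+ 2 + x + 1).
    rewrite -subr_ge0 (_ : _ - _ = (y - x) * (x ^+ 2 * y ^+ 2 + x * y * (x + y) + (y ^+ 2 + x * y + x ^+ 2))); last by ring.
    by apply: mulr_ge0; [lra | nra].
  have a3 : T * (x ^+ 3 * (y ^+ 2 + y + 1)) <= T' * (y ^+ 3 * (x ^+ 2 + x + 1)).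
    apply: ler_pM => //; apply: mulr_ge0; first exact: pX.
    by nra.
  have -> : x * (1 + x + x ^+ 2 * T) * (y ^+ 2 + y + 1)
     = x * (1 + x) * (y ^+ 2 + y + 1) + T * (x ^+ 3 * (y ^+ 2 + y + 1)) by ring.
  have -> : y * (1 + y + y ^+ 2 * T') * (x ^+ 2 + x + 1)
     = y * (1 + y) * (x ^+ 2 + x + 1) + T' * (y ^+ 3 * (x ^+ 2 + x + 1)) by ring.
  exact: lerD.
apply: lerD; last lra.
apply: ler_pM; [exact: pX| |exact: mX|].
  apply: addr_ge0; last exact: pX.
  by apply: mulr_ge0; [exact: Y|have := pX x j.+2 x0; lra].
apply: lerD; last exact: mX.
apply: ler_pM => //; first exact: Y.
  by have := pX x j.+2 x0; lra.
by have := mX j.+2; lra.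
Qed.

End Monotonicity.

(** * Residue fields *)

Definition surj (A B : Type) (f : A -> B) := forall y, exists x, f x = y.

(** The field is built on T itself, with operations transported along the projection [p] and its
    section [s]; its order is then that of T by construction. *)
Lemma quotient_field (R : comNzRingType) (J : R -> Prop) (T : finType)
    (p : R -> T) (s : T -> R) :
  (forall x y, J x -> J y -> J (x + y)) -> (forall r x, J x -> J (r * x)) ->
  ~ J 1 -> (forall x, ~ J x -> exists y, J (x * y - 1)) ->
  cancel s p -> (forall x y, p x = p y <-> J (x - y)) ->
  exists (F : finFieldType) (f : {rmorphism R -> F}),
    [/\ surj f, forall x, f x = 0 <-> J x & #|F| = #|T|].
Proof.
move=> JD JM J1 Jinv sK pP.
have J0 : J 0 by rewrite -(subrr 0); apply/pP.
have JN x : J x -> J (- x) by move=> Jx; rewrite -mulN1r; apply: JM.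
have sp x : J (s (p x) - x) by apply/pP; rewrite sK.
have eqp x y : J (x - y) -> p x = p y by move/pP.
pose add a b := p (s a + s b). pose opp a := p (- s a).
pose mul a b := p (s a * s b).
have pD x y : p (x + y) = add (p x) (p y).
  apply: eqp; rewrite (_ : _ - _ = - (s (p x) - x) + - (s (p y) - y)); last by ring.
  by apply: JD; apply: JN.
have pM x y : p (x * y) = mul (p x) (p y).
  apply: eqp; rewrite (_ : _ - _ = - (s (p y) * (s (p x) - x)) + - (x * (s (p y) - y))); last by ring.
  by apply: JD; apply: JN; apply: JM.
have pN x : p (- x) = opp (p x).
  by apply: eqp; rewrite (_ : _ - _ = s (p x) - x) //; ring.
have P a : exists x, p x = a by exists (s a).
have addA : associative add.
  by move=> a b c; have [x <-] := P a; have [y <-] := P b; have [z <-] := P c; rewrite -!pD addrA.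
have addC : commutative add by move=> a b; rewrite /add addrC.
have add0 : left_id (p 0) add by move=> a; have [x <-] := P a; rewrite -pD add0r.
have addN : left_inverse (p 0) opp add by move=> a; have [x <-] := P a; rewrite -pN -pD addNr.
have mulA : associative mul.
  by move=> a b c; have [x <-] := P a; have [y <-] := P b; have [z <-] := P c; rewrite -!pM mulrA.
have mulC : commutative mul by move=> a b; rewrite /mul mulrC.
have mul1 : left_id (p 1) mul by move=> a; have [x <-] := P a; rewrite -pM mul1r.
have mulD : left_distributive mul add.
  by move=> a b c; have [x <-] := P a; have [y <-] := P b; have [z <-] := P c; rewrite -!(pD,pM) mulrDl.
have one0 : p 1 != p 0 by apply/eqP => /pP; rewrite subr0.
have /choice [inv invP] : forall a, exists b, (a != p 0 -> mul b a = p 1) /\ (a = p 0 -> b = p 0).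
  move=> a; case: (eqVneq a (p 0)) => [->|a0]; first by exists (p 0).
  have [x ex] := P a.
  have [|y Jy] := Jinv x; first by move=> Jx; move/eqP: a0; apply; rewrite -ex; apply: eqp; rewrite subr0.
  exists (p y); split=> // [_|ea]; first by rewrite -ex -pM mulrC; apply: eqp.
  by rewrite ea eqxx in a0.
pose mz := GRing.isZmodule.Build T addA addC add0 addN.
pose Zt : zmodType := HB.pack (T : Type) (Finite.class T) mz.
pose mr := GRing.Zmodule_isComNzRing.Build Zt mulA mulC mul1 mulD one0.
pose Rt : comNzRingType := HB.pack (T : Type) (Finite.class T) mz mr.
have mulV : forall a : Rt, a != 0 -> (inv a : Rt) * a = 1 by move=> a a0; apply: (invP a).1.
have inv0 : (inv (0 : Rt) : Rt) = 0 by apply: (invP _).2.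
pose mf := GRing.ComNzRing_isField.Build Rt mulV inv0.
pose Ft : finFieldType := HB.pack (T : Type) (Finite.class T) mz mr mf.
have pa : zmod_morphism (p : R -> Ft).
  by move=> x y; rewrite -[- y]/(- y) pD pN.
have pm : monoid_morphism (p : R -> Ft) by split.
pose ma := GRing.isZmodMorphism.Build R Ft p pa.
pose mm := GRing.isMonoidMorphism.Build R Ft p pm.
pose f : {rmorphism R -> Ft} := HB.pack (p : R -> Ft) ma mm.
exists Ft, f; split=> //.
  move=> x; split=> [e|Jx]; first by rewrite -[x]subr0; apply/pP.
  by apply: eqp; rewrite subr0.
by apply: (@bij_eq_card Ft T (fun x => x)); exists (fun x => x).
Qed.

Section Residues.
Variable R : idomainType.
Hypothesis char0 : forall n : nat, (0 < n)%N -> (n%:R : R) != 0.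
Hypothesis dvd_nat : forall r : R, r != 0 ->
  exists n : nat, (0 < n)%N /\ exists y, n%:R = r * y.
Hypothesis prime_nonunit : forall p : nat, prime p -> forall y : R, p%:R * y != 1.
Hypothesis fin_quo : forall n : nat, (0 < n)%N ->
  exists (N : nat) (L : 'I_N -> R), forall x, exists i y, x = L i + n%:R * y.

Definition ideal (J : R -> Prop) :=
  [/\ J 0, (forall x y, J x -> J y -> J (x + y)) & (forall r x, J x -> J (r * x))].

Lemma idealB J x y : ideal J -> J x -> J y -> J (x - y).
Proof. by move=> [_ JD JM] Jx Jy; apply: JD => //; rewrite -mulN1r; apply: JM. Qed.

Lemma fin_quo_r r : r != 0 ->
  exists (N : nat) (L : 'I_N -> R), forall x, exists i y, x = L i + r * y.
Proof.
move=> /dvd_nat [n [n0 [z ez]]]; have [N [L HL]] := fin_quo n0.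
by exists N, L => x; have [i [y ->]] := HL x; exists i, (z * y); rewrite ez mulrA.
Qed.

(** The zero ideal is replaced by the ideal of 2. Otherwise J contains a positive integer n, and an
    ideal above J is determined by the representatives modulo n that it contains; one that contains
    as many as possible without containing 1 is maximal. *)
Lemma ideal_residue J : ideal J -> ~ J 1 ->
  exists (F : finFieldType) (f : {rmorphism R -> F}),
    surj f /\ forall x, J x -> f x = 0.
Proof.
move=> idJ J1.
wlog [n n0 Jn] : J idJ J1 / exists2 n : nat, (0 < n)%N & J n%:R.
  move=> W; have [[r r0 Jr]|nr] := pselect (exists2 r, r != 0 & J r).
    have [n [n0 [y ey]]] := dvd_nat r0; apply: (W J) => //; exists n => //.
    by rewrite ey mulrC; case: idJ => _ _; apply.
  pose J2 (x : R) := exists y, x = 2%:R * y.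
  have id2 : ideal J2.
    split; first by exists 0; rewrite mulr0.
      by move=> x y [a ->] [b ->]; exists (a + b); rewrite mulrDr.
    by move=> a x [y ->]; exists (a * y); rewrite mulrCA.
  have [|||F [f [fs fJ]]] := W J2 => //.
  - by move=> [y e]; have := @prime_nonunit 2 isT y; rewrite -e eqxx.
  - by exists 2%N => //; exists 1; rewrite mulr1.
  exists F, f; split=> // x Jx; suff -> : x = 0 by rewrite rmorph0.
  by apply/eqP; apply: contra_notT nr => x0; exists x.
have [N [L HL]] := fin_quo n0.
pose T (K : R -> Prop) : {set 'I_N} := [set i | `[< K (L i) >]].
pose good (A : {set 'I_N}) :=
  `[< exists K, [/\ ideal K, forall x, J x -> K x, ~ K 1 & T K = A] >].
have gJ : good (T J) by apply/asboolP; exists J.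
case: (arg_maxnP (fun A : {set 'I_N} => #|A|) gJ) => A /asboolP [K [idK JK K1 <-]] Amax.
have [K0 KD KM] := idK.
have Kinv x : ~ K x -> exists y, K (x * y - 1).
  move=> nKx; pose K' z := exists a b, K a /\ z = a + x * b.
  have idK' : ideal K'.
    split; first by exists 0, 0; rewrite mulr0 addr0.
      move=> u v [a [b [Ka ->]]] [c [d [Kc ->]]]; exists (a + c), (b + d).
      by split; [apply: KD | ring].
    move=> r u [a [b [Ka ->]]]; exists (r * a), (r * b).
    by split; [apply: KM | ring].
  have KK' z : K z -> K' z by move=> Kz; exists z, 0; rewrite mulr0 addr0.
  have K'x : K' x by exists 0, 1; rewrite mulr1 add0r.
  have [[a [b [Ka e]]]|nK'1] := pselect (K' 1).
    exists b; rewrite (_ : _ - 1 = - a); first by rewrite -mulN1r; apply: KM.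
    by rewrite e; ring.
  have gK' : good (T K').
    by apply/asboolP; exists K'; split=> // z /JK /KK'.
  have : (#|T K'| <= #|T K|)%N := Amax _ gK'.
  rewrite leqNgt => /negP; case; apply: proper_card.
  apply/properP; split.
    by apply/subsetP => i; rewrite !inE => /asboolP /KK' /asboolP.
  have [i [y ex]] := HL x.
  have Kny : K (n%:R * y) by rewrite mulrC; apply/KM/JK.
  exists i; rewrite inE.
    apply/asboolP; rewrite (_ : L i = x - n%:R * y); last by rewrite ex addrK.
    exact: idealB (KK' _ Kny).
  by apply/asboolPn => KLi; apply: nKx; rewrite ex; apply: KD.
have HK x : exists i, K (x - L i).
  have [i [y ->]] := HL x; exists i; rewrite addrC addKr mulrC.
  by apply/KM/JK.
(* Several [L i] may be congruent modulo K. [pick] selects one index per class, and [I0] consists of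
   the selected indices. *)
pose kap x : option 'I_N := [pick i | `[< K (x - L i) >]].
have kapP x : exists2 i, kap x = Some i & K (x - L i).
  rewrite /kap; case: pickP => [i /asboolP Ki|none]; first by exists i.
  by have [i Ki] := HK x; have := none i; move/asboolP: Ki => ->.
have kapE x y : K (x - y) -> kap x = kap y.
  move=> Kxy; apply: eq_pick => i; apply/asboolP/asboolP => H.
    rewrite (_ : _ - _ = (x - L i) - (x - y)); [exact: idealB | ring].
  by rewrite (_ : _ - _ = (y - L i) + (x - y)); [apply: KD | ring].
pose I0 := {i : 'I_N | kap (L i) == Some i}.
have /choice [p pP] : forall x, exists i : I0, K (x - L (val i)).
  move=> x; have [i ei Ki] := kapP x.
  have hi : kap (L i) == Some i.
    by rewrite -ei; apply/eqP/kapE; rewrite -opprB -mulN1r; apply: KM.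
  by exists (Sub i hi).
have pE x y : p x = p y <-> K (x - y).
  split=> [e|Kxy].
    rewrite (_ : x - y = (x - L (val (p x))) - (y - L (val (p y)))).
      exact: idealB.
    by rewrite e; ring.
  apply: val_inj; apply: Some_inj.
  have := valP (p x); have := valP (p y) => /eqP <- /eqP <-; apply: kapE.
  rewrite (_ : _ - _ = (x - y) - (x - L (val (p x))) + (y - L (val (p y)))).
    by apply: KD => //; apply: idealB.
  by ring.
have [F [f [fs fK _]]] : exists (F : finFieldType) (f : {rmorphism R -> F}),
    [/\ surj f, forall x, f x = 0 <-> K x & #|F| = #|{: I0}|].
  apply: (@quotient_field R K I0 p (fun i => L (val i))) => //.
  move=> i; apply: val_inj; apply: Some_inj; have := valP (p (L (val i))).
  by have := valP i => /eqP <- /eqP <-; apply: kapE; rewrite -opprB -mulN1r; apply: KM.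
exists F, f; split=> // x /JK; by move/fK.
Qed.

(* Chinese remaindering for conditions that only depend on x modulo each of the
   finitely many maximal ideals containing r; Q is indexed by these ideals. *)
Lemma crt (J : finType) (r : R) (Q : (R -> Prop) -> (J -> R) -> Prop) :
  r != 0 ->
  (forall (F : finFieldType) (f : {rmorphism R -> F}) x y, (forall j, f (x j) = f (y j)) ->
     Q (fun z => f z = 0) x -> Q (fun z => f z = 0) y) ->
  (forall (F : finFieldType) (f : {rmorphism R -> F}), surj f -> f r = 0 ->
     exists x, Q (fun z => f z = 0) x) ->
  exists x, forall (F : finFieldType) (f : {rmorphism R -> F}), surj f -> f r = 0 ->
     Q (fun z => f z = 0) x.
Proof.
move=> r0 Qc Qe; have [N [L HL]] := fin_quo_r r0.
(* The kernel of f is recorded by the representatives modulo r that it contains. This leaves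
   finitely many kernels and avoids quantifying over fields in the finite sums and products
   below. *)
pose T (F : finFieldType) (f : {rmorphism R -> F}) : {set 'I_N} := [set i | f (L i) == 0].
have TE (F F' : finFieldType) (f : {rmorphism R -> F}) (f' : {rmorphism R -> F'}) :
    f r = 0 -> f' r = 0 -> T F f = T F' f' -> (fun z => f z = 0) = (fun z => f' z = 0).
  move=> fr f'r e; apply/funext => z; apply/propext.
  have [i [y ->]] := HL z; rewrite !rmorphD !rmorphM fr f'r !mul0r !addr0.
  by have /setP /(_ i) := e; rewrite !inE => E; split=> /eqP H; apply/eqP; move: H; rewrite E.
pose isK (A : {set 'I_N}) := exists (F : finFieldType) (f : {rmorphism R -> F}),
   [/\ surj f, f r = 0 & T F f = A].
have /choice [X XP] : forall A : {set 'I_N}, exists x : J -> R, forall (F : finFieldType) (f : {rmorphism R -> F}),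
    surj f -> f r = 0 -> T F f = A -> Q (fun z => f z = 0) x.
  move=> A; have [[F [f [fs fr fA]]]|nA] := pselect (isK A); last first.
    by exists (fun _ => 0) => F f fs fr fA; case: nA; exists F, f.
  have [x Qx] := Qe F f fs fr; exists x => F' f' fs' fr' fA'.
  by rewrite -(TE F F' f f') // fA fA'.
have sep (A B : {set 'I_N}) : exists e : R, A != B -> isK A -> isK B ->
    forall (F : finFieldType) (f : {rmorphism R -> F}), surj f -> f r = 0 ->
    (T F f = A -> f e = 1) /\ (T F f = B -> f e = 0).
  have [[AB [kA kB]]|n] := pselect (A != B /\ isK A /\ isK B); last first.
    by exists 0 => AB kA kB; case: n.
  have [F [f [fs fr fA]]] := kA; have [G [g [gs gr gB]]] := kB.
  have [e [fe ge]] : exists e, f e = 1 /\ g e = 0.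
    have [[y [gy fy]]|n] := pselect (exists y, g y = 0 /\ f y != 0).
      have [z ez] := fs (f y)^-1; exists (y * z).
      by rewrite !rmorphM gy mul0r ez mulfV.
    have [y [fy gy]] : exists y, f y = 0 /\ g y != 0.
      have [//|n'] := pselect (exists y, f y = 0 /\ g y != 0); exfalso.
      move/eqP: AB; apply; apply/setP => i; rewrite -fA -gB !inE.
      case: (eqVneq (f (L i)) 0) => fi; case: (eqVneq (g (L i)) 0) => gi //.
        by case: n'; exists (L i).
      by case: n; exists (L i).
    have [z ez] := gs (g y)^-1; exists (1 - y * z).
    by rewrite !rmorphB !rmorphM !rmorph1 fy mul0r subr0 ez mulfV // subrr.
  exists e => _ _ _ F' f' fs' fr'; split=> fT.
    have := congr1 (fun K => K (e - 1)) (TE F' F f' f fr' fr (etrans fT (esym fA))).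
    have fe1 : f (e - 1) = 0 by rewrite rmorphB fe rmorph1 subrr.
    rewrite /= fe1 => k.
    have : f' (e - 1) = 0 by rewrite k.
    by move/eqP; rewrite rmorphB rmorph1 subr_eq0 => /eqP.
  have := congr1 (fun K => K e) (TE F' G f' g fr' gr (etrans fT (esym gB))).
  by rewrite /= ge => ->.
have /choice [e0 e0P] : forall A, exists e : {set 'I_N} -> R, forall B, A != B -> isK A -> isK B ->
    forall (F : finFieldType) (f : {rmorphism R -> F}), surj f -> f r = 0 ->
    (T F f = A -> f (e B) = 1) /\ (T F f = B -> f (e B) = 0).
  by move=> A; have /choice [e eP] := sep A; exists e.
pose e A := \prod_(B | (A != B) && `[< isK B >]) e0 A B.
exists (fun j => \sum_(A | `[< isK A >]) e A * X A j) => F f fs fr.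
have kT : isK (T F f) by exists F, f.
apply: (Qc F f (X (T F f))); last exact: XP.
move=> j; rewrite rmorph_sum (bigD1 (T F f)) /=; last exact/asboolP.
have -> : f (e (T F f) * X (T F f) j) = f (X (T F f) j).
  rewrite rmorphM /e rmorph_prod big1 ?mul1r // => B /andP [TB /asboolP kB].
  by have [-> //] := e0P _ B TB kT kB F f fs fr.
rewrite big1 ?addr0 // => A /andP [/asboolP kA AT].
rewrite rmorphM /e rmorph_prod (bigD1 (T F f)) /=; last first.
  by rewrite AT; apply/asboolP.
by have [_ -> //] := e0P A _ AT kA kT F f fs fr; rewrite !mul0r.
Qed.

End Residues.

(** * Lines of pairs of matrices *)

Section TopDegree.
Variable A : comNzRingType.
Implicit Types (p r : {poly A}) (d e : nat).

(** The coefficient [c] may be 0, so the predicate is compatible with sums and products over any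
    ring, unlike degree and leading coefficient. *)
Definition ptop d p (c : A) := (size p <= d.+1)%N /\ p`_d = c.

Lemma ptopM d e p r a b : ptop d p a -> ptop e r b -> ptop (d + e) (p * r) (a * b).
Proof.
move=> [sp <-] [sr <-]; split.
  apply: leq_trans (size_polyMleq _ _) _.
  by move: (size p) (size r) sp sr => m n; lia.
rewrite coefM (bigD1 (Ordinal (leq_addr e d : (d < (d + e).+1)%N))) //= addKn.
rewrite big1 ?addr0 // => j jd.
have : (j : nat) != d by apply: contra jd => /eqP jd; apply/eqP/val_inj.
rewrite neq_ltn => /orP [jlt|dlt].
  rewrite [r`_ _]nth_default ?mulr0 //; apply: leq_trans sr _.
  by move: (nat_of_ord j) jlt => jj; lia.
by rewrite [p`_ _]nth_default ?mul0r //; apply: leq_trans sp _.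
Qed.

Lemma ptopD d p r a b : ptop d p a -> ptop d r b -> ptop d (p + r) (a + b).
Proof.
move=> [sp <-] [sr <-]; split; last by rewrite coefD.
by apply: leq_trans (size_polyD _ _) _; rewrite geq_max sp sr.
Qed.

Lemma ptop0 d : ptop d 0 0.
Proof. by split; rewrite ?size_poly0 ?coef0. Qed.

Lemma ptopC c : ptop 0 c%:P c.
Proof. by split; rewrite ?size_polyC ?coefC //; case: (c != 0). Qed.

Lemma ptop_sum (I : finType) (P : pred I) d (p : I -> {poly A}) (c : I -> A) :
  (forall i, P i -> ptop d (p i) (c i)) -> ptop d (\sum_(i | P i) p i) (\sum_(i | P i) c i).
Proof.
move=> H; apply: (big_ind2 (fun x y => ptop d x y)) => //; first exact: ptop0.
by move=> x1 x2 y1 y2; apply: ptopD.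
Qed.

Lemma ptop_prod (I : Type) (s : seq I) (d : I -> nat) (p : I -> {poly A}) (c : I -> A) :
  (forall i, ptop (d i) (p i) (c i)) ->
  ptop (\sum_(i <- s) d i)%N (\prod_(i <- s) p i) (\prod_(i <- s) c i).
Proof.
move=> H; elim: s => [|i s IH]; first by rewrite !big_nil; apply: ptopC.
by rewrite !big_cons; apply: ptopM.
Qed.

Lemma ptop_det n (P : 'M[{poly A}]_n) (d : 'I_n -> nat) (C : 'M[A]_n) :
  (forall i j, ptop (d i) (P i j) (C i j)) ->
  ptop (\sum_i d i)%N (\det P) (\det C).
Proof.
move=> H; rewrite /determinant; apply: ptop_sum => s _.
rewrite -[(\sum_i d i)%N]add0n; apply: ptopM; last by apply: ptop_prod.
by rewrite -(rmorph_sign (@polyC A)); apply: ptopC.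
Qed.

Definition mtop m n d (P : 'M[{poly A}]_(m, n)) (C : 'M[A]_(m, n)) :=
  forall i j, ptop d (P i j) (C i j).

Lemma mtopM m n o d e (P : 'M[{poly A}]_(m, n)) (C : 'M[A]_(m, n))
   (Q : 'M[{poly A}]_(n, o)) (D : 'M[A]_(n, o)) :
  mtop d P C -> mtop e Q D -> mtop (d + e) (P *m Q) (C *m D).
Proof. by move=> HP HQ i j; rewrite !mxE; apply: ptop_sum => k _; apply: ptopM. Qed.

Lemma mtopX n e (P : 'M[{poly A}]_n.+1) (C : 'M[A]_n.+1) :
  mtop 1 P C -> mtop e (P ^+ e) (C ^+ e).
Proof.
move=> H; elim: e => [|e IH].
  by rewrite !expr0 => i j; rewrite !mxE; case: (i == j); rewrite ?mulr1n ?mulr0n; [exact: (ptopC 1)|exact: ptop0].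
by rewrite !exprS -[e.+1]add1n; apply: mtopM.
Qed.

Definition line (X Z : 'M[A]_3) : 'M[{poly A}]_3 :=
  map_mx polyC X + 'X *: map_mx polyC Z.

Lemma mtop_line X Z : mtop 1 (line X Z) Z.
Proof.
move=> i j; rewrite !mxE addrC -[W in ptop _ _ W]addr0; apply: ptopD.
  split; last by rewrite coefXM /= coefC.
  apply: leq_trans (size_polyMleq _ _) _; rewrite size_polyX size_polyC.
  by case: (_ != 0).
split; last by rewrite coefC.
by rewrite size_polyC; case: (_ != 0).
Qed.

End TopDegree.

Section Pair.
Variable A : comNzRingType.
Local Notation M := 'M[A]_3.

(** Two generators indexed by [bool] and a single row indexed by [unit], so that the results on rows
    apply. *)
Definition pair (X Y : M) (b : bool) (_ : unit) : M := if b then X else Y.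

(** N is the nilpotent shift and E closes the cycle: the words N^(2-a) E N^b are the nine matrix
    units, each obtained once. *)
Definition NN : M := delta_mx 0 1 + delta_mx 1 2.
Definition EE : M := delta_mx 2 0.

Lemma mul_NN_EE (a : 'I_3) : NN ^+ (2 - a) *m EE = delta_mx a 0.
Proof.
have NE : NN *m EE = delta_mx 1 0.
  by rewrite /NN /EE mulmxDl (mul_delta_mx_0 _ _ _ (isT : (1 != 2 :> 'I_3))) mul_delta_mx add0r.
case: a => [[|[|[|]]] //] lt; rewrite /= ?subn0 ?subnn.
  rewrite (_ : Ordinal lt = 0); last exact: val_inj.
  by rewrite expr2 -mulmxE -mulmxA NE /NN mulmxDl mul_delta_mx (mul_delta_mx_0 _ _ _ (isT : (2 != 1 :> 'I_3))) addr0.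
rewrite (_ : Ordinal lt = 2) ?expr0; last exact: val_inj.
by rewrite [LHS]mul1mx.
Qed.

Lemma mul_delta_NN (a b : 'I_3) : delta_mx a 0 *m NN ^+ b = delta_mx a b.
Proof.
have D1 i : (delta_mx i 0 : M) *m NN = delta_mx i 1.
  by rewrite /NN mulmxDr mul_delta_mx (mul_delta_mx_0 _ _ _ (isT : (0 != 1 :> 'I_3))) addr0.
have D2 i : (delta_mx i 1 : M) *m NN = delta_mx i 2.
  by rewrite /NN mulmxDr mul_delta_mx (mul_delta_mx_0 _ _ _ (isT : (1 != 0 :> 'I_3))) add0r.
case: b => [[|[|[|]]] //] lt; rewrite /=.
  by rewrite expr0 [LHS]mulmx1; congr delta_mx; apply: val_inj.
by rewrite expr2 -mulmxE mulmxA D1 D2; congr delta_mx; apply: val_inj.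
Qed.

End Pair.

Section LineConductor.
Variable A : comNzRingType.
Variables (X Y : 'M[A]_3) (s : A).
Local Notation T := (unit * 'I_3 * 'I_3)%type.

Definition topdeg (t : T) : nat := (2 - t.1.2) + 1 + t.2.
Definition topsum : nat := \sum_(i < #|{: T}|) topdeg (enum_val i).

Definition hline := pair (line X (s *: NN A)) (line Y (s *: EE A)).
Definition lineword (t : T) (_ : unit) : 'M[{poly A}]_3 :=
  line X (s *: NN A) ^+ (2 - t.1.2) *m line Y (s *: EE A) *m line X (s *: NN A) ^+ t.2.
Definition linedet : {poly A} := \det (coord_mx lineword).

Lemma rowalg_lineword t : rowalg hline (lineword t).
Proof.
have hX : rowalg hline (fun _ : unit => line X (s *: NN A)) := rowalg_var hline true.
have hY : rowalg hline (fun _ : unit => line Y (s *: EE A)) := rowalg_var hline false.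
apply: (@rowalgM _ _ _ hline (fun _ => _ *m _)); last exact: rowalgX.
by apply: rowalgM => //; apply: rowalgX.
Qed.

Lemma cond_linedet : cond hline linedet.
Proof. by apply: cond_det; apply: rowalg_lineword. Qed.

(** At top degree in t the lines reduce to their directions s N and s E. The word of index (a, b)
    then becomes a power of s times a matrix unit, so the coordinate matrix becomes diagonal. *)
Lemma linedet_top : ptop topsum linedet (s ^+ topsum).
Proof.
have top t : mtop (topdeg t) (lineword t tt) (s ^+ topdeg t *: delta_mx t.1.2 t.2).
  have -> : s ^+ topdeg t *: delta_mx t.1.2 t.2
     = (s *: NN A) ^+ (2 - t.1.2) *m (s *: EE A) *m (s *: NN A) ^+ t.2.
    rewrite !exprZn -!scalemxAl -!scalemxAr -!scalemxAl mul_NN_EE mul_delta_NN !scalerA.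
    by rewrite /topdeg !exprD expr1 -!mulrA [s * _]mulrC.
  apply: mtopM; last by apply: mtopX; apply: mtop_line.
  by apply: mtopM; [apply: mtopX|]; apply: mtop_line.
have -> : s ^+ topsum = \det (diag_mx (\row_i s ^+ topdeg (enum_val i)) : 'M_#|{: T}|).
  rewrite det_diag /topsum; under eq_bigr do rewrite mxE.
  by rewrite expr_sum.
apply: ptop_det => i j; rewrite !mxE /coord.
have := top (enum_val i) (enum_val j).1.2 (enum_val j).2; rewrite !mxE.
case: (eqVneq i j) => [->|ij]; first by rewrite !eqxx mulr1 mulr1n; case: (enum_val j).1.1.
have -> : ((enum_val j).1.2 == (enum_val i).1.2) && ((enum_val j).2 == (enum_val i).2) = false.
  apply/negbTE; apply: contra ij => /andP [/eqP e1 /eqP e2]; apply/eqP/enum_val_inj.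
  by move: e1 e2; case: (enum_val i) => [[[] a] b]; case: (enum_val j) => [[[] c] d] /= -> ->.
by rewrite mulr0 mulr0n; case: (enum_val j).1.1.
Qed.

End LineConductor.

(** * A line that generates wherever 1020 is invertible *)

Section UnimodularLine.
Variable A : comNzRingType.
Variables (c r : A).
(* 1020 = 4 * 15 * 17 clears the denominators of the Bezout identities between the
   entries of [DY] in [unimodular_diag]. *)
Hypothesis c1020 : 1020%:R * c = 1.
Local Notation M := 'M[A]_3.

Definition mx3 (l : seq (seq A)) : M := \matrix_(i, j) nth 0 (nth [::] l i) j.

Definition DX : M := mx3 [:: [:: 0; 0; 0]; [:: 0; 1; 0]; [:: 0; 0; 2%:R]].
Local Notation t := (2%:R * r).
(* The pair (diag(0,1,2) + t N, E13 + E21 + E32 + t E31), with t = 2r, in a basis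
   of eigenvectors of the first matrix; t = 2r avoids denominators. *)
Definition yt : seq (seq A) :=
  [:: [:: 4%:R * r ^+ 3 - 2%:R * r; 8%:R * r ^+ 4 - 2%:R * r ^+ 2; 8%:R * r ^+ 5 + 1];
      [:: 1 - 4%:R * r ^+ 2; - (8%:R * r ^+ 3); - (8%:R * r ^+ 4 + 2%:R * r ^+ 2)];
      [:: 2%:R * r; 1 + 4%:R * r ^+ 2; 4%:R * r ^+ 3 + 2%:R * r]].
Definition DY : M := mx3 yt.

Let h := pair DX DY.
(** For fixed i and j the admissible p form an ideal of A, and these ideals multiply along paths i,
    j, k; the aim is to find 1 in each of them. *)
Let In (i j : 'I_3) (p : A) := rowalg h (fun _ => p *: delta_mx i j).

Let InD i j p p' : In i j p -> In i j p' -> In i j (p + p').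
Proof. by move=> Hp Hr; apply: rowalg_ext (rowalgD Hp Hr) => l; rewrite scalerDl. Qed.
Let InE i j p p' : p = p' -> In i j p -> In i j p'.
Proof. by move=> ->. Qed.
Let InZ i j p p' : In i j p' -> In i j (p * p').
Proof. by move=> Hr; apply: rowalg_ext (rowalgZ p Hr) => l; rewrite scalerA. Qed.
Let InM i j k p p' : In i j p -> In j k p' -> In i k (p * p').
Proof.
move=> Hp Hr; apply: rowalg_ext (rowalgM Hp Hr) => l.
by rewrite -scalerAl -scalerAr scalerA -mulmxE mul_delta_mx.
Qed.

Let hX : rowalg h (fun _ => DX) := rowalg_var h true.
Let hY : rowalg h (fun _ => DY) := rowalg_var h false.

Let In_ii i : In i i 1.
Proof.
have h2 : 2%:R * (510%:R * c) = 1 by rewrite -[RHS]c1020; ring.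
have h1 : rowalg h (fun _ => 1%:A) := rowalg_const h 1.
have hXX := rowalgM hX hX.
(* The diagonal idempotents are the Lagrange polynomials in [DX] for its eigenvalues 0, 1, 2; here
   [510 * c] is one half. *)
pose P (a b d : A) := rowalgD (rowalgD (rowalgZ a h1) (rowalgZ b hX)) (rowalgZ d hXX).
have dg (a b d : A) (l : unit) : a *: 1%:A + b *: DX + d *: (DX * DX)
   = mx3 [:: [:: a; 0; 0]; [:: 0; a + b + d; 0]; [:: 0; 0; a + b * 2%:R + d * 4%:R]].
  apply/matrixP => x y; rewrite !mxE !big_ord_recl big_ord0 !mxE.
  by case: x => [[|[|[|]]] //] ?; case: y => [[|[|[|]]] //] ? /=; ring.
have dE (x : 'I_3) : delta_mx x x = mx3 [:: [:: (x == 0)%:R; 0; 0]; [:: 0; (x == 1)%:R; 0]; [:: 0; 0; (x == 2)%:R]].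
  apply/matrixP => a b; rewrite !mxE.
  by case: x => [[|[|[|]]] //] ?; case: a => [[|[|[|]]] //] ?; case: b => [[|[|[|]]] //] ?.
elim/ord3_ind: i.
- apply: rowalg_ext (P 1 (- 3%:R * (510%:R * c)) (510%:R * c)) => l.
  rewrite dg // dE scale1r; congr mx3; congr [:: _; [:: _; _; _]; [:: _; _; _]] => /=.
    by transitivity (1 - 2%:R * (510%:R * c)); [ring | rewrite h2; ring].
  by transitivity (1 - 2%:R * (510%:R * c)); [ring | rewrite h2; ring].
- apply: rowalg_ext (P 0 2%:R (-1)) => l.
  rewrite dg // dE scale1r; congr mx3; congr [:: _; [:: _; _; _]; [:: _; _; _]] => /=; ring.
- apply: rowalg_ext (P 0 (- (510%:R * c)) (510%:R * c)) => l.
  rewrite dg // dE scale1r; congr mx3; congr [:: _; [:: _; _; _]; [:: _; _; _]] => /=; first ring.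
  by transitivity (2%:R * (510%:R * c)); [ring | rewrite h2].
Qed.

Let In_y i j : In i j (DY i j).
Proof.
have e1 := rowalgM (rowalgM (In_ii i) hY) (In_ii j).
apply: rowalg_ext e1 => l; rewrite !scale1r -!mulmxE; apply/matrixP => a b.
rewrite !mxE (bigD1 j) //= big1 ?addr0 => [|k kj]; last by rewrite [X in _ * X]mxE (negbTE kj) mulr0.
rewrite mxE (bigD1 i) //= big1 ?addr0 => [|k ki]; last by rewrite [X in X * _]mxE (negbTE ki) andbF mul0r.
rewrite ![delta_mx _ _ _ _]mxE !eqxx /= andbT.
have -> : nth 0 (nth [::] yt i) j = DY i j by rewrite [RHS]mxE.
by case: (a == i); case: (b == j); rewrite /= ?mulr1 ?mul1r ?mulr0 ?mul0r.
Qed.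

(** The idempotents isolate the entries of [DY]. In the positions 10, 21, 01 and 12 the entry and a
    product of two entries along a path are coprime once 1020 is inverted; the multipliers are
    Bezout cofactors. The positions 02 and 20 follow by composition. *)
Lemma unimodular_diag : rgen h.
Proof.
have y01 : In 0 1 (8%:R * r ^+ 4 - 2%:R * r ^+ 2) by have := In_y 0 1; rewrite mxE.
have y02 : In 0 2 (8%:R * r ^+ 5 + 1) by have := In_y 0 2; rewrite mxE.
have y10 : In 1 0 (1 - 4%:R * r ^+ 2) by have := In_y 1 0; rewrite mxE.
have y12 : In 1 2 (- (8%:R * r ^+ 4 + 2%:R * r ^+ 2)) by have := In_y 1 2; rewrite mxE.
have y20 : In 2 0 (2%:R * r) by have := In_y 2 0; rewrite mxE.
have y21 : In 2 1 (1 + 4%:R * r ^+ 2) by have := In_y 2 1; rewrite mxE.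
have u10 : In 1 0 1.
  apply: InE (InD (InZ (510%:R * c * (2%:R + 2%:R * t ^+ 2 + t ^+ 4)) y10)
    (InZ (- t * (1020%:R * c)) (InM y12 y20))).
  by rewrite -[RHS]c1020; ring.
have u21 : In 2 1 1.
  apply: InE (InD (InZ (510%:R * c * (2%:R - 2%:R * t ^+ 2 + t ^+ 4)) y21)
    (InZ (- t * (1020%:R * c)) (InM y20 y01))).
  by rewrite -[RHS]c1020; ring.
have u01 : In 0 1 1.
  apply: InE (InD (InZ (17%:R * c * 2%:R * (32%:R - 8%:R * t + 4%:R * t ^+ 2 - t ^+ 3 + 4%:R * t ^+ 4 + 7%:R * t ^+ 5 + 2%:R * t ^+ 6)) y01)
     (InZ (17%:R * c * 4%:R * (15%:R - 7%:R * t ^+ 2 - 2%:R * t ^+ 3)) (InM y02 y21))).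
  by rewrite -[RHS]c1020; ring.
have u12 : In 1 2 1.
  apply: InE (InD (InZ (- 15%:R * c * 2%:R * (32%:R - 8%:R * t + 4%:R * t ^+ 2 - t ^+ 3 - 4%:R * t ^+ 4 + 9%:R * t ^+ 5 + 2%:R * t ^+ 6)) y12)
     (InZ (15%:R * c * 4%:R * (17%:R + 9%:R * t ^+ 2 + 2%:R * t ^+ 3)) (InM y10 y02))).
  by rewrite -[RHS]c1020; ring.
have u02 : In 0 2 1 by apply: InE (InM u01 u12); rewrite mulr1.
have u20 : In 2 0 1 by apply: InE (InM u21 u10); rewrite mulr1.
apply: cond1_rgen => [[[[] i] j]].
have Iij : In i j 1.
  by elim/ord3_ind: i; elim/ord3_ind: j => //; apply: In_ii.
by apply: rowalg_ext Iij => [[]]; rewrite /rowdelta.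
Qed.

Lemma mul_mx3 (a b : seq (seq A)) (d : seq (seq A)) :
  (forall i j, (i < 3)%N -> (j < 3)%N ->
     nth 0 (nth [::] a i) 0 * nth 0 (nth [::] b 0) j
     + (nth 0 (nth [::] a i) 1 * nth 0 (nth [::] b 1) j
     + nth 0 (nth [::] a i) 2 * nth 0 (nth [::] b 2) j) = nth 0 (nth [::] d i) j) ->
  mx3 a *m mx3 b = mx3 d.
Proof.
move=> H; apply/matrixP => i j; rewrite mxE !big_ord_recl big_ord0 addr0 !mxE /=.
exact: H.
Qed.

Definition BB : M := mx3 [:: [:: 0; 0; 1]; [:: 1; 0; 0]; [:: 0; 1; 0]].

Lemma unimodular_line : rgen (pair (DX + t *: NN A) (BB + t *: EE A)).
Proof.
(* The columns of U are eigenvectors of [DX + t N] for 0, 1, 2, and V is its inverse; the corner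
   entry [2 r^2] is t^2/2. *)
pose U := mx3 [:: [:: 1; t; 2%:R * r ^+ 2]; [:: 0; 1; t]; [:: 0; 0; 1]].
pose V := mx3 [:: [:: 1; - t; 2%:R * r ^+ 2]; [:: 0; 1; - t]; [:: 0; 0; 1]].
have eX : DX + t *: NN A = mx3 [:: [:: 0; t; 0]; [:: 0; 1; t]; [:: 0; 0; 2%:R]].
  apply/matrixP => i j; rewrite !mxE.
  by case: i => [[|[|[|]]] //] ?; case: j => [[|[|[|]]] //] ? /=; ring.
have eY : BB + t *: EE A = mx3 [:: [:: 0; 0; 1]; [:: 1; 0; 0]; [:: t; 1; 0]].
  apply/matrixP => i j; rewrite !mxE.
  by case: i => [[|[|[|]]] //] ?; case: j => [[|[|[|]]] //] ? /=; ring.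
have UV : U *m V = 1%:M.
  have -> : 1%:M = mx3 [:: [:: 1; 0; 0]; [:: 0; 1; 0]; [:: 0; 0; 1]].
    apply/matrixP => i j; rewrite !mxE.
    by case: i => [[|[|[|]]] //] ?; case: j => [[|[|[|]]] //] ?.
  by apply: mul_mx3 => [[|[|[|]]] [|[|[|]]]] //= _ _; ring.
have UX : U *m DX = (DX + t *: NN A) *m U.
  rewrite eX [RHS](mul_mx3 (d := [:: [:: 0; t; 4%:R * r ^+ 2]; [:: 0; 1; 2%:R * t]; [:: 0; 0; 2%:R]])).
    by apply: mul_mx3 => [[|[|[|]]] [|[|[|]]]] //= _ _; ring.
  by move=> [|[|[|]]] [|[|[|]]] //= _ _; ring.
have UY : U *m DY = (BB + t *: EE A) *m U.
  rewrite eY [RHS](mul_mx3 (d := [:: [:: 0; 0; 1]; [:: 1; t; 2%:R * r ^+ 2]; [:: t; 1 + t ^+ 2; t + 4%:R * r ^+ 3]])).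
    by apply: mul_mx3 => [[|[|[|]]] [|[|[|]]]] //= _ _; ring.
  by move=> [|[|[|]]] [|[|[|]]] //= _ _; ring.
move=> x; have [s es] := unimodular_diag (fun l => V *m x l *m U).
exists s => l; case: l; set h' := pair _ _.
have hU : intertwines (fun b => h b tt) (fun b => h' b tt) U by case.
by rewrite -[LHS]mulmx1 -UV mulmxA -(intertwines_ev s hU) es !mulmxA UV mul1mx -mulmxA UV mulmx1.
Qed.

End UnimodularLine.

(** * Constants in the conductor *)

Lemma resultant_map (A B : nzRingType) (f : {rmorphism A -> B}) (p r : {poly A}) :
  f (lead_coef p) != 0 -> f (lead_coef r) != 0 ->
  f (resultant p r) = resultant (map_poly f p) (map_poly f r).
Proof.
move=> nzp nzr; rewrite /resultant /Sylvester_mx !size_map_poly_id0 //.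
rewrite -det_map_mx /= map_col_mx; congr (\det (col_mx _ _));
  by apply: map_lin1_mx => v; rewrite map_poly_rV rmorphM /= map_rVpoly.
Qed.

(** Lifts of the matrix units inside the generated algebra have a coordinate determinant that maps
    to 1, and by [cond_det] this determinant lies in the conductor. *)
Lemma lift_rgen (A B : comNzRingType) (phi : {rmorphism A -> B}) (I : Type) (L : finType)
    (h : I -> L -> 'M[A]_3) :
  surj phi -> rgen (fun i l => map_mx phi (h i l)) ->
  exists2 d, cond h d & phi d = 1.
Proof.
move=> sphi gh.
have /choice [b bP] : forall t, exists b : L -> 'M[A]_3,
    rowalg h b /\ forall l, map_mx phi (b l) = rowdelta B t l.
  move=> t; have [s' es'] := gh (rowdelta B t); have [s es] := nc_map_surj sphi s'.
  exists (fun l => ev (fun i => h i l) s); split; first by exists s.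
  by move=> l; rewrite map_ev es.
exists (\det (coord_mx b)); first by apply: cond_det => t; case: (bP t).
rewrite -det_map_mx -[RHS](@det1 B #|{: L * 'I_3 * 'I_3}|); congr (\det _).
apply/matrixP => i j; rewrite !mxE /coord.
have [_ /(_ (enum_val j).1.1) /matrixP /(_ (enum_val j).1.2 (enum_val j).2)] := bP (enum_val i).
rewrite mxE => ->; rewrite /rowdelta -(inj_eq enum_val_inj).
case: (enum_val i) => [[l a] c]; case: (enum_val j) => [[l' a'] c'] /=.
rewrite !xpair_eqE [l == l']eq_sym [a == a']eq_sym [c == c']eq_sym.
by case: (l' == l); rewrite !mxE.
Qed.

(** Over F the conductor element lifted from 1 is coprime to D, so a resultant with D is nonzero
    there; and a resultant lies in the ideal of its two arguments. *)
Lemma conductor_const (R : idomainType) (F : fieldType) (f : {rmorphism R -> F})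
    (I : Type) (L : finType) (h : I -> L -> 'M[{poly R}]_3) (D : {poly R}) (K : nat) (a : R) :
  surj f -> (0 < K)%N -> cond h D -> ptop K D a -> f a != 0 ->
  rgen (fun i l => map_mx (map_poly f) (h i l)) ->
  exists2 rho, f rho != 0 & cond h rho%:P.
Proof.
move=> sf K0 cD [sD ea] fa gh.
have sphi : surj (map_poly f).
  move=> p; have /choice [g gP] := sf.
  exists (\poly_(i < size p) g p`_i); apply/polyP => i; rewrite coef_map coef_poly.
  by case: ltnP => ip; [exact: gP | rewrite [RHS]nth_default //; exact: rmorph0].
have [d cd pd] := lift_rgen sphi gh.
have a0 : a != 0 by apply: contraNneq fa => ->; rewrite rmorph0.
have szD : size D = K.+1.
  apply/eqP; rewrite eqn_leq sD /= ltnNge; apply/negP => sK.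
  by move: a0; rewrite -ea nth_default ?eqxx.
have lD : lead_coef D = a by rewrite /lead_coef szD.
have D0 : D != 0 by rewrite -size_poly_eq0 szD.
(* Reduction may lower the degree of d, and then the resultant would not commute with f. Adding a
   high multiple of D gives D2 the leading coefficient a, which survives, and keeps D2 congruent to
   1 modulo D over F. *)
pose D2 := d + 'X^(size d) * D.
have cD2 : cond h D2 by apply: condD => //; apply: condM.
have szX : size ('X^(size d) * D) = (size d + K.+1)%N.
  by rewrite mulrC size_Mmonic ?monicXn // szD size_polyXn !addSn addnC addnS.
have sz2 : (size d < size ('X^(size d) * D)%R)%N by rewrite szX; lia.
have lD2 : lead_coef D2 = a by rewrite /D2 lead_coefDr // lead_coefM lead_coefXn mul1r.
have szD2 : size D2 = (size d + K.+1)%N by rewrite /D2 addrC size_polyDl.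
exists (resultant D D2).
  rewrite resultant_map ?lD ?lD2 // resultant_eq0 -leqNgt.
  set P := map_poly f D; set P2 := map_poly f D2.
  have e1 : P2 - map_poly f 'X^(size d) * P = 1.
    by rewrite /P2 /D2 rmorphD rmorphM /= pd addrK.
  have : gcdp P P2 %| 1.
    by rewrite -e1 dvdp_sub ?dvdp_gcdr // dvdp_mull ?dvdp_gcdl.
  by rewrite dvdp1 => /eqP ->.
have [||[u v] /= _ ->] := @resultant_in_ideal R D D2.
- by rewrite szD.
- by rewrite szD2; lia.
by apply: condD; apply: condM.
Qed.

(** * From residue fields to the ring *)

Section GlobalRing.
Variable R : idomainType.
Hypothesis char0 : forall n : nat, (0 < n)%N -> (n%:R : R) != 0.
Hypothesis dvd_nat : forall r : R, r != 0 ->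
  exists n : nat, (0 < n)%N /\ exists y, n%:R = r * y.
Hypothesis prime_nonunit : forall p : nat, prime p -> forall y : R, p%:R * y != 1.
Hypothesis fin_quo : forall n : nat, (0 < n)%N ->
  exists (N : nat) (L : 'I_N -> R), forall x, exists i y, x = L i + n%:R * y.
Local Notation M := 'M[R]_3.

(** A proper conductor would be killed by some residue map, yet [lift_rgen] finds in it an element
    mapped to 1. *)
Lemma local_global (I : Type) (L : finType) (g : I -> L -> M) :
  (forall (F : finFieldType) (f : {rmorphism R -> F}), surj f ->
     rgen (fun i l => map_mx f (g i l))) -> rgen g.
Proof.
move=> H; apply: cond1_rgen.
have [//|n1] := pselect (cond g 1).
have idJ : ideal (cond g).
  by split; [apply: cond0 | apply: condD | move=> *; apply: condM].
have [F [f [sf fJ]]] := ideal_residue dvd_nat prime_nonunit fin_quo idJ n1.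
have [d /fJ -> /eqP] := lift_rgen sf (H F f sf).
by rewrite eq_sym oner_eq0.
Qed.

(** Take a prime p above a positive multiple n of s; in a residue field of characteristic p the
    integer n, hence also s, is nonzero. *)
Lemma aux_residue (s : R) : s != 0 ->
  exists (F : finFieldType) (f : {rmorphism R -> F}) (p : nat),
    [/\ surj f, f s != 0, (0 < p)%N & f p%:R = 0].
Proof.
move=> s0; have [n [n0 [y ey]]] := dvd_nat s0.
have [p pn pp] := prime_above n.
pose J (x : R) := exists y, x = p%:R * y.
have idJ : ideal J.
  split; first by exists 0; rewrite mulr0.
    by move=> a b [a' ->] [b' ->]; exists (a' + b'); rewrite mulrDr.
  by move=> a b [b' ->]; exists (a * b'); rewrite mulrCA.
have J1 : ~ J 1 by move=> [z ez]; have := prime_nonunit pp z; rewrite -ez eqxx.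
have [F [f [sf fJ]]] := ideal_residue dvd_nat prime_nonunit fin_quo idJ J1.
have fp : f p%:R = 0 by apply: fJ; exists 1; rewrite mulr1.
exists F, f, p; split=> //; last exact: prime_gt0.
apply/eqP => fs; have fn : f n%:R = 0 by rewrite ey rmorphM fs mul0r.
have pF : p \in [pchar F] by rewrite inE pp -(rmorph_nat f) fp eqxx.
have: (p %| n)%N by rewrite (dvdn_pcharf pF) -(rmorph_nat f) fn.
by move=> /(dvdn_leq n0); rewrite leqNgt pn.
Qed.

Lemma avoid_values (b c : R) (l : seq R) : c != 0 -> exists n : nat, b + n%:R * c \notin l.
Proof.
move=> c0; apply: contrapT => H.
have inj : injective (fun n : nat => b + n%:R * c).
  move=> n n' /addrI /(mulIf c0) e; wlog le : n n' e / (n <= n')%N.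
    by move=> W; case/orP: (leq_total n n') => le; [|symmetry]; apply: W.
  have /eqP : (n' - n)%:R = 0 :> R by rewrite natrB // e subrr.
  have [/eqP|/char0/negbTE ->//] := posnP (n' - n).
  by rewrite subn_eq0 => le' _; apply/eqP; rewrite eqn_leq le.
pose r := [seq b + n%:R * c | n <- iota 0 (size l).+1].
have : (size r <= size l)%N.
  apply: uniq_leq_size; first by rewrite map_inj_uniq // iota_uniq.
  move=> x /mapP [n _ ->]; apply: contra_notT H => nl; by exists n.
by rewrite size_map size_iota ltnn.
Qed.

Lemma trNN : \tr (NN R) = 0.
Proof. by rewrite /mxtrace !big_ord_recl big_ord0 !mxE /= !addr0. Qed.

Lemma tr_delta00 : \tr (delta_mx 0 0 : M) = 1.
Proof. by rewrite /mxtrace !big_ord_recl big_ord0 !mxE /= !addr0. Qed.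

Lemma map_NN (A B : comNzRingType) (f : {rmorphism A -> B}) : map_mx f (NN A) = NN B.
Proof. by rewrite map_mxD !map_delta_mx. Qed.

Lemma map_EE (A B : comNzRingType) (f : {rmorphism A -> B}) : map_mx f (EE A) = EE B.
Proof. exact: map_delta_mx. Qed.

Lemma map_DX (A B : comNzRingType) (f : {rmorphism A -> B}) : map_mx f (DX A) = DX B.
Proof.
apply/matrixP => i j; rewrite !mxE.
by elim/ord3_ind: i; elim/ord3_ind: j; rewrite /= ?rmorph0 ?rmorph1 ?rmorph_nat.
Qed.

Lemma map_BB (A B : comNzRingType) (f : {rmorphism A -> B}) : map_mx f (BB A) = BB B.
Proof.
apply/matrixP => i j; rewrite !mxE.
by elim/ord3_ind: i; elim/ord3_ind: j; rewrite /= ?rmorph0 ?rmorph1.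
Qed.

Lemma map_line (A B : comNzRingType) (f : {rmorphism A -> B}) X Z :
  map_mx (map_poly f) (line X Z) = line (map_mx f X) (map_mx f Z).
Proof. by apply/matrixP => i j; rewrite !mxE rmorphD rmorphM /= map_polyX !map_polyC. Qed.

Lemma eval_line (A : comNzRingType) (t : A) X Z :
  map_mx (horner_eval t) (line X Z) = X + t *: Z.
Proof. by apply/matrixP => i j; rewrite !mxE /horner_eval !hornerE. Qed.

Lemma rgen_ext (A : comNzRingType) (I : Type) (L : finType) (h h' : I -> L -> 'M[A]_3) :
  (forall i l, h i l = h' i l) -> rgen h -> rgen h'.
Proof.
by move=> e gh x; have [s es] := gh x; exists s => l; rewrite -es; apply: eq_ev => i; rewrite e.
Qed.

(** An invariant of simultaneous conjugation that sees the parameter: since tr(N N E) = 1, its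
    coefficient of t^3 along the line is s^3. *)
Definition tau (A : comNzRingType) (X Y : 'M[A]_3) := \tr (X *m X *m Y).

Lemma ptop_tau (X Y : M) s :
  ptop 3 (tau (line X (s *: NN R)) (line Y (s *: EE R))) (s ^+ 3).
Proof.
have -> : s ^+ 3 = tau (s *: NN R) (s *: EE R).
  rewrite /tau -!scalemxAl -!scalemxAr -!scalemxAl !mxtraceZ.
  have -> : NN R *m NN R *m EE R = delta_mx 0 0 by rewrite -(mul_NN_EE R 0) /= expr2.
  by rewrite tr_delta00 mulr1 !exprS expr0 mulr1.
apply: ptop_sum => i _.
have t1 := mtop_line X (s *: NN R); have t2 := mtop_line Y (s *: EE R).
exact: (mtopM (mtopM t1 t1) t2).
Qed.

Lemma nonroot (F : finFieldType) (K : nat) (G : {poly F}) (a : F) :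
  ptop K G a -> a != 0 -> (K < #|F|)%N -> exists x, G.[x] != 0.
Proof.
move=> [sG ea] a0 KF; apply: contrapT => H.
have G0 : G != 0 by apply: contraNneq a0 => G0; rewrite -ea G0 coef0.
have : (size (enum F) < size G)%N.
  apply: max_poly_roots => //; last by rewrite enum_uniq.
  by apply/allP => x _; apply: contra_notT H => nx; exists x.
by rewrite -cardE => h; have := leq_trans h sG; rewrite ltnS leqNgt KF.
Qed.

Lemma ptop_map (A B : comNzRingType) (f : {rmorphism A -> B}) d p a :
  ptop d p a -> ptop d (map_poly f p) (f a).
Proof.
move=> [sp <-]; split; last by rewrite coef_map.
exact: leq_trans (size_poly _ _) sp.
Qed.

Lemma ptop_subC (A : comNzRingType) d (p : {poly A}) a b : ptop d.+1 p a -> ptop d.+1 (p - b%:P) a.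
Proof.
move=> pp; rewrite -[a]addr0; apply: ptopD => //.
by split; rewrite ?coefN ?coefC ?oppr0 // size_polyN size_polyC; case: (_ != 0).
Qed.

Definition inequiv (F : finFieldType) (f : {rmorphism R -> F}) (X Y X' Y' : M) :=
  (f (\tr X) != f (\tr X')) || (f (tau X Y) != f (tau X' Y')).

(* Along the line t |-> (X1 + s t N, Y1 + s t E31) the trace of the first matrix is
   constant, so [tau] has to separate the new row from the previous ones only over
   the finitely many residue fields where these traces agree. *)
Lemma extend_row (s : R) (X0 Y0 : M) (prev : seq (M * M)) (m : nat) :
  s != 0 -> (exists y, s = 1020%:R * y) -> (size prev <= m)%N ->
  (forall (F : finFieldType) (f : {rmorphism R -> F}), surj f -> f s != 0 ->
     (topsum + 3 * m < #|F|)%N) ->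
  exists X Y : M, [/\ exists Z : M, X = X0 + s *: Z, exists Z : M, Y = Y0 + s *: Z &
    forall (F : finFieldType) (f : {rmorphism R -> F}), surj f -> f s != 0 ->
      rgen (pair (map_mx f X) (map_mx f Y)) /\
      forall p, p \in prev -> inequiv f X Y p.1 p.2].
Proof.
move=> s0 [s1020 es] szp Hbig.
have [F' [f' [p' [sf' fs' p'0 fp']]]] := aux_residue s0.
have [y ey] : exists y, f' (s * y) = 1.
  have [y ey] := sf' (f' s)^-1; exists y; by rewrite rmorphM ey mulfV.
(* Modulo s nothing changes, while in the auxiliary field [s * y] is 1, so the pair becomes ([DX],
   [BB]). Multiples of [s * p'] vanish in both, which leaves z free to move the trace away from
   those of the previous rows. *)
pose Xb := X0 + (s * y) *: (DX R - X0).
have [z zP] := avoid_values (\tr Xb) [seq \tr p.1 | p <- prev] (mulf_neq0 s0 (char0 p'0)).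
pose X1 := Xb + (z%:R * (s * p'%:R)) *: delta_mx 0 0.
pose Y1 := Y0 + (s * y) *: (BB R - Y0).
have trX1 : \tr X1 = \tr Xb + z%:R * (s * p'%:R).
  rewrite /X1 mxtraceD mxtraceZ.
  by rewrite tr_delta00 mulr1.
have fX1 : map_mx f' X1 = DX F'.
  rewrite /X1 /Xb !map_mxD !map_mxZ map_mxB map_DX ey scale1r addrC addrA.
  by rewrite !rmorphM fp' !mulr0 scale0r add0r addrC subrK.
have fY1 : map_mx f' Y1 = BB F'.
  by rewrite /Y1 map_mxD map_mxZ map_mxB map_BB ey scale1r addrC subrK.
pose h := hline X1 Y1 s.
have f1020 : f' 1020%:R != 0.
  by apply: contraNneq fs' => e; rewrite es rmorphM e mul0r.
have gh : rgen (fun i l => map_mx (map_poly f') (h i l)).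
  pose c := ((f' 1020%:R)^-1)%:P : {poly F'}.
  (* Chosen so that [2 * r] is f'(s) 'X: the reduction of the line is then the one of
     [unimodular_line]. *)
  pose r := (510%:R * c) * ((f' s)%:P * 'X).
  have c1 : 1020%:R * c = 1.
    by rewrite -polyC_natr -polyCM -(rmorph_nat f') mulfV.
  apply: rgen_ext (unimodular_line r c1) => i l.
  have e2r : 2%:R * r = (f' s)%:P * 'X.
    have aux (A : comNzRingType) (a b : A) : 2%:R * (510%:R * a * b) = 1020%:R * a * b by ring.
    by rewrite /r aux c1 mul1r.
  rewrite e2r /h /hline /pair; case: i; rewrite map_line ?fX1 ?fY1 map_mxZ ?map_NN ?map_EE /line.
    by rewrite map_DX map_mxZ map_NN scalerA mulrC.
  by rewrite map_BB map_mxZ map_EE scalerA mulrC.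
have K0 : (0 < topsum)%N.
  rewrite /topsum (bigD1 (enum_rank (tt, 0 : 'I_3, 0 : 'I_3))) //= /topdeg enum_rankK /=.
  by rewrite addn_gt0.
have topD := linedet_top X1 Y1 s.
have fsK : f' (s ^+ topsum) != 0 by rewrite rmorphXn expf_neq0.
have [rho frho crho] := conductor_const sf' K0 (cond_linedet X1 Y1 s) topD fsK gh.
have rho0 : rho != 0 by apply: contraNneq frho => ->; rewrite rmorph0.
(* Where C is nonzero every value of t works: [rho] is invertible in the conductor and the traces
   differ. Only the residue fields killing C impose conditions on t. *)
pose C := rho * \prod_(p <- prev) (\tr X1 - \tr p.1).
have C0 : C != 0.
  rewrite mulf_neq0 // prodf_seq_neq0; apply/allP => p pin /=; rewrite subr_eq0.
  apply: contra zP => /eqP e; rewrite -trX1 e; apply/mapP; by exists p.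
pose D := linedet X1 Y1 s.
pose tp := tau (line X1 (s *: NN R)) (line Y1 (s *: EE R)).
pose Q (K : R -> Prop) (x : unit -> R) :=
  K s \/ (~ K D.[x tt] /\ forall p, p \in prev -> ~ K (tp.[x tt] - tau p.1 p.2)).
have [x xP] : exists x : unit -> R, forall (F : finFieldType) (f : {rmorphism R -> F}),
    surj f -> f C = 0 -> Q (fun z => f z = 0) x.
  apply: (crt dvd_nat fin_quo) => //.
    move=> F f x x' e [|[H1 H2]]; [by left | right; split].
      by rewrite -horner_map -e horner_map.
    by move=> p pin; rewrite rmorphB -horner_map -e horner_map -rmorphB; apply: H2.
  move=> F f sf fC; case: (eqVneq (f s) 0) => fs; first by exists (fun _ => 0); left.
  (* One value must avoid the roots of the determinant and of all differences of [tau]. The top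
     coefficient of G is a power of f s, and its formal degree is below |F|. *)
  pose G := map_poly f D * \prod_(p <- prev) (map_poly f tp - (f (tau p.1 p.2))%:P).
  have topG : ptop (topsum + 3 * size prev) G (f (s ^+ topsum) * f (s ^+ 3) ^+ size prev).
    apply: ptopM; first exact: ptop_map.
    have -> : (3 * size prev = \sum_(p <- prev) 3)%N by rewrite big_const_seq count_predT iter_addn_0.
    have -> : f (s ^+ 3) ^+ size prev = \prod_(p <- prev) f (s ^+ 3).
      by rewrite big_const_seq count_predT -Monoid.iteropE.
    apply: ptop_prod => p; apply: ptop_subC; apply: ptop_map; exact: ptop_tau.
  have [t Gt] : exists t, G.[t] != 0.
    apply: (nonroot topG); first by rewrite !rmorphXn mulf_neq0 // !expf_neq0.
    apply: leq_ltn_trans (Hbig F f sf fs); by rewrite leq_add2l leq_mul2l.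
  have [x ex] := sf t; exists (fun _ => x); right.
  move: Gt; rewrite /G hornerM mulf_eq0 negb_or horner_prod prodf_seq_neq0 => /andP [Dt /allP pt].
  split; first by apply/eqP; rewrite -horner_map ex.
  move=> p pin; have := pt p pin; rewrite /= hornerD hornerN hornerC => ne; apply/eqP.
  by rewrite rmorphB -horner_map ex.
set t := x tt in xP.
exists (X1 + t *: (s *: NN R)), (Y1 + t *: (s *: EE R)); split.
- exists (y *: (DX R - X0) + (z%:R * p'%:R) *: delta_mx 0 0 + t *: NN R).
  rewrite /X1 /Xb; move: (DX R - X0) => W; rewrite !scalerDr !scalerA -!addrA.
  congr (_ + (_ + (_ + _))).
    by congr (_ *: _); ring.
  by rewrite [t * s]mulrC.
- exists (y *: (BB R - Y0) + t *: EE R).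
  by rewrite /Y1; move: (BB R - Y0) => W; rewrite !scalerDr !scalerA -!addrA [t * s]mulrC.
move=> F f sf fs.
have evh a : cond h a -> f a.[t] != 0 ->
    rgen (pair (map_mx f (X1 + t *: (s *: NN R))) (map_mx f (Y1 + t *: (s *: EE R)))).
  move=> ca fa; have ca' := map_cond f (map_cond (horner_eval t) ca).
  apply: rgen_ext (cond_unit_rgen fa ca') => i l.
  by rewrite /h /hline /pair; case: i; rewrite eval_line.
have etau : tau (X1 + t *: (s *: NN R)) (Y1 + t *: (s *: EE R)) = tp.[t].
  rewrite -!eval_line /tau -!map_mxM -[RHS]/(horner_eval t tp) /tp /tau /mxtrace rmorph_sum.
  by apply: eq_bigr => i _; rewrite mxE.
have etr : \tr (X1 + t *: (s *: NN R)) = \tr X1.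
  by rewrite mxtraceD !mxtraceZ trNN !mulr0 addr0.
split.
  case: (eqVneq (f rho) 0) => fr; last by apply: (evh rho%:P) => //; rewrite hornerC.
  have fC : f C = 0 by rewrite rmorphM fr mul0r.
  have [fs0|[nD _]] := xP F f sf fC; first by rewrite fs0 eqxx in fs.
  by apply: (evh D); [exact: cond_linedet | apply/eqP].
move=> p pin; rewrite /inequiv etau etr; case: (eqVneq (f (\tr X1)) (f (\tr p.1))) => //= e.
have fC : f C = 0.
  rewrite rmorphM rmorph_prod; apply/eqP; rewrite mulf_eq0; apply/orP; right.
  rewrite prodf_seq_eq0; apply/hasP; exists p => //=; by rewrite rmorphB e subrr.
have [fs0|[_ /(_ p pin) nt]] := xP F f sf fC; first by rewrite fs0 eqxx in fs.
by apply/eqP => e2; apply: nt; rewrite rmorphB e2 subrr.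
Qed.

End GlobalRing.

Lemma map_rgen (A B : comNzRingType) (f : {rmorphism A -> B}) (I : Type) (L : finType)
    (g : I -> L -> 'M[A]_3) : surj f -> rgen g -> rgen (fun i l => map_mx f (g i l)).
Proof.
move=> sf gg x; have /choice [r rP] := sf.
have [s es] := gg (fun l => map_mx r (x l)); exists (nc_map f s) => l.
rewrite -(map_ev f (fun i => g i l)) es; apply/matrixP => i j; rewrite !mxE; exact: rP.
Qed.

(** Translation by 1 permutes F, so the sum of all elements does not change when |F| is added to
    it. *)
Lemma natr_card_eq0 (F : finFieldType) : #|F|%:R = 0 :> F.
Proof.
have e : \sum_(x : F) x = \sum_(x : F) (x + 1) by rewrite (reindex_inj (addIr 1)).
rewrite big_split /= sumr_const in e.
by apply: (addrI (\sum_(x : F) x)); rewrite addr0 -e.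
Qed.

Lemma intertwines_tr (F : finFieldType) (I : Type) (h h' : I -> 'M[F]_3) g i j :
  g \in unitmx -> intertwines h h' g ->
  \tr (h i) = \tr (h' i) /\ tau (h i) (h j) = tau (h' i) (h' j).
Proof.
move=> gu gi; have e k : h' k = g *m h k *m invmx g by rewrite gi mulmxK.
split; first by rewrite e mxtrace_mulC mulKmx.
by rewrite /tau !e !mulmxA !mulmxKV // [RHS]mxtrace_mulC !mulmxA mulVmx // mul1mx.
Qed.

Section Global.
Variable R : idomainType.
Hypothesis char0 : forall n : nat, (0 < n)%N -> (n%:R : R) != 0.
Hypothesis dvd_nat : forall r : R, r != 0 ->
  exists n : nat, (0 < n)%N /\ exists y, n%:R = r * y.
Hypothesis prime_nonunit : forall p : nat, prime p -> forall y : R, p%:R * y != 1.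
Hypothesis fin_quo : forall n : nat, (0 < n)%N ->
  exists (N : nat) (L : 'I_N -> R), forall x, exists i y, x = L i + n%:R * y.
Local Notation M := 'M[R]_3.

(** Expresses generation over F through the kernel of f alone, the form of condition that [crt]
    accepts. *)
Lemma rgen_mod (F : finFieldType) (f : {rmorphism R -> F}) (I : Type) (L : finType)
    (g : I -> L -> M) : surj f ->
  rgen (fun i l => map_mx f (g i l)) <->
  forall y : L -> M, exists w, forall l a b, f ((ev (fun i => g i l) w - y l) a b) = 0.
Proof.
move=> sf; split=> [gg y|H x].
  have [w' ew'] := gg (fun l => map_mx f (y l)); have [w ew] := nc_map_surj sf w'.
  exists w => l a b; have := ew' l; rewrite -ew -(map_ev f (fun i => g i l)).
  by move=> /matrixP /(_ a b); rewrite !mxE rmorphB => ->; rewrite subrr.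
have /choice [r rP] := sf.
have [w Hw] := H (fun l => map_mx r (x l)); exists (nc_map f w) => l.
rewrite -(map_ev f (fun i => g i l)); apply/matrixP => a b; have := Hw l a b.
rewrite !mxE rmorphB => /eqP; rewrite subr_eq0 => /eqP ->; exact: rP.
Qed.

Lemma local_solutions (k m : nat) (s : R) : s != 0 ->
  (forall (F : finFieldType) (f : {rmorphism R -> F}), surj f ->
     exists h : 'I_k -> 'I_m -> 'M[F]_3, rgen h) ->
  exists g : 'I_k -> 'I_m -> M, forall (F : finFieldType) (f : {rmorphism R -> F}),
    surj f -> f s = 0 -> rgen (fun i l => map_mx f (g i l)).
Proof.
move=> s0 loc.
pose G (x : 'I_k * 'I_m * 'I_3 * 'I_3 -> R) i l : M := \matrix_(a, b) x (i, l, a, b).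
pose Q (K : R -> Prop) x := forall y : 'I_m -> M, exists w, forall l a b,
   K ((ev (fun i => G x i l) w - y l) a b).
have [x xP] : exists x, forall (F : finFieldType) (f : {rmorphism R -> F}),
    surj f -> f s = 0 -> Q (fun z => f z = 0) x.
  apply: (crt dvd_nat fin_quo) => //.
    move=> F f x x' e Qx y; have [w Hw] := Qx y; exists w => l a b.
    rewrite -(Hw l a b) !mxE !rmorphB; congr (_ - _).
    have ee : map_mx f (ev (fun i => G x' i l) w) = map_mx f (ev (fun i => G x i l) w).
      rewrite !map_ev; apply: eq_ev => i; apply/matrixP => c d; rewrite !mxE; by rewrite e.
    by move/matrixP/(_ a b): ee; rewrite !mxE.
  move=> F f sf _; have [h gh] := loc F f sf; have /choice [r rP] := sf.
  exists (fun t => r (h t.1.1.1 t.1.1.2 t.1.2 t.2)).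
  apply/(rgen_mod _ sf); apply: rgen_ext gh => i l; apply/matrixP => a b.
  by rewrite !mxE; symmetry; apply: rP.
exists (G x) => F f sf fs; apply/(rgen_mod _ sf); exact: xP.
Qed.

Lemma global_rgen (k m : nat) : (2 <= k)%N ->
  (forall (F : finFieldType) (f : {rmorphism R -> F}), surj f ->
     exists h : 'I_k -> 'I_m -> 'M[F]_3, rgen h) ->
  exists g : 'I_k -> 'I_m -> M, rgen g.
Proof.
case: k => [|[|k]] // _ loc; set i0 : 'I_k.+2 := ord0; set i1 : 'I_k.+2 := lift ord0 ord0.
(* If |F| <= B, then |F| divides B! and s vanishes in F; so s is nonzero only in fields large enough
   for [extend_row]. The summand 1020 makes s a multiple of 1020. *)
pose B := (topsum + 3 * m + 1020)%N.
pose s : R := (B`!)%:R.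
have s0 : s != 0 by apply: char0; apply: fact_gt0.
have s1020 : exists y, s = 1020%:R * y.
  have : (1020 %| B`!)%N by apply: dvdn_fact; rewrite leq_addl.
  by case/dvdnP => z ez; exists z%:R; rewrite /s ez natrM mulrC.
have Hbig (F : finFieldType) (f : {rmorphism R -> F}) : surj f -> f s != 0 ->
    (topsum + 3 * m < #|F|)%N.
  move=> _; rewrite ltnNge; apply: contra => le.
  have /dvdnP [z ez] : (#|F| %| B`!)%N.
    apply: dvdn_fact; rewrite (ltn_trans _ (q_gt1 F)) //=.
    by apply: leq_trans le _; rewrite leq_addr.
  by rewrite /s ez natrM rmorphM !rmorph_nat natr_card_eq0 mulr0.
have [g0 g0P] := local_solutions s0 loc.
have [rows [rcong rloc rne]] : exists rows : nat -> M * M,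
    [/\ forall l : 'I_m, (exists Z, (rows l).1 = g0 i0 l + s *: Z) /\
                         (exists Z, (rows l).2 = g0 i1 l + s *: Z),
      forall l : nat, (l < m)%N -> forall (F : finFieldType) (f : {rmorphism R -> F}), surj f -> f s != 0 ->
        rgen (pair (map_mx f (rows l).1) (map_mx f (rows l).2)) &
      forall l l' : nat, (l' < l)%N -> (l < m)%N -> forall (F : finFieldType) (f : {rmorphism R -> F}),
        surj f -> f s != 0 -> inequiv f (rows l).1 (rows l).2 (rows l').1 (rows l').2].
  suff H j : (j <= m)%N -> exists rows : nat -> M * M,
    [/\ forall l : 'I_m, (l < j)%N -> (exists Z, (rows l).1 = g0 i0 l + s *: Z) /\
                         (exists Z, (rows l).2 = g0 i1 l + s *: Z),
      forall l : nat, (l < j)%N -> forall (F : finFieldType) (f : {rmorphism R -> F}), surj f -> f s != 0 ->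
        rgen (pair (map_mx f (rows l).1) (map_mx f (rows l).2)) &
      forall l l' : nat, (l' < l)%N -> (l < j)%N -> forall (F : finFieldType) (f : {rmorphism R -> F}),
        surj f -> f s != 0 -> inequiv f (rows l).1 (rows l).2 (rows l').1 (rows l').2].
    have [rows [H1 H2 H3]] := H m (leqnn m); exists rows; split=> // l; exact: H1.
  elim: j => [|j IH] jm; first by exists (fun _ => (0, 0)).
  have [rows [H1 H2 H3]] := IH (ltnW jm).
  pose prev := [seq rows l | l <- iota 0 j].
  pose lj : 'I_m := Ordinal jm.
  have [|X [Y [[ZX eX] [ZY eY] HXY]]] := extend_row char0 dvd_nat prime_nonunit fin_quo
     (g0 i0 lj) (g0 i1 lj) (prev := prev) (m := m) s0 s1020 _ Hbig.
    by rewrite /prev size_map size_iota ltnW.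
  exists (fun l => if l == j then (X, Y) else rows l); split.
  - move=> l; rewrite ltnS leq_eqVlt => /orP [/eqP e|lt].
      have -> : l = lj by apply: val_inj.
      by rewrite /= eqxx /=; split; [exists ZX | exists ZY].
    by rewrite (ltn_eqF lt); apply: H1.
  - move=> l; rewrite ltnS leq_eqVlt => /orP [/eqP ->|lt] F f sf fs.
      by rewrite eqxx /=; have [] := HXY F f sf fs.
    by rewrite (ltn_eqF lt); apply: H2.
  move=> l l' ll'; rewrite ltnS leq_eqVlt => /orP [/eqP e|lt] F f sf fs.
    rewrite e in ll' *; rewrite eqxx (ltn_eqF ll') /=.
    have [_ Hp] := HXY F f sf fs; apply: Hp; apply/mapP; exists l' => //.
    by rewrite mem_iota.
  by rewrite (ltn_eqF lt) (ltn_eqF (ltn_trans ll' lt)); apply: H3.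
(* The first two generators change by multiples of s, so where s vanishes g still reduces to the
   local solution. Elsewhere these two alone generate in each row, and their invariants separate the
   rows. *)
pose g (i : 'I_k.+2) (l : 'I_m) : M :=
  if i == i0 then (rows l).1 else if i == i1 then (rows l).2 else g0 i l.
exists g; apply: (local_global dvd_nat prime_nonunit fin_quo) => F f sf.
case: (eqVneq (f s) 0) => fs.
  apply: rgen_ext (g0P F f sf fs) => i l; rewrite /g.
  have [[ZX eX] [ZY eY]] := rcong l.
  case: (eqVneq i i0) => [->|_]; first by rewrite eX map_mxD map_mxZ fs scale0r addr0.
  by case: (eqVneq i i1) => [->|_] //; rewrite eY map_mxD map_mxZ fs scale0r addr0.
have gi0 l : g i0 l = (rows l).1 by rewrite /g eqxx.
have gi1 l : g i1 l = (rows l).2 by [].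
have sg l : sgen (fun i => map_mx f (g i l)).
  move=> x; have := rloc l (ltn_ord l) F f sf fs (fun _ => x).
  pose e (b : bool) := if b then i0 else i1.
  move=> gl; have [|w ew] := @rowalg_sub F 'I_k.+2 bool unit e (fun i _ => map_mx f (g i l)) (fun _ => x).
    by have [w ew] := gl; exists w => u; rewrite -(ew u); apply: eq_ev => [[]]; rewrite /e /pair ?gi0 ?gi1.
  by exists w; rewrite -(ew tt).
have ne (l l' : 'I_m) : l != l' -> inequiv f (rows l).1 (rows l).2 (rows l').1 (rows l').2.
  rewrite neq_ltn => /orP [lt|lt]; last first.
    exact: (rne _ _ lt (ltn_ord l) F f sf fs).
  have := rne _ _ lt (ltn_ord _) F f sf fs.
  by rewrite /inequiv eq_sym [f (tau _ _) == _]eq_sym.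
apply: goursat => // l l' ll; apply: separate_rows => // h hu hi.
have := ne l l' ll; rewrite /inequiv -!gi0 -!gi1.
have [e1 e2] := intertwines_tr i0 i1 hu hi.
have ftr X : f (\tr X) = \tr (map_mx f X) by rewrite trace_map_mx.
have ftau X Y : f (tau X Y) = tau (map_mx f X) (map_mx f Y) by rewrite /tau ftr !map_mxM.
by rewrite !ftau e2 !ftr e1 !eqxx.
Qed.

Theorem global_fk (F0 : finFieldType) (f0 : {rmorphism R -> F0}) (k m : nat) :
  surj f0 ->
  (forall (F : finFieldType) (f : {rmorphism R -> F}), surj f -> (#|F0| <= #|F|)%N) ->
  (2 <= k)%N ->
  (exists g : 'I_k -> 'I_m -> M, rgen g) <-> m%:R <= fk k #|F0|%:R.
Proof.
move=> sf0 minF k2; split=> [[g gg]|mle].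
  by apply/(rgen_fk F0 m k2); exists (fun i l => map_mx f0 (g i l)); apply: map_rgen.
apply: global_rgen => // F f sf; apply/(rgen_fk F m k2).
apply: le_trans mle _; apply: fk_mono => //; first by rewrite ler_nat q_gt1.
by rewrite ler_nat; apply: minF sf.
Qed.

Lemma global_small (F0 : finFieldType) (f0 : {rmorphism R -> F0}) (k m : nat) :
  surj f0 -> (k <= 1)%N -> (0 < m)%N -> ~ exists g : 'I_k -> 'I_m -> M, rgen g.
Proof.
move=> sf0 k1 m0 [g gg]; have := rgen_sgen (map_rgen sf0 gg) (Ordinal m0).
exact: no_sgen.
Qed.

End Global.

(** * Rings of integers *)

Lemma natr_abszP (A : pzRingType) (c : int) :
  (`|c|%N%:R = c%:~R :> A) \/ (`|c|%N%:R = - c%:~R :> A).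
Proof. by case: c => n; [left | right; rewrite NegzE mulrNz opprK]. Qed.

Section RingOfIntegers.
Variable K : fieldExtType rat.

Definition int_pred : {pred K} := fun x => `[< ringOfIntegers x >].

Lemma int_predP x : x \in int_pred <-> integralOver (intr : int -> K) x.
Proof.
split=> [/asboolP [p [pm pr]]|[p pm pr]]; first by exists p.
by apply/asboolP; exists p.
Qed.

Fact int_subring : subring_closed int_pred.
Proof.
split; first exact/int_predP/integral1.
  by move=> x y /int_predP ix /int_predP iy; apply/int_predP; apply: integral_sub.
by move=> x y /int_predP ix /int_predP iy; apply/int_predP; apply: integral_mul.
Qed.
HB.instance Definition _ := GRing.isSubringClosed.Build K int_pred int_subring.

Definition OK := {x : K | x \in int_pred}.
HB.instance Definition _ := SubChoice.on OK.
HB.instance Definition _ := [SubChoice_isSubComNzRing of OK by <:].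

Definition OK_unit : {pred OK} := fun x => `[< exists y, y * x = 1 >].
Definition OK_inv (x : OK) : OK :=
  if pselect (exists y, y * x = 1) is left e then projT1 (cid e) else x.
Fact OK_mulV : {in OK_unit, left_inverse 1 OK_inv *%R}.
Proof.
move=> x /asboolP e; rewrite /OK_inv; case: pselect => // e'; by case: cid.
Qed.
Fact OK_unitP (x y : OK) : y * x = 1 -> x \in OK_unit.
Proof. by move=> e; apply/asboolP; exists y. Qed.
Fact OK_inv_out : {in [predC OK_unit], OK_inv =1 id}.
Proof.
move=> x; rewrite inE => /asboolPn e; rewrite /OK_inv; by case: pselect.
Qed.
HB.instance Definition _ := GRing.ComNzRing_hasMulInverse.Build OK OK_mulV OK_unitP OK_inv_out.

Fact OK_integral (x y : OK) : x * y = 0 -> (x == 0) || (y == 0).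
Proof.
move=> /(congr1 val); rewrite rmorphM rmorph0 => /eqP; rewrite mulf_eq0.
by rewrite -!(rmorph0 (val : OK -> K)) !(inj_eq val_inj).
Qed.
HB.instance Definition _ := GRing.ComUnitRing_isIntegral.Build OK OK_integral.

Lemma natK_neq0 (n : nat) : (0 < n)%N -> (n%:R : K) != 0.
Proof.
by move=> n0; rewrite -[n%:R]scaler_nat scaler_eq0 oner_eq0 orbF pnatr_eq0 -lt0n.
Qed.

Lemma OK_char0 (n : nat) : (0 < n)%N -> (n%:R : OK) != 0.
Proof.
move=> n0; apply: contraNneq (natK_neq0 n0) => e.
by rewrite -(rmorph_nat (val : OK -> K)) e rmorph0.
Qed.

Lemma OK_intr_eq0 (c : int) : (c%:~R == 0 :> OK) = (c == 0).
Proof.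
apply/eqP/eqP => [|->]; last by rewrite mulr0z.
move=> e; apply/eqP; rewrite -absz_eq0; apply: contraT; rewrite -lt0n => /OK_char0.
by case: (natr_abszP OK c) => ->; rewrite e ?oppr0 eqxx.
Qed.

Lemma OK_root (x : OK) : exists p : {poly int}, p \is monic /\ (map_poly intr p).[x] = 0 :> OK.
Proof.
have /int_predP [p pm] := valP x; exists p; split=> //.
apply: val_inj; rewrite -[RHS](rmorph0 (val : OK -> K)).
have -> : val (map_poly intr p).[x] = (map_poly (val : OK -> K) (map_poly intr p)).[val x].
  by rewrite horner_map.
rewrite -map_poly_comp rmorph0.
rewrite (eq_map_poly (g := intr)); first exact/eqP.
by move=> z; exact: (rmorph_int (val : OK -> K)).
Qed.

(** In an integral equation for r with nonzero constant term c, r divides c; a zero constant term is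
    removed by cancelling r. *)
Lemma OK_dvd_nat (r : OK) : r != 0 -> exists n : nat, (0 < n)%N /\ exists y, n%:R = r * y.
Proof.
move=> r0; have [p [/monic_neq0 p0 pr]] := OK_root r.
elim/poly_ind: p p0 pr => [|p c IH]; first by rewrite eqxx.
move=> p0; rewrite rmorphD rmorphM /= map_polyX map_polyC hornerMXaddC -[X in _ + X]/(c%:~R) => e.
case: (eqVneq c 0) => c0.
  move: e; rewrite c0 mulr0z addr0 => /eqP; rewrite mulf_eq0 (negbTE r0) orbF => /eqP; apply: IH.
  by apply: contraNneq p0 => ->; rewrite c0 mul0r add0r polyC0.
exists `|c|%N; split; first by rewrite absz_gt0.
have ec : c%:~R = r * - (map_poly intr p).[r] :> OK.
  by apply/eqP; rewrite mulrN -addr_eq0 addrC mulrC e.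
case: (natr_abszP OK c) => ->; rewrite ec; first by eexists.
by rewrite -mulrN; eexists.
Qed.

(** Multiplying a monic equation of degree n for y = 1/p by p^n leaves an equality 1 + p z = 0
    between integers. *)
Lemma OK_prime_nonunit p : prime p -> forall y : OK, p%:R * y != 1.
Proof.
move=> pp y; apply/eqP => py.
have H n : forall f : {poly int}, (size f <= n.+1)%N ->
   exists z : int, p%:R ^+ n * (map_poly intr f).[y] = (f`_n + p%:Z * z)%:~R :> OK.
  elim: n => [|n IH] f sf.
    exists 0; rewrite expr0 mul1r mulr0 addr0.
    by rewrite [in LHS](size1_polyC sf) map_polyC hornerC.
  elim/poly_ind: f sf => [|f c _] sf.
    by exists 0; rewrite rmorph0 horner0 !mulr0 coef0 addr0.
  have sf' : (size f <= n.+1)%N.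
    case: (eqVneq f 0) => [->|f0]; first by rewrite size_poly0.
    by move: sf; rewrite size_MXaddC (negbTE f0).
  have [z ez] := IH f sf'; exists (z + p%:Z ^+ n * c).
  rewrite coefD coefMX coefC /= addr0 rmorphD rmorphM /= map_polyX map_polyC hornerMXaddC.
  transitivity (p%:R ^+ n * (map_poly intr f).[y] * (p%:R * y) + p%:R ^+ n.+1 * c%:~R : OK).
    by rewrite exprS; ring.
  rewrite py mulr1 ez mulrDr !rmorphD !rmorphM /= rmorphXn /= exprS; ring.
have [f [fm fy]] := OK_root y.
have [z] := H (size f).-1 f (leqSpred _).
rewrite fy mulr0 => /esym/eqP; rewrite OK_intr_eq0.
have -> : f`_(size f).-1 = 1 by exact/eqP.
move=> /eqP e; have := prime_gt1 pp.
have : (p %| 1)%Z by apply/dvdzP; exists (- z); rewrite mulNr; lia.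
by rewrite dvdz1 /= => /eqP ->.
Qed.

(** * Finite quotients without an integral basis *)

Section FiniteQuotient.
Variable p : nat.
Hypothesis pp : prime p.

Definition indep_mod j (xs : 'I_j -> OK) := forall c : 'I_j -> int,
  (exists y, \sum_i (c i)%:~R * xs i = p%:R * y) -> forall i, (p %| c i)%Z.

(** Descent: the coefficients of an integral relation are divisible by p, and dividing them by p
    gives another relation. So they are divisible by all powers of p and vanish, and the family is
    free over the rationals. *)
Lemma indep_mod_bound j (xs : 'I_j -> OK) : indep_mod xs -> (j <= \dim {:K})%N.
Proof.
move=> ind; have p0 : (p%:R : OK) != 0 by apply: OK_char0; apply: prime_gt0.
have desc e : forall c : 'I_j -> int, \sum_i (c i)%:~R * xs i = 0 -> forall i, (p%:Z ^+ e %| c i)%Z.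
  elim: e => [|e IH] c ce i; first by rewrite expr0 dvd1z.
  have dc : forall i, exists z, c i = z * p%:Z.
    by move=> l; apply/dvdzP; apply: ind; exists 0; rewrite ce mulr0.
  have /choice [c' ec'] := dc.
  have : \sum_i (c' i)%:~R * xs i = 0.
    apply: (mulfI p0); rewrite mulr0 mulr_sumr -[RHS]ce; apply: eq_bigr => l _.
    by rewrite ec' rmorphM /= -[(p%:Z)%:~R]/(p%:R) mulrCA mulrA.
  move=> /IH /(_ i) d; rewrite ec' exprSr; exact: dvdz_mul.
pose X := [tuple val (xs i) | i < j].
have fX : free X.
  apply/freeP => k ek i.
  pose c i : int := numq (k i) * \prod_(l | l != i) denq (k l).
  pose D : int := \prod_l denq (k l).
  have cE l : (c l)%:~R = k l * D%:~R :> rat.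
    by rewrite /c /D rmorphM /= numqE [in RHS](bigD1 l) //= rmorphM /= mulrA.
  have : \sum_i (c i)%:~R * xs i = 0.
    apply: val_inj; rewrite (rmorph_sum (val : OK -> K)) (rmorph0 (val : OK -> K)).
    transitivity (D%:~R *: \sum_(i < j) k i *: X`_i).
      rewrite scaler_sumr; apply: eq_bigr => l _.
      rewrite (rmorphM (val : OK -> K)) (rmorph_int (val : OK -> K)) scalerA mulrC.
      by rewrite [D%:~R * _]mulrC -cE -tnth_nth tnth_mktuple scaler_int mulrzr.
    by rewrite ek scaler0.
  move=> /desc dv; have c0 : c i = 0.
    apply/eqP; rewrite -absz_eq0; apply: contraT; rewrite -lt0n => cp.
    have := dv `|c i|%N i; rewrite dvdzE abszX /= => /(dvdn_leq cp).
    by rewrite leqNgt ltn_expl ?prime_gt1.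
  have D0 : D%:~R != 0 :> rat.
    by rewrite intr_eq0 prodf_seq_neq0; apply/allP => l _ /=; apply: denq_neq0.
  by apply: (mulIf D0); rewrite mul0r -cE c0.
have := fX; rewrite /free size_tuple => /eqP <-; apply: dimvS; exact: subvf.
Qed.

(** A family independent modulo p and of maximal length spans modulo p, so its combinations with
    coefficients below p are representatives. *)
Lemma OK_fin_prime : exists (N : nat) (L : 'I_N -> OK), forall x, exists i y, x = L i + p%:R * y.
Proof.
pose P j := `[< exists xs : 'I_j -> OK, indep_mod xs >].
have P0 : exists j, P j.
  by exists 0%N; apply/asboolP; exists (fun _ => 0) => c _ [].
have Pb j : P j -> (j <= \dim {:K})%N by move=> /asboolP [xs /indep_mod_bound].
case: (ex_maxnP P0 Pb) => j /asboolP [xs ind] jmax.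
(* [p.-1.+1] equals p but is visibly a successor, as [inord] requires. *)
pose T := {ffun 'I_j -> 'I_p.-1.+1}.
exists #|{: T}|, (fun t => \sum_i ((enum_val t : T) i : nat)%:R * xs i) => x.
pose xs' (i : 'I_j.+1) := if unlift ord0 i is Some l then xs l else x.
have nind : ~ indep_mod xs'.
  by move=> ind'; have := jmax j.+1; rewrite ltnn => H; suff: false by []; apply: H; apply/asboolP; exists xs'.
have [c [[y ey] [i0 ni0]]] : exists c : 'I_j.+1 -> int,
    (exists y, \sum_i (c i)%:~R * xs' i = p%:R * y) /\ exists i, ~~ (p %| c i)%Z.
  apply: contra_notP nind => H c hc i; apply: contra_notT H => ni.
  by exists c; split=> //; exists i.
have sumE : \sum_i (c i)%:~R * xs' i = (c ord0)%:~R * x + \sum_i (c (lift ord0 i))%:~R * xs i.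
  rewrite big_ord_recl /xs' unlift_none; congr (_ + _).
  by apply: eq_bigr => i _; rewrite liftK.
have nc0 : ~~ (p %| c ord0)%Z.
  apply/negP => /dvdzP [z ez]; move/negP: ni0; apply.
  have H i : (p %| c (lift ord0 i))%Z.
    apply: (ind (fun i => c (lift ord0 i))); exists (y - z%:~R * x); rewrite mulrBr -ey sumE ez rmorphM /=.
    by rewrite -[(p%:Z)%:~R]/(p%:R); ring.
  case: (unliftP ord0 i0) => [l|] ->; first exact: H.
  by apply/dvdzP; exists z.
(* Inverting the coefficient of x modulo p solves the relation for x; the resulting coefficients
   [b i] are then replaced by their remainders. *)
have [u [v euv]] : exists u v : int, u * c ord0 = 1 + p%:Z * v.
  have cop : coprimez p%:Z (c ord0) by rewrite coprimezE prime_coprime // -dvdzE.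
  have [a [b e]] := Bezoutz p%:Z (c ord0).
  move/eqP: cop => cop; rewrite cop in e; exists b, (- a); rewrite -e; lia.
pose b i : int := - u * c (lift ord0 i).
have p0 : p%:Z != 0 by rewrite -lt0n prime_gt0.
pose t : T := [ffun i => inord `|(b i %% p%:Z)%Z|%N].
exists (enum_rank t), (u%:~R * y - v%:~R * x + \sum_i (b i %/ p%:Z)%Z%:~R * xs i).
rewrite enum_rankK.
have bE i : (b i)%:~R = (t i : nat)%:R + p%:R * (b i %/ p%:Z)%Z%:~R :> OK.
  rewrite {1}(divz_eq (b i) p%:Z) ffunE inordK; last first.
    have pz : 0 < p%:Z by rewrite ltz_nat prime_gt0.
    rewrite prednK ?prime_gt0 //; have := ltz_pmod (b i) pz.
    by have := modz_ge0 (b i) p0; case: (b i %% p%:Z)%Z => // n _; rewrite ltz_nat.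
  have -> : (`|(b i %% p%:Z)%Z|%N%:R : OK) = (b i %% p%:Z)%Z%:~R.
    by have := modz_ge0 (b i) p0; case: (b i %% p%:Z)%Z.
  by rewrite rmorphD rmorphM /= addrC mulrC.
rewrite mulrDr mulr_sumr addrCA -big_split /=.
under eq_bigr => i _ do rewrite mulrA -mulrDl -bE.
have -> : \sum_i (b i)%:~R * xs i = - u%:~R * \sum_i (c (lift ord0 i))%:~R * xs i :> OK.
  by rewrite mulr_sumr; apply: eq_bigr => i _; rewrite mulrA /b rmorphM rmorphN.
have -> : \sum_i (c (lift ord0 i))%:~R * xs i = p%:R * y - (c ord0)%:~R * x :> OK.
  by rewrite -ey sumE addrC addKr.
have euv' : u%:~R * (c ord0)%:~R = 1 + p%:R * v%:~R :> OK.
  by rewrite -rmorphM euv rmorphD rmorphM rmorph1.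
transitivity (u%:~R * (c ord0)%:~R * x - p%:R * v%:~R * x); first by rewrite euv'; ring.
by ring.
Qed.

End FiniteQuotient.

Lemma OK_fin_quo (n : nat) : (0 < n)%N ->
  exists (N : nat) (L : 'I_N -> OK), forall x, exists i y, x = L i + n%:R * y.
Proof.
elim/ltn_ind: n => n IH n0; case: (ltnP 1 n) => n1; last first.
  have -> : n = 1%N by apply/eqP; rewrite eqn_leq n1.
  by exists 1%N, (fun _ => 0) => x; exists ord0, x; rewrite mul1r add0r.
have pp := pdiv_prime n1; set p := pdiv n in pp.
have en : n = (p * (n %/ p))%N by rewrite mulnC divnK // pdiv_dvd.
have m0 : (0 < n %/ p)%N by move: n0; rewrite {1}en muln_gt0 => /andP [].
have [N1 [L1 H1]] := OK_fin_prime pp.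
have [N2 [L2 H2]] := IH _ (ltn_Pdiv (prime_gt1 pp) n0) m0.
exists #|{: 'I_N1 * 'I_N2}|, (fun t => L1 (enum_val t).1 + p%:R * L2 (enum_val t).2) => x.
have [i [y ey]] := H1 x; have [j [z ez]] := H2 y.
exists (enum_rank (i, j)), z; rewrite enum_rankK /= ey ez [in RHS]en natrM; ring.
Qed.

End RingOfIntegers.

(** * Matrices with entries in a subring *)

Section SubringGeneration.
Variables (S A : comNzRingType) (phi : {rmorphism S -> A}) (R : A -> Prop).
Hypotheses (phiI : injective phi) (phiR : forall y, R (phi y))
  (Rphi : forall x, R x -> exists y, phi y = x).

Lemma map_mx_inj n : injective (fun X : 'M[S]_n => map_mx phi X).
Proof.
move=> X Y e; apply/matrixP => a b; apply: phiI.
by move/matrixP: e => /(_ a b); rewrite !mxE.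
Qed.

Lemma generates_rgen (k m : nat) :
  (exists g : 'I_k -> 'I_m -> 'M[A]_3, generates R g) <->
  (exists g : 'I_k -> 'I_m -> 'M[S]_3, rgen g).
Proof.
split=> [[g [gR gg]]|[g gg]].
  have /choice [g' g'P] : forall t : 'I_k * 'I_m * 'I_3 * 'I_3, exists y : S,
      phi y = g t.1.1.1 t.1.1.2 t.1.2 t.2 by move=> t; apply: Rphi.
  pose G i l : 'M[S]_3 := \matrix_(a, b) g' (i, l, a, b).
  have eG i l : map_mx phi (G i l) = g i l.
    by apply/matrixP => a b; rewrite !mxE; exact: (g'P (i, l, a, b)).
  exists G => x; have [|s [sR es]] := gg (fun l => map_mx phi (x l)).
    by move=> l a b; rewrite mxE.
  have [s' es'] : exists s', nc_map phi s' = s.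
    elim: s sR {es} => [|[c w] s IH] sR; first by exists [::].
    have [s' <-] := IH (fun p ps => sR p (mem_behead (s := (c, w) :: s) ps)).
    have /= [c' <-] := Rphi (sR _ (mem_head (c, w) s)); by exists ((c', w) :: s').
  exists s' => l; apply: map_mx_inj; rewrite map_ev es' es.
  by apply: eq_ev => i; rewrite eG.
exists (fun i l => map_mx phi (g i l)); split=> [i l a b|x xR]; first by rewrite mxE.
have /choice [x' x'P] : forall t : 'I_m * 'I_3 * 'I_3, exists y : S,
    phi y = x t.1.1 t.1.2 t.2 by move=> t; apply: Rphi.
have [s es] := gg (fun l => \matrix_(a, b) x' (l, a, b)).
exists (nc_map phi s); split=> [p /mapP [r _ ->]|l]; first exact: phiR.
apply: etrans (map_ev phi (fun i => g i l) s); rewrite es.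
by apply/matrixP => a b; rewrite !mxE -(x'P (l, a, b)).
Qed.

End SubringGeneration.

Lemma rgen_widen (A : comNzRingType) (j k m : nat) : (j <= k)%N ->
  (exists g : 'I_j -> 'I_m -> 'M[A]_3, rgen g) -> exists g : 'I_k -> 'I_m -> 'M[A]_3, rgen g.
Proof.
move=> jk [g gg].
exists (fun i => if insub (i : nat) is Some i' then g i' else fun _ => 0) => x.
apply: (@rowalg_sub _ _ _ _ (widen_ord jk)); have [s es] := gg x; exists s => l.
rewrite -es; apply: eq_ev => i /=; rewrite insubT //= => h; congr (g _ l).
exact: val_inj.
Qed.

(** * Maximal ideals and residue fields of the ring of integers *)

Section Transfer.
Variable K : fieldExtType rat.
Local Notation S := (OK K).
Local Notation vS := (val : S -> K).

Lemma OK_sub (x : K) : ringOfIntegers x -> exists y : S, val y = x.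
Proof. by move=> ix; have h : x \in @int_pred K by [apply/asboolP]; exists (exist _ x h). Qed.

Lemma OK_int (y : S) : ringOfIntegers (val y).
Proof. by apply/asboolP; apply: (valP y). Qed.

Lemma integers_add (x y : K) :
  ringOfIntegers x -> ringOfIntegers y -> ringOfIntegers (x + y).
Proof. by move=> /OK_sub [a <-] /OK_sub [b <-]; rewrite -(rmorphD vS); apply: OK_int. Qed.

Lemma integers_mul (x y : K) :
  ringOfIntegers x -> ringOfIntegers y -> ringOfIntegers (x * y).
Proof. by move=> /OK_sub [a <-] /OK_sub [b <-]; rewrite -(rmorphM vS); apply: OK_int. Qed.

Lemma ideal_maximal_residue (P : K -> Prop) (q : nat) :
  maximal_ideal (@ringOfIntegers K) P -> quotient_card (@ringOfIntegers K) P q ->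
  exists (F : finFieldType) (f : {rmorphism S -> F}), surj f /\ #|F| = q.
Proof.
move=> [[PR P0 PD PM] P1 Pmax] [s [sR sI sP]].
pose J (x : S) := P (val x).
have /choice [p pP] : forall x : S, exists i, P (val x - s i).
  by move=> x; apply: sP; apply: OK_int.
have /choice [s' s'P] : forall i, exists y : S, val y = s i by move=> i; apply: OK_sub.
have PN x : P x -> P (- x).
  move=> Px; rewrite -mulN1r; apply: PM => //.
  by have := OK_int (- 1 : S); rewrite (rmorphN vS) (rmorph1 vS).
have PB x y : P x -> P y -> P (x - y) by move=> Px Py; apply: PD => //; apply: PN.
have [F [f [sf _ cF]]] : exists (F : finFieldType) (f : {rmorphism S -> F}),
    [/\ surj f, forall x, f x = 0 <-> J x & #|F| = #|{: 'I_q}|].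
  apply: (@quotient_field S J 'I_q p s').
  - by move=> x y Jx Jy; rewrite /J (rmorphD vS); apply: PD.
  - by move=> r x Jx; rewrite /J (rmorphM vS); apply: PM => //; apply: OK_int.
  - by rewrite /J (rmorph1 vS).
  - move=> x nx; pose P' z := exists a b, [/\ P a, ringOfIntegers b & z = a + val x * b].
    have idP' : is_ideal (@ringOfIntegers K) P'.
      split.
      + move=> z [a [b [Pa Rb ->]]]; apply: integers_add (PR _ Pa) _.
        exact: integers_mul (OK_int x) Rb.
      + by exists 0, 0; split=> //; rewrite ?mulr0 ?addr0 //; apply: PR.
      + move=> z z' [a [b [Pa Rb ->]]] [c [d [Pc Rd ->]]]; exists (a + c), (b + d).
        by split; [exact: PD|exact: integers_add|ring].
      + move=> r z Rr [a [b [Pa Rb ->]]]; exists (r * a), (r * b).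
        by split; [exact: PM|exact: integers_mul|ring].
    have [|P'P|[a [b [Pa Rb e]]]] := Pmax P' idP'.
    + move=> z Pz; exists z, 0; split=> //; [exact: PR|by rewrite mulr0 addr0].
    + case: nx; apply: P'P; exists 0, 1; split=> //; last by rewrite mulr1 add0r.
      by have := OK_int (1 : S); rewrite (rmorph1 vS).
    have [b' eb] := OK_sub Rb; exists b'; rewrite -eb in e.
    rewrite /J (rmorphB vS) (rmorphM vS) (rmorph1 vS).
    rewrite (_ : _ - 1 = - a); first exact: PN.
    by rewrite [X in _ - X]e; ring.
  - by move=> i; apply/esym/sI; rewrite -s'P; apply: pP.
  move=> x y; rewrite /J (rmorphB vS); split=> [e|Pxy].
    rewrite (_ : _ - _ = (val x - s (p x)) - (val y - s (p y))); first exact: PB.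
    by rewrite e; ring.
  apply: sI; rewrite (_ : _ - _ = (val x - val y) - (val x - s (p x)) + (val y - s (p y))).
    by apply: PD => //; apply: PB.
  by ring.
by exists F, f; rewrite cF card_ord.
Qed.

(** The kernel of f. With it, minimality of the norm among maximal ideals bounds the order of every
    residue field from below. *)
Lemma residue_maximal_ideal (F : finFieldType) (f : {rmorphism S -> F}) : surj f ->
  exists P : K -> Prop, maximal_ideal (@ringOfIntegers K) P /\
    quotient_card (@ringOfIntegers K) P #|F|.
Proof.
move=> sf; pose P z := exists x : S, val x = z /\ f x = 0.
have PE (x : S) : P (val x) <-> f x = 0.
  by split=> [[y [/val_inj ->]]|fx] //; exists x.
exists P; split; last first.
  have /choice [r rP] := sf.
  exists (fun i => val (r (enum_val i))); split.
  - by move=> i; apply: OK_int.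
  - move=> i j; rewrite -(rmorphB vS) => /PE; rewrite rmorphB !rP => /eqP.
    by rewrite subr_eq0 => /eqP /enum_val_inj.
  move=> x /OK_sub [y <-]; exists (enum_rank (f y)).
  by rewrite -(rmorphB vS); apply/PE; rewrite rmorphB rP enum_rankK subrr.
split.
- split.
  + by move=> x [y [<- _]]; apply: OK_int.
  + by exists 0; rewrite (rmorph0 vS) rmorph0.
  + move=> x y [x' [<- fx]] [y' [<- fy]]; exists (x' + y').
    by rewrite (rmorphD vS) rmorphD fx fy addr0.
  + move=> r x /OK_sub [r' <-] [x' [<- fx]]; exists (r' * x').
    by rewrite (rmorphM vS) rmorphM fx mulr0.
- by rewrite -(rmorph1 vS) => /PE /eqP; rewrite rmorph1 oner_eq0.
move=> J [JR J0 JD JM] PJ.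
have [H|nH] := pselect (forall x, J x -> P x); first by left.
right; have [x [Jx nPx]] : exists x, J x /\ ~ P x.
  apply: contra_notP nH => nH x Jx; apply: contra_notP nH => nP; by exists x.
have [y ey] := OK_sub (JR x Jx); rewrite -{x}ey in Jx nPx.
have fy : f y != 0 by apply/eqP => /PE.
have [z ez] := sf (f y)^-1.
rewrite (_ : 1 = val z * val y + (1 - val z * val y)); last by ring.
apply: JD; first by apply: JM => //; apply: OK_int.
apply: PJ; exists (1 - z * y); split; first by rewrite (rmorphB vS) (rmorph1 vS) (rmorphM vS).
by rewrite rmorphB rmorph1 rmorphM ez mulVf ?subrr.
Qed.

Theorem min_gens_fk (P : K -> Prop) (q k m : nat) :
  maximal_ideal (@ringOfIntegers K) P -> quotient_card (@ringOfIntegers K) P q ->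
  (forall (P' : K -> Prop) (q' : nat), maximal_ideal (@ringOfIntegers K) P' ->
     quotient_card (@ringOfIntegers K) P' q' -> (q <= q')%N) ->
  (2 <= k)%N -> (1 <= m)%N ->
  min_gens_eq (@ringOfIntegers K) m k <-> fk (k - 1) q%:R < m%:R <= fk k q%:R.
Proof.
move=> Pmax Pq Pmin k2 m1.
have [F0 [f0 [sf0 cF0]]] := ideal_maximal_residue Pmax Pq.
have minF (F : finFieldType) (f : {rmorphism S -> F}) : surj f -> (#|F0| <= #|F|)%N.
  by move=> /residue_maximal_ideal [P' [P'max P'q]]; rewrite cF0; apply: Pmin P'q.
have tr j := generates_rgen (phi := vS : {rmorphism S -> K}) val_inj OK_int OK_sub j m.
have big j : (2 <= j)%N ->
    (exists g : 'I_j -> 'I_m -> 'M[K]_3, generates (@ringOfIntegers K) g) <-> m%:R <= fk j q%:R.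
  move=> j2; rewrite -cF0; apply: iff_trans (tr j) _.
  exact: (global_fk (@OK_char0 K) (@OK_dvd_nat K) (@OK_prime_nonunit K) (@OK_fin_quo K)).
have small j : (j <= 1)%N ->
    ~ exists g : 'I_j -> 'I_m -> 'M[K]_3, generates (@ringOfIntegers K) g.
  by move=> j1 /tr; apply: (global_small sf0).
rewrite /min_gens_eq big //; split=> [[-> nj]|/andP [lt ->]]; [rewrite andbT|split=> // j jk].
  (* For k = 2 the lower bound is [fk 1 = 0], and m is positive. *)
  case: (ltnP 2 k) => k3; last first.
    have -> : k = 2%N by apply/eqP; rewrite eqn_leq k3.
    by rewrite ltr0n.
  by rewrite real_ltNge ?num_real //; apply/negP => /big H; apply: (nj (k - 1)%N); [lia|apply: H; lia].
case: (leqP 2 j) => j2; last exact: small.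
move=> /tr g; have : m%:R <= fk (k - 1) q%:R; last by rewrite leNgt lt.
by apply/big; [lia|apply/tr; apply: rgen_widen g; lia].
Qed.

End Transfer.

(** * The rational integers *)

Section Integers.

Lemma int_dvd_nat (r : int) : r != 0 -> exists n : nat, (0 < n)%N /\ exists y, n%:R = r * y.
Proof.
move=> r0; exists `|r|%N; split; first by rewrite absz_gt0.
by exists (sgz r); rewrite pmulrn intz abszEsg mulrC.
Qed.

Lemma int_prime_nonunit p : prime p -> forall y : int, p%:R * y != 1.
Proof.
move=> /prime_gt1 p1 y; apply/eqP => /(congr1 absz); rewrite pmulrn intz abszM => /eqP.
by rewrite muln_eq1 /= => /andP [/eqP e _]; rewrite e in p1.
Qed.

Lemma int_fin_quo (n : nat) : (0 < n)%N ->
  exists (N : nat) (L : 'I_N -> int), forall x, exists i y, x = L i + n%:R * y.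
Proof.
case: n => // n _; exists n.+1, (fun i => i%:Z) => x.
have lt : (`|(x %% n.+1)%Z|%N < n.+1)%N by rewrite -ltz_nat gez0_abs ?modz_ge0 ?ltz_pmod.
exists (Ordinal lt), (x %/ n.+1)%Z.
by rewrite /= gez0_abs ?modz_ge0 // pmulrn intz mulrC addrC -divz_eq.
Qed.

Lemma fk_two_two : fk 2 2%:R = 768%:R.
Proof. by rewrite /fk /=; field. Qed.

Theorem int_two_gens (m : nat) :
  (exists g : 'I_2 -> 'I_m -> 'M[int]_3, generates (fun _ : int => True) g) <-> (m <= 768)%N.
Proof.
pose f0 : {rmorphism int -> 'F_2} := intr.
have sf0 : surj f0 by move=> y; exists (y : nat)%:Z; rewrite /f0 /= -[RHS]natr_Zp.
have minF (F : finFieldType) (f : {rmorphism int -> F}) : surj f -> (#|'F_2| <= #|F|)%N.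
  by rewrite card_Fp // => _; exact: q_gt1.
have char0 n : (0 < n)%N -> n%:R != 0 :> int by rewrite pnatr_eq0 -lt0n.
have tr := @generates_rgen int int idfun (fun _ => True) (fun _ _ e => e) (fun _ => I)
  (fun x _ => ex_intro _ x erefl) 2 m.
have H := @global_fk int char0 int_dvd_nat int_prime_nonunit int_fin_quo 'F_2 f0 2 m sf0 minF isT.
rewrite (card_Fp (isT : prime 2)) fk_two_two ler_nat in H.
exact: iff_trans tr H.
Qed.

End Integers.

Theorem mainTheorem16 :
  (forall (K : fieldExtType rat) (P : K -> Prop) (q : nat),
     maximal_ideal (@ringOfIntegers K) P ->
     quotient_card (@ringOfIntegers K) P q ->
     (forall (P' : K -> Prop) (q' : nat),
        maximal_ideal (@ringOfIntegers K) P' ->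
        quotient_card (@ringOfIntegers K) P' q' -> (q <= q')%N) ->
     forall k m : nat, (2 <= k)%N -> (1 <= m)%N ->
       (min_gens_eq (@ringOfIntegers K) m k <->
        fk (k - 1) q%:R < m%:R <= fk k q%:R))
  /\
  (forall m : nat, (1 <= m)%N ->
     ((exists g : 'I_2 -> 'I_m -> 'M[int]_3, generates (fun _ : int => True) g)
      <-> (m <= 768)%N)).
Proof.
split=> [K P q Pmax Pq Pmin k m k2 m1|m _]; last exact: int_two_gens.
exact: min_gens_fk Pmax Pq Pmin k2 m1.
Qed.
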